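(* Let $\xi\in\mathbb N^S$ be a finite configuration. For all $x\in\Omega$ and all $t>0$, $$\mathbb E_x\,D(\xi,x_t)=\widehat{\mathbb E}_\xi\,D(\xi_t,x).$$ As a consequence, for every $\theta>0$ the product measure $\bigotimes_{i\in S}\nu_\theta(dx_i)$ is invariant for the process $(x_t)_{t\ge0}$.
   Context: $\mathbb N=\{0,1,2,\dots\}$. $S$ is a (finite or countably infinite) set of vertices, and $p(i,j)$ is an irreducible symmetric random walk kernel on $S$: $p(i,j)=p(j,i)\ge0$, $\sum_jp(i,j)=1$, and for all $i,j\in S$ there is $n$ with $p^{(n)}(i,j)>0$. All sums over $i,j$ below are over ordered pairs of distinct vertices. Continuous process: $\Omega=[0,\infty)^S$, and $(x_t)_{t\ge0}$ is the Markov process on $\Omega$ with generator $$Lf(x)=\sum_{i,j}p(i,j)\int_0^1\int_0^1\big(f(x^{ij;uv})-f(x)\big)\,du\,dv,$$ where $x^{ij;uv}_k=x_k$ for $k\notin\{i,j\}$, $x^{ij;uv}_i=x_i(1-u)+x_jv$, $x^{ij;uv}_j=x_j(1-v)+x_iu$. $\mathbb E_x$ is expectation for this process started from $x$. Dual process: a configuration $\xi\in\mathbb N^S$ is finite if $|\xi|=\sum_{i\in S}\xi_i<\infty$. $(\xi_t)_{t\ge0}$ is the Markov process on configurations with generator $$\mathcal Lf(\xi)=\sum_{i,j}p(i,j)\sum_{K=0}^{\xi_i}\sum_{M=0}^{\xi_j}\frac{1}{(\xi_i+1)(\xi_j+1)}\big(f(\xi^{ij;KM})-f(\xi)\big),$$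 where $\xi^{ij;KM}_k=\xi_k$ for $k\notin\{i,j\}$, $\xi^{ij;KM}_i=\xi_i-K+M$, $\xi^{ij;KM}_j=\xi_j-M+K$. $\widehat{\mathbb E}_\xi$ is expectation for this process started from $\xi$. Duality polynomials: $D(\xi,x)=\prod_{i\in S}d(\xi_i,x_i)$ with $d(n,z)=\dfrac{z^n}{(n+1)!}$. $\nu_\theta(dz)=\theta^{-2}\,z\,e^{-z/\theta}\,dz$ on $[0,\infty)$ is the Gamma distribution with shape $2$ and scale $\theta$. *)

(* Defs.v *)
From HB Require Import structures.
From mathcomp Require Import all_boot all_order all_algebra finmap.
From mathcomp Require Import all_classical all_reals all_analysis measurable_realfun.

Set Implicit Arguments.
Unset Strict Implicit.
Unset Printing Implicit Defensive.
Import Order.TTheory GRing.Theory Num.Theory.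
Import numFieldNormedType.Exports.

Local Open Scope classical_set_scope.
Local Open Scope ring_scope.

Fixpoint kernel_iter {R : realType} {S : countType} (p : S -> S -> R) (n : nat)
    (i j : S) : \bar R :=
  if n is m.+1 then (\esum_(k in setT) ((p i k)%:E * kernel_iter p m k j))%E
  else ((i == j)%:R)%:E.

Record symmetric_irreducible {R : realType} {S : countType} (p : S -> S -> R)
    : Prop := {
  kernel_sym : forall i j, p i j = p j i ;
  kernel_ge0 : forall i j, 0 <= p i j ;
  kernel_sum1 : forall i, (\esum_(j in setT) (p i j)%:E = 1)%E ;
  kernel_irr : forall i j, exists n, (0 < kernel_iter p n i j)%E }.

Definition cylinders (S : Type) {d : measure_display} (E : measurableType d)
    : set (set (S -> E)) :=
  [set A | exists i (B : set E),
     measurable B /\ A = (fun x : S -> E => x i) @^-1` B].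

(* [S -> E] with the product sigma-algebra *)
Definition config (S : Type) {d : measure_display} (E : measurableType d) :=
  g_sigma_algebraType (@cylinders S d E).

Definition local_fun {R : realType} {S : countType} {d : measure_display}
    {E : measurableType d} (f : config S E -> R) : Prop :=
  exists A : {fset S},
    forall x y, (forall i, i \in A -> x i = y i) -> f x = f y.

Definition test_fun {R : realType} {S : countType} {d : measure_display}
    {E : measurableType d} (f : config S E -> R) : Prop :=
  [/\ measurable_fun setT f, local_fun f & exists M, forall x, `|f x| <= M].

(** Markov processes with values in a subset [Om] of a measurable space:
    [X] is the process, [Pr x] the law under which it starts from [x]. *)

Definition past {R : realType} {dT dW : measure_display}
    {T : measurableType dT} {W : measurableType dW} (X : R -> W -> T) (s : R)
    : set (set W) :=
  <<s [set C | exists (r : R) (B : set T),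
         [/\ 0 <= r, r <= s, measurable B & C = X r @^-1` B]] >>.

Record markov_process {R : realType} {dT dW : measure_display}
    {T : measurableType dT} {W : measurableType dW} (Om : set T)
    (Pr : T -> probability W R) (X : R -> W -> T) : Prop := {
  mp_measurable : forall t : R, 0 <= t -> measurable_fun setT (X t) ;
  mp_state : forall (t : R) w, 0 <= t -> Om (X t w) ;
  mp_start : forall x, Om x -> {ae Pr x, forall w, X 0 w = x} ;
  mp_kernel : forall (t : R) (A : set T), 0 <= t -> measurable A ->
    measurable_fun Om (fun x => Pr x (X t @^-1` A) : \bar R) ;
  mp_markov : forall x (s t : R) (F : set W) (A : set T),
    Om x -> 0 <= s -> 0 <= t -> past X s F -> measurable A ->
    (Pr x (F `&` X (s + t)%R @^-1` A) =
     \int[Pr x]_(w in F) Pr (X s w) (X t @^-1` A))%E }.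

(* Meaningful for bounded measurable [f], where the expectation is finite. *)
Definition semigroup {R : realType} {dT dW : measure_display}
    {T : measurableType dT} {W : measurableType dW}
    (Pr : T -> probability W R) (X : R -> W -> T) (t : R) (f : T -> R) (x : T)
    : R := fine ('E_(Pr x)[fun w => f (X t w)])%E.

(* [L] is the infinitesimal generator on the bounded measurable functions of
   finitely many coordinates. Both generators below have bounded rates per
   site, so these functions are in the domain and determine the semigroup. *)
Definition has_generator {R : realType} {S : countType}
    {dE dW : measure_display} {E : measurableType dE} {W : measurableType dW}
    (Om : set (config S E)) (Pr : config S E -> probability W R)
    (X : R -> W -> config S E)
    (L : (config S E -> R) -> config S E -> R) : Prop :=
  forall f, test_fun f ->
    {uniform Om, (fun t x => (semigroup Pr X t f x - f x) / t) @ 0^'+ --> L f}.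

Definition invariant_measure {R : realType} {dT dW : measure_display}
    {T : measurableType dT} {W : measurableType dW} (Om : set T)
    (Pr : T -> probability W R) (X : R -> W -> T) (mu : probability T R)
    : Prop :=
  forall (t : R) (A : set T), 0 <= t -> measurable A ->
    (\int[mu]_(x in Om) Pr x (X t @^-1` A) = mu A)%E.

(* Unordered sum, meaningful when [a] is absolutely summable on [D]. In the
   generators this holds for bounded local functions: only pairs meeting the
   support contribute, with total rate at most twice its cardinal. *)
Definition rsum {R : realType} {I : choiceType} (D : set I) (a : I -> R) : R :=
  fine (\esum_(k in D) (EFin \o a)^\+ k - \esum_(k in D) (EFin \o a)^\- k)%E.

Definition pair_sum {R : realType} {S : countType} (a : S -> S -> R) : R :=
  rsum [set ij : S * S | ij.1 != ij.2] (fun ij => a ij.1 ij.2).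

Definition Omega (R : realType) (S : countType) : set (config S R) :=
  [set x | forall i, 0 <= x i].
Arguments Omega : clear implicits.

Definition exchange {R : realType} {S : countType} (x : config S R) (i j : S)
    (u v : R) : config S R :=
  fun k => if k == i then x i * (1 - u) + x j * v
           else if k == j then x j * (1 - v) + x i * u
           else x k.

Definition exch_gen {R : realType} {S : countType} (p : S -> S -> R)
    (f : config S R -> R) (x : config S R) : R :=
  pair_sum (fun i j => p i j *
    \int[lebesgue_measure]_(u in `[0%R, 1%R])
      \int[lebesgue_measure]_(v in `[0%R, 1%R])
        (f (exchange x i j u v) - f x)).

Definition dual_exchange {S : countType} (xi : config S nat) (i j : S)
    (K M : nat) : config S nat :=
  fun k => if k == i then (xi i - K + M)%N
           else if k == j then (xi j - M + K)%N
           else xi k.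

Definition dual_gen {R : realType} {S : countType} (p : S -> S -> R)
    (f : config S nat -> R) (xi : config S nat) : R :=
  pair_sum (fun i j => p i j *
    \sum_(K < (xi i).+1) \sum_(M < (xi j).+1)
      ((xi i).+1%:R * (xi j).+1%:R)^-1 * (f (dual_exchange xi i j K M) - f xi)).

Definition finite_config (R : realType) {S : countType} (xi : config S nat)
    : Prop := (\esum_(i in setT) ((xi i)%:R : R)%:E < +oo)%E.

Definition dpol {R : realType} (n : nat) (z : R) : R := z ^+ n / (n.+1)`!%:R.

(* As [dpol 0 z = 1], the product has finitely many factors different from 1
   when [xi] is finite. *)
Definition dual_poly {R : realType} {S : countType} (xi : config S nat)
    (x : config S R) : R :=
  \big[*%R/1]_(i \in [set: S]) dpol (xi i) (x i).

Definition gamma2 {R : realType} (theta : R) (B : set R) : \bar R :=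
  (\int[lebesgue_measure]_(z in B `&` `[0%R, +oo[)
     (theta ^- 2 * z * expR (- z / theta))%:E)%E.

(* The finite-dimensional marginals characterise the product measure. *)
Definition is_product_measure {R : realType} {S : countType}
    {d : measure_display} {E : measurableType d} (nu : set E -> \bar R)
    (mu : probability (config S E) R) : Prop :=
  forall (A : {fset S}) (B : S -> set E), (forall i, measurable (B i)) ->
    (mu [set x : config S E | forall i, i \in A -> B i (x i)] =
     \prod_(i <- A) nu (B i))%E.

(* Main.v *)
(** Averaging D(xi, .) over the two uniform variables of an exchange gives the
    average of D over the dual exchanges of xi, by a binomial expansion and Beta
    integrals. As D is unbounded and the generator is known only on bounded local
    functions, this identity enters through truncations, as one-sided
    comparisons. On configurations with at most N particles the dual generator
    plus lam = 2 N + 1 is a positive bounded operator G, and with L the generator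
    of the continuous process
      (L + lam) min(D(xi, .), C) (x) <= G min(D(., x), (N + 1)^2 C) (xi),
      (L + lam) D(xi, . /\ m) (x) >= G D(., x /\ (m / 2)) (xi).
    Iterating the forward equation n times bounds exp(lam t) E_x D(xi, x_t) from
    both sides by partial sums of the exponential series of G; the truncation
    levels change by factors (N + 1)^(2n) and 2^n, which the factor t^n / n! of
    the last term absorbs. The same series describes the dual side, and letting
    n and then the truncation level tend to infinity gives the duality.

    That the dual process stays among the configurations with at most N particles
    comes from uniqueness for the forward equation on bounded local functions: a
    function of a sites evolves into functions of at most as many sites as a
    branching process with splitting rate 2 has particles.

    Invariance is obtained without moments. If a has law Gamma(2) and u is
    uniform, then a u and a (1 - u) are independent exponential variables, so an
    exchange decomposes two Gamma variables into four independent exponentials and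
    recombines them in pairs. Hence every exchange preserves the product measure,
    the generator integrates to zero, and uniqueness for the forward equation
    concludes. *)

Require Import Defs.
From HB Require Import structures.
From mathcomp Require Import all_boot all_order all_algebra finmap.
From mathcomp Require Import all_classical all_reals all_analysis measurable_realfun.
From mathcomp Require unstable.
From mathcomp Require Import giry ring lra zify.

Set Implicit Arguments.
Unset Strict Implicit.
Unset Printing Implicit Defensive.
Import Order.TTheory GRing.Theory Num.Theory.
Import numFieldNormedType.Exports.

Local Open Scope classical_set_scope.
Local Open Scope ring_scope.

(** * Expectations under a sub-probability and the Markov semigroup *)

(** The expectations of D may a priori be infinite, so both sides of the duality are kept as
    integrals with values in [0, +oo] and compared by two inequalities. Truncation does not commute
    with averaging over an exchange, but it loses something in one direction only; positivity of G
    is what allows such an inequality to be iterated. The size of lam comes from the support: at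
    most N particles occupy at most N sites, and the ordered pairs meeting one site have total rate
    at most 2.

    A second obstacle is that S may be infinite. The generators are then infinite sums, and G f of a
    local f is no longer local. Both difficulties are met by one device: a finite set of pairs,
    chosen from the support and the bound alone, approximates the pair sum uniformly over all
    admissible increments, so that identities are checked on finite sums and passed to the limit.

    The estimate behind uniqueness is Markov's inequality for the branching process, whose mean at
    time t is (a + 1) exp(2 t) when it starts from a + 1 particles. *)

Section bounded_expectation.
Context {d} {T : measurableType d} {R : realType}.
Variable D : set T.
Hypothesis mD : measurable D.
Implicit Types (m : giry T R) (f g : T -> R).

(** On this class the real-valued integral under a sub-probability is linear and monotone, so
    integrability never has to be tracked separately. *)
Definition bmeas f :=
  measurable_fun D f /\ exists M, forall x, D x -> `|f x| <= M.

Definition Ex m f := \int[m]_(x in D) f x.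

Lemma bmeas_integrable m f : bmeas f -> m.-integrable D (EFin \o f).
Proof.
move=> [mf [M fM]]; apply: measurable_bounded_integrable => //.
  apply: (@le_lt_trans _ _ 1%E); last exact: ltey.
  apply: le_trans (@sprobability_setT _ _ _ m).
  by apply: le_measure; rewrite ?inE.
exists M; split; first exact: num_real.
by move=> r Mr x Dx /=; apply: le_trans (fM x Dx) (ltW Mr).
Qed.

Lemma bmeas_cst c : bmeas (fun=> c).
Proof. by split; [exact: measurable_cst|exists `|c|]. Qed.

Lemma bmeasD f g : bmeas f -> bmeas g -> bmeas (fun x => f x + g x).
Proof.
move=> [mf [M fM]] [mg [M' gM]]; split; first exact: measurable_funD.
exists (M + M') => x Dx.
by rewrite (le_trans (ler_normD _ _))// lerD ?fM ?gM.
Qed.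

Lemma bmeasZ c f : bmeas f -> bmeas (fun x => c * f x).
Proof.
move=> [mf [M fM]]; split; first exact: measurable_funM.
by exists (`|c| * M) => x Dx; rewrite normrM ler_wpM2l// fM.
Qed.

Lemma bmeasB f g : bmeas f -> bmeas g -> bmeas (fun x => f x - g x).
Proof.
move=> bf bg; have := bmeasD bf (bmeasZ (-1) bg).
by congr bmeas; apply/funext => x; rewrite mulN1r.
Qed.

Lemma bmeas_sum (I : eqType) (s : seq I) (F : I -> T -> R) :
  (forall i, i \in s -> bmeas (F i)) -> bmeas (fun x => \sum_(i <- s) F i x).
Proof.
elim: s => [|i s ih] bF.
  by under eq_fun do rewrite big_nil; exact: bmeas_cst.
under eq_fun do rewrite big_cons; apply: bmeasD.
  by apply: bF; rewrite mem_head.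
by apply: ih => j js; apply: bF; rewrite in_cons js orbT.
Qed.

Lemma ExD m f g : bmeas f -> bmeas g ->
  Ex m (fun x => f x + g x) = Ex m f + Ex m g.
Proof. by move=> bf bg; apply: RintegralD => //; exact: bmeas_integrable. Qed.

Lemma ExZ m c f : bmeas f -> Ex m (fun x => c * f x) = c * Ex m f.
Proof. by move=> bf; apply: RintegralZl => //; exact: bmeas_integrable. Qed.

Lemma ExB m f g : bmeas f -> bmeas g ->
  Ex m (fun x => f x - g x) = Ex m f - Ex m g.
Proof. by move=> bf bg; apply: RintegralB => //; exact: bmeas_integrable. Qed.

Lemma Ex_sum m (I : eqType) (s : seq I) (F : I -> T -> R) :
  (forall i, i \in s -> bmeas (F i)) ->
  Ex m (fun x => \sum_(i <- s) F i x) = \sum_(i <- s) Ex m (F i).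
Proof.
elim: s => [|i s ih] bF.
  under [X in Ex m X]eq_fun do rewrite big_nil.
  by rewrite big_nil /Ex Rintegral_cst// mul0r.
have bs : forall j, j \in s -> bmeas (F j).
  by move=> j js; apply: bF; rewrite in_cons js orbT.
under [X in Ex m X]eq_fun do rewrite big_cons.
by rewrite big_cons ExD ?ih//; [apply: bF; rewrite mem_head|exact: bmeas_sum].
Qed.

Lemma eq_Ex m f g : (forall x, D x -> f x = g x) -> Ex m f = Ex m g.
Proof. by move=> fg; apply: eq_Rintegral => x /set_mem; exact: fg. Qed.

Lemma Ex_le m f g : bmeas f -> bmeas g -> (forall x, D x -> f x <= g x) ->
  Ex m f <= Ex m g.
Proof.
by move=> bf bg fg; apply: le_Rintegral => //; exact: bmeas_integrable.
Qed.

Lemma Ex_cst_le m c : 0 <= c -> Ex m (fun=> c) <= c.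
Proof.
move=> c0; rewrite /Ex Rintegral_cst// ler_piMr//.
rewrite -lee_fin fineK ?fin_num_measure//.
apply: le_trans (@sprobability_setT _ _ _ m).
by apply: le_measure; rewrite ?inE.
Qed.

Lemma Ex_le_cst m f c : 0 <= c -> bmeas f -> (forall x, D x -> f x <= c) ->
  Ex m f <= c.
Proof.
move=> c0 bf fc; apply: le_trans (Ex_cst_le m c0).
by apply: Ex_le => //; exact: bmeas_cst.
Qed.

Lemma Ex_norm_le m f c : 0 <= c -> bmeas f -> (forall x, D x -> `|f x| <= c) ->
  `|Ex m f| <= c.
Proof.
move=> c0 bf fc; rewrite ler_norml; apply/andP; split; last first.
  by apply: Ex_le_cst => // x Dx; rewrite (le_trans (ler_norm _))// fc.
have -> : Ex m f = - Ex m (fun x => -1 * f x) by rewrite ExZ// mulN1r opprK.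
rewrite lerN2; apply: Ex_le_cst => //; first exact: bmeasZ.
by move=> x Dx; rewrite mulN1r (le_trans (ler_norm _))// normrN fc.
Qed.

Lemma Ex_ret x f : D x -> bmeas f -> Ex (giry_ret x) f = f x.
Proof.
move=> Dx [mf _]; rewrite /Ex /Rintegral integral_dirac//.
  by rewrite diracE mem_set// mul1e.
exact/measurable_EFinP.
Qed.

Lemma giry_ret_supp x : D x -> (giry_ret x : giry T R) (~` D) = 0%E.
Proof. by move=> Dx; rewrite /giry_ret /= diracE memNset//= => nDx. Qed.

(* A bound valid up to a uniform error survives integration because the total
   mass is at most 1. *)
Lemma Ex_close m f g e : 0 <= e -> bmeas f -> bmeas g ->
  (forall x, D x -> `|f x - g x| <= e) -> `|Ex m f - Ex m g| <= e.
Proof.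
by move=> e0 bf bg fg; rewrite -ExB//; apply: Ex_norm_le => //; exact: bmeasB.
Qed.

End bounded_expectation.

Lemma Ex_restrict {d} {T : measurableType d} {R : realType} (D : set T)
    (m : giry T R) (f : T -> R) :
  measurable D -> m (~` D) = 0%E -> bmeas setT f -> Ex setT m f = Ex D m f.
Proof.
move=> mD m0 bf; rewrite /Ex /Rintegral.
rewrite (@negligible_integral _ _ _ _ setT (~` D))//.
- by rewrite setTD setCK.
- exact: measurableC.
- exact: bmeas_integrable.
Qed.

Section markov_flow.
Context {R : realType} {dT dW : measure_display}
  {T : measurableType dT} {W : measurableType dW}.
Variables (Om : set T) (Pr : T -> probability W R) (X : R -> W -> T).
Hypothesis mOm : measurable Om.
Hypothesis hX : markov_process Om Pr X.
Implicit Types (t s : R) (x : T) (f : T -> R) (m : giry T R).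

Let mX t : measurable_fun setT (X `|t|) := mp_measurable hX (normr_ge0 t).

(* Outside [Om] nothing is known about [Pr]: the kernel is made total by
   freezing the process there; likewise [X t] is replaced with [X `|t|]. *)
Definition transition t x : giry T R :=
  if `[< Om x >] then giry_map (mX t) (Pr x : subprobability W R)
  else giry_ret x.

Lemma transitionE t x A : Om x -> transition t x A = Pr x (X `|t| @^-1` A).
Proof. by move=> Ox; rewrite /transition asboolT. Qed.

Lemma measurable_transition t : measurable_fun setT (transition t).
Proof.
apply: measurable_giry_codensity => // B mB.
rewrite -(setvU Om); apply/measurable_funU => //; first exact: measurableC.
split.
  apply: (eq_measurable_fun (fun x => \d_x B)); last first.
    exact: measurable_funTS (measurable_fun_dirac mB).
  by move=> x; rewrite inE => nOx; rewrite /transition asboolF.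
apply: (eq_measurable_fun (fun x => Pr x (X `|t| @^-1` B))).
  by move=> x; rewrite inE => Ox; rewrite transitionE.
exact: (mp_kernel hX).
Qed.

(** Law at time t from the initial law [m]. Duality uses Dirac initial laws, invariance uses the
    product measure. *)
Definition flow m t : giry T R := giry_bind m (measurable_transition t).

Lemma flowE m t A : measurable A -> flow m t A = (\int[m]_x transition t x A)%E.
Proof.
move=> mA; have m1 : measurable_fun setT (fun x : T => ((\1_A x : R)%:E)).
  exact/measurable_EFinP/measurable_indic.
have -> : flow m t A = giry_int (flow m t) (fun x => (\1_A x)%:E).
  by rewrite /giry_int integral_indic// setIT.
rewrite /flow giry_int_bind//.
by apply: eq_integral => x _; rewrite /giry_int integral_indic// setIT.
Qed.

Lemma transition_supp t x : Om x -> transition t x (~` Om) = 0%E.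
Proof.
move=> Ox; rewrite transitionE//.
rewrite (_ : _ @^-1` _ = set0) ?measure0// -subset0 => w /=.
by apply; exact: (mp_state hX).
Qed.

Lemma giry_int_supp m (h : T -> \bar R) : m (~` Om) = 0%E ->
  measurable_fun setT h -> (forall x, (0 <= h x)%E) ->
  giry_int m h = (\int[m]_(x in Om) h x)%E.
Proof.
move=> m0 mh h0; rewrite /giry_int (ge0_negligible_integral _ _ _ _ m0)//.
- by rewrite setTD setCK.
- exact: measurableC.
Qed.

Lemma flow_supp m t : m (~` Om) = 0%E -> flow m t (~` Om) = 0%E.
Proof.
move=> m0; rewrite flowE; last exact: measurableC.
rewrite -/(giry_int m _) giry_int_supp//; last first.
  exact: (measurableT_comp (measurable_giry_ev (measurableC mOm))
    (measurable_transition t)).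
by apply: integral0_eq => x Ox; rewrite transition_supp.
Qed.

Lemma semigroupE t f x : 0 <= t -> Om x -> bmeas Om f ->
  semigroup Pr X t f x = Ex Om (transition t x) f.
Proof.
move=> t0 Ox bf; rewrite /semigroup /Ex /Rintegral; congr fine.
rewrite unlock /transition asboolT//.
rewrite (_ : (\int[_]_(y in Om) _)%E =
  (\int[pushforward (Pr x) (X `|t|)]_(y in Om) (f y)%:E)%E)//.
have XOm : X `|t| @^-1` Om = setT.
  by rewrite -subTset => w _ /=; exact: (mp_state hX).
have mf : measurable_fun Om (EFin \o f) by apply/measurable_EFinP; exact: bf.1.
rewrite integralE [RHS]integralE !ge0_integral_pushforward//.
- by rewrite XOm (ger0_norm t0); congr (_ - _)%E; apply: eq_integral => w _;
    rewrite [RHS]/= ?funeposE ?funenegE.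
- by apply: measurable_funeneg; exact: mf.
- by apply: measurable_funepos; exact: mf.
Qed.

Lemma bmeas_semigroup t f : 0 <= t -> bmeas Om f ->
  bmeas Om (semigroup Pr X t f).
Proof.
move=> t0 bf.
(* Measurability of integrals against a kernel is available for nonnegative integrands; a bounded
   [f] is shifted by its bound [M]. *)
suff Hpos g : bmeas Om g -> (forall x, Om x -> 0 <= g x) ->
    measurable_fun Om (fun x => Ex Om (transition t x) g).
  have [M fM] := bf.2; have M0 : bmeas Om (fun=> M) by exact: bmeas_cst.
  split; last first.
    exists `|M| => x Ox; rewrite semigroupE//; apply: Ex_norm_le => // y Oy.
    by rewrite (le_trans (fM y Oy))// ler_norm.
  apply: (@eq_measurable_fun _ _ _ _ _ (fun x => Ex Om (transition t x)
    (fun y => f y + M) - Ex Om (transition t x) (fun=> M))).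
    move=> x; rewrite inE => Ox; rewrite semigroupE// ExD//.
    by rewrite addrK.
  apply: measurable_funB; apply: Hpos.
  - exact: bmeasD.
  - by move=> x Ox; have := fM x Ox; rewrite ler_norml => /andP[]; lra.
  - by [].
  - by move=> x Ox; apply: le_trans (fM x Ox).
move=> bg g0.
pose h : T -> \bar R := (EFin \o g) \_ Om.
have mh : measurable_fun setT h.
  by apply/(measurable_restrictT _ _).1 => //; apply/measurable_EFinP; exact: bg.1.
have h0 x : (0 <= h x)%E.
  by rewrite /h patchE; case: ifPn => //; rewrite inE => Ox; rewrite lee_fin g0.
apply: (eq_measurable_fun (fun x => fine (giry_int (transition t x) h))).
  move=> x; rewrite inE => Ox; rewrite /Ex /Rintegral; congr fine.
  by rewrite /giry_int /h -integral_mkcond.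
apply: measurableT_comp => //; apply: measurable_funTS.
exact: (measurableT_comp (measurable_giry_int mh h0)
  (measurable_transition t)).
Qed.

Lemma Ex_flow m t f : 0 <= t -> m (~` Om) = 0%E -> bmeas Om f ->
  Ex Om (flow m t) f = Ex Om m (semigroup Pr X t f).
Proof.
move=> t0 m0 bf.
suff Hpos g : bmeas Om g -> (forall x, Om x -> 0 <= g x) ->
    Ex Om (flow m t) g = Ex Om m (semigroup Pr X t g).
  have [M fM] := bf.2; have bM : bmeas Om (fun=> M) by exact: bmeas_cst.
  have -> : Ex Om (flow m t) f = Ex Om (flow m t) (fun y => f y + M)
      - Ex Om (flow m t) (fun=> M) by rewrite ExD// addrK.
  have bfM := bmeasD bf bM.
  have -> : Ex Om m (semigroup Pr X t f) = Ex Om m (fun x =>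
      semigroup Pr X t (fun y => f y + M) x - semigroup Pr X t (fun=> M) x).
    by apply: eq_Ex => x Ox; rewrite !semigroupE// ExD// addrK.
  rewrite ExB//; try exact: bmeas_semigroup.
  rewrite !Hpos//.
  - by move=> x Ox; apply: le_trans (fM x Ox).
  - by move=> x Ox; have := fM x Ox; rewrite ler_norml => /andP[]; lra.
move=> bg g0.
pose h : T -> \bar R := (EFin \o g) \_ Om.
have mh : measurable_fun setT h.
  by apply/(measurable_restrictT _ _).1 => //; apply/measurable_EFinP; exact: bg.1.
have h0 x : (0 <= h x)%E.
  by rewrite /h patchE; case: ifPn => //; rewrite inE => Ox; rewrite lee_fin g0.
rewrite /Ex /Rintegral; congr fine.
rewrite [LHS]integral_mkcond -/h -/(giry_int _ h) giry_int_bind//.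
rewrite giry_int_supp//; last first.
  by move=> x; apply: integral_ge0.
  exact: (measurableT_comp (measurable_giry_int mh h0)
    (measurable_transition t)).
apply: eq_integral => x; rewrite inE => Ox; rewrite semigroupE//.
rewrite /Ex /Rintegral fineK; last first.
  by apply: integrable_fin_num => //; exact: bmeas_integrable.
by rewrite /giry_int /h -integral_mkcond.
Qed.

(** The Chapman-Kolmogorov equation, from the Markov property with the trivial past event [setT]. *)
Lemma transition_flow s t x A : 0 <= s -> 0 <= t -> Om x -> measurable A ->
  transition (s + t) x A = flow (transition s x) t A.
Proof.
move=> s0 t0 Ox mA; rewrite transitionE// ger0_norm ?addr_ge0//.
have := @mp_markov _ _ _ _ _ _ _ _ hX x s t setT A Ox s0 t0.
rewrite setTI => ->//; last first.
  rewrite -setC0; apply: sigma_algebraC; exact: sigma_algebra0.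
rewrite flowE//.
have mtr : measurable_fun setT (fun y => transition t y A).
  exact: (measurableT_comp (measurable_giry_ev mA) (measurable_transition t)).
have -> : transition s x = giry_map (mX s) (Pr x : subprobability W R).
  by rewrite /transition asboolT.
rewrite (_ : (\int[giry_map _ _]_y _)%E =
  (\int[pushforward (Pr x) (X `|s|)]_y transition t y A)%E)//.
rewrite ge0_integral_pushforward// preimage_setT (ger0_norm s0).
apply: eq_integral => w _ /=; rewrite transitionE ?(ger0_norm t0)//.
exact: (mp_state hX).
Qed.

Lemma semigroupD s t f x : 0 <= s -> 0 <= t -> Om x -> bmeas Om f ->
  semigroup Pr X (s + t) f x = semigroup Pr X s (semigroup Pr X t f) x.
Proof.
move=> s0 t0 Ox bf.
have bs := bmeas_semigroup t0 bf.
rewrite semigroupE ?addr_ge0// [RHS]semigroupE//.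
rewrite -Ex_flow//; last exact: transition_supp.
rewrite /Ex /Rintegral; congr fine; apply: eq_measure_integral => A mA _.
exact: transition_flow.
Qed.

Lemma Ex_flowD m s t f : 0 <= s -> 0 <= t -> m (~` Om) = 0%E -> bmeas Om f ->
  Ex Om (flow m (s + t)) f = Ex Om (flow m s) (semigroup Pr X t f).
Proof.
move=> s0 t0 m0 bf; have bs := bmeas_semigroup t0 bf.
rewrite Ex_flow ?addr_ge0// Ex_flow//.
by apply: eq_Ex => x Ox; exact: semigroupD.
Qed.

Lemma semigroup0 f x : Om x -> bmeas Om f -> semigroup Pr X 0 f x = f x.
Proof.
move=> Ox bf; rewrite /semigroup unlock.
have mf : measurable_fun Om (EFin \o f) by apply/measurable_EFinP; exact: bf.1.
rewrite (@ae_eq_integral _ _ _ (Pr x) setT (fun=> (f x)%:E))//.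
- rewrite integral_cst// [X in (_ * X)%E](_ : _ = 1%E) ?mule1//; exact: probability_setT.
- apply: (measurable_comp mOm _ mf (mp_measurable hX (lexx 0))) => _ [w _ <-].
  exact: (mp_state hX).
- by apply: filterS (mp_start hX Ox) => w ->.
Qed.

Lemma Ex_flow0 m f : m (~` Om) = 0%E -> bmeas Om f ->
  Ex Om (flow m 0) f = Ex Om m f.
Proof.
by move=> m0 bf; rewrite Ex_flow//; apply: eq_Ex => x Ox; exact: semigroup0.
Qed.

End markov_flow.

(** * The forward equation *)

Section uniform_right_derivative.
Context {R : realType}.
Implicit Types (t h e s : R).
Variables (phi psi : R -> R) (C : R).
Hypothesis psi_bounded : forall t, 0 <= t -> `|psi t| <= C.
Hypothesis right_deriv : forall e, 0 < e -> exists2 del : R, 0 < del &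
  forall t h, 0 <= t -> 0 < h -> h < del ->
  `|phi (t + h) - phi t - h * psi t| <= e * h.

(** The uniform error bound with e = 1 already gives a Lipschitz estimate at small distances. *)
Let phi_lip : exists2 del : R, 0 < del & forall s t, 0 <= s -> 0 <= t ->
  `|s - t| < del -> `|phi s - phi t| <= (C + 1) * `|s - t|.
Proof.
have [del del0 H] := right_deriv ltr01; exists del => // s t s0 t0.
wlog ts : s t s0 t0 / t < s => [W|].
  have [st|ts|->] := ltgtP s t; last by rewrite !subrr normr0 mulr0.
    by rewrite distrC (distrC (phi s)); exact: W.
  exact: W.
rewrite gtr0_norm ?subr_gt0// => std.
have := H t (s - t) t0; rewrite subr_gt0 => /(_ ts std).
rewrite (addrC t) subrK mul1r => {}H.
have -> : phi s - phi t = (phi s - phi t - (s - t) * psi t) + (s - t) * psi t.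
  by rewrite subrK.
rewrite (le_trans (ler_normD _ _))//.
have -> : (C + 1) * (s - t) = (s - t) + (s - t) * C by ring.
rewrite lerD// normrM gtr0_norm ?subr_gt0// ler_wpM2l ?psi_bounded//.
by rewrite subr_ge0 ltW.
Qed.

(** Both [psi s] and [psi t] are close to difference quotients of [phi] with the same increment h,
    and the Lipschitz bound makes these quotients close once |s - t| is small compared with h. *)
Let psi_cont e : 0 < e -> exists2 del : R, 0 < del & forall s t, 0 <= s -> 0 <= t ->
  `|s - t| < del -> `|psi s - psi t| <= e.
Proof.
move=> e0; have e40 : 0 < e / 4 by rewrite divr_gt0.
have [d1 d10 H] := right_deriv e40.
have [d2 d20 K] := phi_lip.
pose h := d1 / 2.
have h0 : 0 < h by rewrite divr_gt0.
have hd : h < d1 by rewrite /h; lra.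
have C0 : 0 <= C by apply: le_trans (psi_bounded (lexx 0)).
have C1 : 0 < C + 1 by rewrite ltr_wpDl.
(* After multiplication by h there are four errors, two from the quotients and two from the
   Lipschitz bound, each at most e / 4 * h. *)
exists (Num.min d2 (e / 4 * h / (C + 1))).
  by rewrite lt_min d20 divr_gt0 ?mulr_gt0.
move=> s t s0 t0; rewrite lt_min => /andP[st1]; rewrite ltr_pdivlMr// => st2.
have A := H s h s0 h0 hd; have B := H t h t0 h0 hd.
have K1 : `|phi s - phi t| <= e / 4 * h.
  by apply: le_trans (K s t s0 t0 st1) _; rewrite mulrC ltW.
have K2 : `|phi (s + h) - phi (t + h)| <= e / 4 * h.
  apply: le_trans (K _ _ _ _ _) _; rewrite ?addr_ge0 ?(ltW h0)//.
    by rewrite opprD addrACA subrr addr0.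
  by rewrite opprD addrACA subrr addr0 mulrC ltW.
move: A B K1 K2; rewrite !ler_norml => /andP[A1 A2] /andP[B1 B2].
move=> /andP[C11 C2] /andP[D1 D2].
have h4 : e / 4 * h * 4 = h * e by field.
by apply/andP; split; rewrite -(ler_pM2l h0); nra.
Qed.

(** An increment to the left of t is a forward increment from t + h, with derivative [psi (t + h)];
    continuity of [psi] replaces it with [psi t]. *)
Lemma right_deriv_is_derive t : 0 < t -> is_derive t 1 phi (psi t).
Proof.
move=> t0.
have cv : (fun h => h^-1 *: (phi (h *: 1 + t) - phi t)) @ 0^' --> psi t.
  apply/cvgrPdist_le => e e0.
  have e20 : 0 < e / 2 by rewrite divr_gt0.
  have [d1 d10 H] := right_deriv e20.
  have [d2 d20 K] := psi_cont e20.
  near=> h.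
  have hn0 : h != 0 by near: h; exact: nbhs_dnbhs_neq.
  have hd1 : `|h| < d1 by near: h; apply: dnbhs0_lt.
  have hd2 : `|h| < d2 by near: h; apply: dnbhs0_lt.
  have ht : `|h| < t by near: h; apply: dnbhs0_lt.
  rewrite /= scaler1 /GRing.scale/=.
  have [h0|h0|/eqP] := ltgtP h 0; last by rewrite (negbTE hn0).
    have ht0 : 0 <= t + h by move: ht; rewrite ltr0_norm//; lra.
    have hN0 : 0 < - h by rewrite oppr_gt0.
    have hNd1 : - h < d1 by rewrite -ltr0_norm.
    have := H (t + h) (- h) ht0 hN0 hNd1; rewrite addrK.
    have := K t (t + h) (ltW t0) ht0; rewrite opprD addNKr normrN => /(_ hd2).
    rewrite !ler_norml (addrC h) => /andP[A1 A2] /andP[B1 B2].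
    have hV : h * h^-1 = 1 by rewrite divff.
    have hV0 : h^-1 < 0 by rewrite invr_lt0.
    have E : h^-1 * (phi (t + h) - phi t) =
      (- h^-1) * (phi t - phi (t + h) - - h * psi (t + h)) + psi (t + h).
      by field.
    have Ee : (- h^-1) * (e / 2 * - h) = e / 2 by field.
    have hV1 : 0 <= - h^-1 by rewrite oppr_ge0 ltW.
    have := ler_wpM2l hV1 B2; have := ler_wpM2l hV1 B1; rewrite mulrN Ee.
    move=> F1 F2.
    by rewrite E; apply/andP; split; lra.
  have := H t h (ltW t0) h0; rewrite -{1}(gtr0_norm h0) => /(_ hd1).
  rewrite !ler_norml (addrC h) => /andP[A1 A2].
  have hV : h * h^-1 = 1 by rewrite divff.
  have hV0 : 0 < h^-1 by rewrite invr_gt0.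
  have E : h^-1 * (phi (t + h) - phi t) =
      h^-1 * (phi (t + h) - phi t - h * psi t) + psi t by field.
  have Ee : h^-1 * (e / 2 * h) = e / 2 by field.
  have := ler_wpM2l (ltW hV0) A2; have := ler_wpM2l (ltW hV0) A1.
  rewrite mulrN Ee => F1 F2.
  by rewrite E; apply/andP; split; lra.
apply: DeriveDef.
  by apply/cvg_ex; exists (psi t).
exact/cvg_lim.
Unshelve. all: by end_near. Qed.

Lemma right_deriv_cvg0 : phi s @[s --> 0^'+] --> phi 0.
Proof.
have [del del0 K] := phi_lip.
have C0 : 0 <= C by apply: le_trans (psi_bounded (lexx 0)).
have C1 : 0 < C + 1 by rewrite ltr_wpDl.
apply/cvgrPdist_le => e e0; near=> s.
have s0 : 0 < s by near: s; exact: nbhs_right_gt.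
have sd : s < del by near: s; exact: nbhs_right_lt.
have se : s < e / (C + 1) by near: s; apply: nbhs_right_lt; rewrite divr_gt0.
have := K 0 s (lexx 0) (ltW s0); rewrite sub0r normrN gtr0_norm// => /(_ sd).
by move=> /le_trans; apply; rewrite mulrC -ler_pdivlMr// ltW.
Unshelve. all: by end_near. Qed.

End uniform_right_derivative.

Section exponential_comparison.
Context {R : realType}.
Implicit Types (t T lam : R) (f g phi psi : R -> R).

Lemma nonincreasing_from0 f g T : (forall t, 0 < t -> is_derive t 1 f (g t)) ->
  f s @[s --> 0^'+] --> f 0 -> (forall t, 0 < t -> t < T -> g t <= 0) ->
  forall t, 0 <= t -> t <= T -> f t <= f 0.
Proof.
move=> df f0 g0 t; rewrite le_eqVlt => /predU1P[<-//|t0] tT.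
have der x : 0 < x -> derivable f x 1 by move=> x0; have [] := df x x0.
apply: (@ler0_derive1_nincr _ f 0 t) => //.
- by move=> x; rewrite in_itv/= => /andP[x0 _]; exact: der.
- move=> x; rewrite in_itv/= => /andP[x0 xt]; rewrite derive1E.
  by have [_ ->] := df x x0; apply: g0 => //; exact: lt_le_trans tT.
- apply/continuous_within_itvP => //; split => //.
    move=> x; rewrite in_itv/= => /andP[x0 _].
    by apply: differentiable_continuous; apply/derivable1_diffP; exact: der.
  apply: cvg_at_left_filter.
  by apply: differentiable_continuous; apply/derivable1_diffP; exact: der.
- exact: ltW.
Qed.

(** With the integrating factor exp(lam t), the difference of the two sides has a nonpositive
    derivative. *)
Lemma exp_comparison lam T phi psi (G G' : R -> R) :
  (forall t, 0 < t -> is_derive t 1 phi (psi t)) ->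
  phi s @[s --> 0^'+] --> phi 0 ->
  (forall t, is_derive t 1 G (G' t)) ->
  (forall t, 0 < t -> t < T ->
     expR (lam * t) * (psi t + lam * phi t) <= G' t) ->
  phi 0 <= G 0 ->
  forall t, 0 <= t -> t <= T -> expR (lam * t) * phi t <= G t.
Proof.
move=> dphi phi0 dG le' le0 t t0 tT; rewrite -subr_le0.
apply: le_trans (_ : expR (lam * 0) * phi 0 - G 0 <= 0); last first.
  by rewrite mulr0 expR0 mul1r subr_le0.
apply: (@nonincreasing_from0 (fun t => expR (lam * t) * phi t - G t)
  (fun t => expR (lam * t) * (psi t + lam * phi t) - G' t) T) => //.
- move=> s s0; have ds := dphi s s0; have dGs := dG s.
  apply: is_derive_eq.
  rewrite /GRing.scale/= mulr1; ring.
- apply: cvgB; last first.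
    apply: cvg_at_right_filter.
    by apply: differentiable_continuous; apply/derivable1_diffP; have [] := dG 0.
  apply: cvgM => //; apply: cvg_at_right_filter.
  apply: continuous_comp; first exact: mulrl_continuous.
  exact: continuous_expR.
- by move=> s s0 sT; rewrite subr_le0; exact: le'.
Qed.

(** Taylor polynomial whose derivatives at 0 are the [c k]: differentiation shifts [c], as one use
    of the forward equation does. *)
Definition psum (c : nat -> R) n t := \sum_(k < n) c k * t ^+ k / (k`!)%:R.

Lemma psum0 c t : psum c 0 t = 0. Proof. by rewrite /psum big_ord0. Qed.

Lemma psumS c n t : psum c n.+1 t = psum c n t + c n * t ^+ n / (n`!)%:R.
Proof. by rewrite /psum big_ord_recr. Qed.

Lemma psum_at0 c n : psum c n.+1 0 = c 0%N.
Proof.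
rewrite /psum big_ord_recl big1 ?addr0/= ?expr0 ?mulr1 ?invr1 ?mulr1// => i _.
by rewrite expr0n/= mulr0 mul0r.
Qed.

Lemma is_derive_psum c n t :
  is_derive t 1 (psum c n.+1) (psum (fun k => c k.+1) n t).
Proof.
elim: n c => [|n ih] c.
  rewrite psum0 (_ : psum c 1 = cst (c 0%N)); first exact: is_derive_cst.
  by apply/funext => s; rewrite psumS psum0 add0r expr0 mulr1 divr1.
rewrite psumS (_ : psum c n.+2 =
  (psum c n.+1 + (c n.+1 / (n.+1`!)%:R) \*: (id ^+ n.+1 : R -> R))%R); last first.
  by apply/funext => s; rewrite psumS /= fctE /= exprfctE /GRing.scale/= mulrAC.
have := ih c => ihc.
apply: is_derive_eq.
rewrite /GRing.scale/= mulr1 factS natrM; congr (_ + _).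
by field; rewrite pnatr_eq0 -lt0n fact_gt0 /= addrC natr1 pnatr_eq0.
Qed.

End exponential_comparison.

Section generator_flow.
Context {R : realType} {S : countType} {dE dW : measure_display}
  {E : measurableType dE} {W : measurableType dW}.
Variables (Om : set (config S E)) (Pr : config S E -> probability W R)
  (X : R -> W -> config S E).
Variable L : (config S E -> R) -> config S E -> R.
Hypothesis mOm : measurable Om.
Hypothesis hX : markov_process Om Pr X.
Hypothesis hL : has_generator Om Pr X L.
Implicit Types (t h e : R) (x : config S E) (f : config S E -> R)
  (m : giry (config S E) R).

Lemma test_fun_bmeas f : test_fun f -> bmeas Om f.
Proof.
by move=> [mf _ [M fM]]; split; [exact: measurable_funTS|exists M => x _].
Qed.

Lemma generator_uniform f e : test_fun f -> 0 < e -> exists2 del : R, 0 < del &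
  forall h x, 0 < h -> h < del -> Om x ->
  `|(semigroup Pr X h f x - f x) / h - L f x| <= e.
Proof.
move=> tf e0.
have nP : nbhs (L f : {uniform` Om -> R})
    [set g | forall x, Om x -> `|L f x - g x| < e].
  apply/uniform_nbhs; exists [set xy | ball xy.1 e xy.2]; split.
    exact: (entourage_ball _ (PosNum e0)).
  by move=> g.
have := hL tf nP; rewrite /nbhs/= => -[del/= del0 H].
exists del => // h x h0 hd Ox; rewrite distrC ltW//.
by apply: (H h) => //=; rewrite sub0r normrN gtr0_norm.
Qed.

(** Here [L] is abstract. Measurability of [L f] comes from its being a limit of difference
    quotients, and boundedness from its being within 1 of a single one of them. *)
Lemma bmeas_generator f : test_fun f -> bmeas Om (L f).
Proof.
move=> tf; have bf := test_fun_bmeas tf; have [_ _ [M fM]] := tf.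
split.
  apply: (@measurable_fun_cvg _ _ _ _
    (fun n x => (semigroup Pr X n.+1%:R^-1 f x - f x) / n.+1%:R^-1)).
    move=> n; apply: measurable_funM => //; apply: measurable_funB; last exact: bf.1.
    by have [] := bmeas_semigroup mOm hX (_ : 0 <= n.+1%:R^-1) bf.
  move=> x Ox; apply/cvgrPdist_le => e e0.
  have [del del0 H] := generator_uniform tf e0.
  near=> n; rewrite distrC; apply: H => //.
  near: n; exact: near_infty_natSinv_lt (PosNum del0).
have [del del0 H] := generator_uniform tf ltr01.
have h0 : 0 < del / 2 by rewrite divr_gt0.
have hd : del / 2 < del by lra.
have [_ [M' sM]] := bmeas_semigroup mOm hX (ltW h0) bf.
exists ((M' + M) / (del / 2) + 1) => x Ox.
have := H _ _ h0 hd Ox; set a := (_ / _) => Ha.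
have -> : L f x = a - (a - L f x) by rewrite opprB addrC subrK.
rewrite (le_trans (ler_normB _ _))// lerD// /a normrM normfV.
rewrite (gtr0_norm h0) ler_wpM2r ?invr_ge0 ?(ltW h0)//.
by rewrite (le_trans (ler_normB _ _))// lerD ?sM.
Unshelve. all: by end_near. Qed.

(** The increment from t to t + h is the integral of [semigroup h f - f] under the law at time t. As
    the generator limit is uniform on [Om], one [del] serves all t. *)
Lemma flow_right_deriv m f e : m (~` Om) = 0%E -> test_fun f -> 0 < e ->
  exists2 del : R, 0 < del & forall t h, 0 <= t -> 0 < h -> h < del ->
  `|Ex Om (flow mOm hX m (t + h)) f - Ex Om (flow mOm hX m t) f
    - h * Ex Om (flow mOm hX m t) (L f)| <= e * h.
Proof.
move=> m0 tf e0; have bf := test_fun_bmeas tf.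
have [del del0 H] := generator_uniform tf e0.
exists del => // t h t0 h0 hd.
have bs := bmeas_semigroup mOm hX (ltW h0) bf.
have bL := bmeas_generator tf.
rewrite Ex_flowD ?(ltW h0)// -ExB// -ExZ// -ExB//; last 2 first.
- exact: bmeasB.
- exact: bmeasZ.
apply: Ex_norm_le => //.
- by rewrite mulr_ge0// ltW.
- by apply: bmeasB; [exact: bmeasB|exact: bmeasZ].
- move=> x Ox; rewrite -ler_pdivrMr//.
  have := H h x h0 hd Ox.
  have hn0 : h != 0 by rewrite gt_eqF.
  rewrite (_ : _ / h - _ = (semigroup Pr X h f x - f x - h * L f x) / h).
    by rewrite normrM normfV (gtr0_norm h0).
  by field.
Qed.

Lemma flow_is_derive m f t : m (~` Om) = 0%E -> test_fun f -> 0 < t ->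
  is_derive t 1 (fun s => Ex Om (flow mOm hX m s) f)
    (Ex Om (flow mOm hX m t) (L f)).
Proof.
move=> m0 tf t0; have [mL [M LM]] := bmeas_generator tf.
have M0 : 0 <= `|M| by [].
apply: (@right_deriv_is_derive _ _
  (fun s => Ex Om (flow mOm hX m s) (L f)) `|M|) => //.
- move=> s s0; apply: Ex_norm_le => //; first by split=> //; exists M.
  by move=> x Ox; rewrite (le_trans (LM x Ox))// ler_norm.
- by move=> e e0; exact: flow_right_deriv.
Qed.

Lemma flow_cvg0 m f : m (~` Om) = 0%E -> test_fun f ->
  Ex Om (flow mOm hX m s) f @[s --> 0^'+] --> Ex Om m f.
Proof.
move=> m0 tf; have [mL [M LM]] := bmeas_generator tf.
have bf := test_fun_bmeas tf.
rewrite -(Ex_flow0 mOm hX)//.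
apply: (@right_deriv_cvg0 _ (fun s => Ex Om (flow mOm hX m s) f)
  (fun s => Ex Om (flow mOm hX m s) (L f)) `|M|) => //.
- move=> s s0; apply: Ex_norm_le => //; first by split=> //; exists M.
  by move=> x Ox; rewrite (le_trans (LM x Ox))// ler_norm.
- by move=> e e0; exact: flow_right_deriv.
Qed.

Lemma flow_comparison m f lam T (G G' : R -> R) :
  m (~` Om) = 0%E -> test_fun f ->
  (forall t, is_derive t 1 G (G' t)) ->
  (forall t, 0 < t -> t < T -> expR (lam * t) *
     Ex Om (flow mOm hX m t) (fun x => L f x + lam * f x) <= G' t) ->
  Ex Om m f <= G 0 ->
  forall t, 0 <= t -> t <= T -> expR (lam * t) * Ex Om (flow mOm hX m t) f <= G t.
Proof.
move=> m0 tf dG dle le0 t t0 tT; have bf := test_fun_bmeas tf.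
apply: (@exp_comparison _ lam T (fun s => Ex Om (flow mOm hX m s) f)
  (fun s => Ex Om (flow mOm hX m s) (L f)) G G') => //.
- by move=> s s0; exact: flow_is_derive.
- by rewrite Ex_flow0//; exact: flow_cvg0.
- move=> s s0 sT; rewrite -ExZ// -ExD//; first exact: dle.
    exact: bmeas_generator.
  exact: bmeasZ.
- by rewrite Ex_flow0.
Qed.

End generator_flow.

(** * Sums over ordered pairs *)

Section pair_sum_approximation.
Context {R : realType} {S : countType}.
Variable p : S -> S -> R.
Hypothesis hp : symmetric_irreducible p.
Implicit Types (A : {fset S}) (F G : {fset S * S}) (a b : S -> S -> R).

Definition touches A (k : S * S) :=
  (k.1 != k.2) && ((k.1 \in A) || (k.2 \in A)).

Lemma row_sum_le1 i (s : seq S) : uniq s -> \sum_(j <- s) p i j <= 1.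
Proof.
move=> us; rewrite -lee_fin -(kernel_sum1 hp i).
apply: esum_ge; exists [set` s].
  by split => //; exact: finite_seq.
by rewrite -fsbig_seq// sumEFin.
Qed.

(** [g] and [h] stand for the two projections in either order; each row of the kernel with index in
    [A] contributes at most 1. *)
Lemma sum_first_coordinate_le (G : seq (S * S)) (g h : S * S -> S) A :
  uniq G -> (forall k l, g k = g l -> h k = h l -> k = l) ->
  \sum_(k <- G | g k \in A) p (g k) (h k) <= #|` A|%:R.
Proof.
move=> uG gh.
have -> : \sum_(k <- G | g k \in A) p (g k) (h k) =
   \sum_(i <- A) \sum_(k <- G | g k == i) p i (h k).
  rewrite (exchange_big_dep xpredT)//= big_mkcond/=; apply: eq_bigr => k _.
  rewrite -big_filter (_ : seq.filter _ _ = [seq i <- A | pred1 (g k) i]); last first.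
    by apply: eq_filter => i /=; rewrite eq_sym.
  case: ifPn => gA; first by rewrite filter_pred1_uniq ?fset_uniq// big_seq1.
  rewrite (_ : seq.filter _ _ = [::]) ?big_nil//.
  apply/eqP; rewrite -(negbK (_ == _)) -has_filter -all_predC.
  by apply/allP => i iA /=; apply: contraNneq gA => <-.
rewrite -sum1_size natr_sum big_seq [leRHS]big_seq ler_sum// => i iA.
rewrite -big_filter -(big_map h xpredT (p i)) row_sum_le1//.
rewrite map_inj_in_uniq ?filter_uniq// => k l.
by rewrite !mem_filter => /andP[/eqP gk _] /andP[/eqP gl _]; apply: gh; rewrite gl.
Qed.

(** A pair is charged to a coordinate lying in [A]. Symmetry of [p] turns columns into rows, hence
    the factor 2. *)
Lemma touches_sum_le A G : (forall k, k \in G -> touches A k) ->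
  \sum_(k <- G) p k.1 k.2 <= 2 * #|` A|%:R.
Proof.
move=> GA.
apply: (@le_trans _ _ (\sum_(k <- G | k.1 \in A) p k.1 k.2 +
                       \sum_(k <- G | k.2 \in A) p k.2 k.1)).
  rewrite !(big_mkcond (fun k => _ \in A))/= -big_split/= big_seq [leRHS]big_seq.
  apply: ler_sum => k /GA /andP[_]; have := kernel_ge0 hp k.1 k.2.
  rewrite -(kernel_sym hp k.1 k.2).
  by case: (k.1 \in A); case: (k.2 \in A) => //=; lra.
rewrite mulrC mulr2n mulrDr mulr1 lerD//.
  by apply: (@sum_first_coordinate_le G fst snd); [exact: fset_uniq|move=> -[? ?] [? ?] /= -> ->].
by apply: (@sum_first_coordinate_le G snd fst); [exact: fset_uniq|move=> -[? ?] [? ?] /= -> ->].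
Qed.

(** [F] comes within e of the supremum of the finite partial sums, so disjoint pairs cannot add more
    than e. *)
Lemma exists_dominating_pairs A (e : R) : 0 < e -> exists2 F : {fset S * S},
  (forall k, k \in F -> touches A k) &
  forall G, (forall k, k \in G -> touches A k) -> \sum_(k <- (G `\` F)%fset) p k.1 k.2 <= e.
Proof.
move=> e0.
pose V := [set r | exists2 G : {fset S * S}, (forall k, k \in G -> touches A k) &
  r = \sum_(k <- G) p k.1 k.2].
have hV : has_sup V.
  split; first by exists 0; exists fset0 => //; rewrite big_seq_fset0.
  by exists (2 * #|` A|%:R) => _ [G GA ->]; exact: touches_sum_le.
have [_ [F FA ->] supF] := sup_adherent e0 hV.
exists F => // G GA.
have : \sum_(k <- (F `|` G)%fset) p k.1 k.2 <= sup V.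
  apply: ub_le_sup; first exact: hV.2.
  by exists (F `|` G)%fset => // k; rewrite inE => /orP[/FA|/GA].
rewrite (big_fsetID _ (mem F))/= => H.
have : \sum_(k <- (G `\` F)%fset) p k.1 k.2 + \sum_(k <- F) p k.1 k.2 <= sup V.
  apply: le_trans H; rewrite addrC; apply: lerD; rewrite le_eqVlt; apply/orP; left; apply/eqP.
    apply: eq_fbigl => k; rewrite !inE/=; by case: (k \in F) => //=; rewrite ?andbF ?andbT.
  by apply: eq_fbigl => k; rewrite !inE/=; case: (k \in F) => //=; rewrite ?andbF ?andbT.
lra.
Qed.

Definition adapted A a := forall i j, i != j -> ~~ touches A (i, j) -> a i j = 0.

Definition bounded_on A (C : R) a := forall i j, touches A (i, j) -> `|a i j| <= C.

(** The order of quantifiers is the point: [F] is chosen before [a]. The same finite sum can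
    therefore be used for all starting points, and under an expectation. *)
Lemma pair_sum_approx A (C e : R) : 0 <= C -> 0 < e -> exists2 F : {fset S * S},
  (forall k, k \in F -> touches A k) &
  forall a, bounded_on A C a -> adapted A a ->
  `|pair_sum (fun i j => p i j * a i j) - \sum_(k <- F) p k.1 k.2 * a k.1 k.2| <= e.
Proof.
move=> C0 e0; have C1 : 0 < C + 1 by rewrite ltr_wpDl.
(* The positive and negative parts of [a] each leave a tail of at most C times this mass, that is e
   / 2; C + 1 avoids a division by 0. *)
have e20 : 0 < e / 2 / (C + 1) by rewrite !divr_gt0.
have Ce : C * (e / 2 / (C + 1)) <= e / 2.
  by rewrite mulrCA ger_pMr ?divr_gt0// ler_pdivrMr// mul1r lerDl.
have [F FA HF] := exists_dominating_pairs A e20.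
exists F => // a aC a0.
pose D := [set ij : S * S | ij.1 != ij.2].
have Hpos (b : S * S -> R) : (forall k, 0 <= b k) ->
    (forall k, touches A k -> b k <= C) -> (forall k, D k -> ~~ touches A k -> b k = 0) ->
    ((\sum_(k <- F) p k.1 k.2 * b k)%:E <= \esum_(k in D) (p k.1 k.2 * b k)%:E
      <= (\sum_(k <- F) p k.1 k.2 * b k + e / 2)%:E)%E.
  move=> b0 bC bA; apply/andP; split.
    apply: esum_ge; exists [set` F].
      split; first exact: finite_fset.
      by move=> k /= /FA /andP[].
    by rewrite -fsbig_seq ?fset_uniq// sumEFin.
  apply: ge_ereal_sup => _ [G0 [finG GD] <-].
  rewrite fsbig_finite//= sumEFin lee_fin; set G := fset_set G0.
  have GD' k : k \in G -> D k by rewrite in_fset_set// inE => /GD.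
  pose G' := [fset k in G | touches A k]%fset.
  have -> : \sum_(k <- G) p k.1 k.2 * b k = \sum_(k <- G') p k.1 k.2 * b k.
    rewrite [RHS]big_fset/= [RHS]big_mkcond/= !big_seq; apply: eq_bigr => k kG.
    by case: ifPn => // nm; rewrite bA ?mulr0//; exact: GD'.
  have G'A k : k \in G' -> touches A k by rewrite !inE => /andP[].
  have pb0 k : 0 <= p k.1 k.2 * b k by rewrite mulr_ge0 ?(kernel_ge0 hp).
  apply: (@le_trans _ _ (\sum_(k <- F) p k.1 k.2 * b k +
      \sum_(k <- (G' `\` F)%fset) p k.1 k.2 * b k)).
    rewrite (big_fsetID _ (mem F))/=; apply: lerD.
      rewrite (_ : [fset x | x in G' & x \in F]%fset = (F `&` G')%fset); last first.
        by apply/fsetP => k; rewrite !inE/= andbC.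
      rewrite [leRHS](big_fsetID _ (mem G'))/=.
      rewrite (_ : [fset x | x in F & x \in G']%fset = (F `&` G')%fset); last first.
        by apply/fsetP => k; rewrite !inE/=.
      by rewrite lerDl sumr_ge0.
    rewrite le_eqVlt; apply/orP; left; apply/eqP; apply: eq_fbigl => k.
    by rewrite !inE/= andbC.
  rewrite lerD2l; apply: (@le_trans _ _ (C * \sum_(k <- (G' `\` F)%fset) p k.1 k.2)).
    rewrite mulr_sumr !big_seq; apply: ler_sum => k; rewrite inE => /andP[_ /G'A kA].
    by rewrite mulrC ler_wpM2r ?(kernel_ge0 hp)// bC.
  by apply: le_trans Ce; rewrite ler_wpM2l// HF.
have absC k : touches A k -> `|a k.1 k.2| <= C by case: k => i j; exact: aC.
have abs0 k : D k -> ~~ touches A k -> a k.1 k.2 = 0 by case: k => i j; exact: a0.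
have : ((\sum_(k <- F) p k.1 k.2 * Num.max (a k.1 k.2) 0)%:E <=
    \esum_(k in D) (p k.1 k.2 * Num.max (a k.1 k.2) 0)%:E <=
    (\sum_(k <- F) p k.1 k.2 * Num.max (a k.1 k.2) 0 + e / 2)%:E)%E.
  apply: Hpos => [k|k km|k Dk km]; first by rewrite le_max lexx orbT.
    by rewrite ge_max C0 andbT (le_trans (ler_norm _))// absC.
  by rewrite abs0// maxxx.
have : ((\sum_(k <- F) p k.1 k.2 * Num.max (- a k.1 k.2) 0)%:E <=
    \esum_(k in D) (p k.1 k.2 * Num.max (- a k.1 k.2) 0)%:E <=
    (\sum_(k <- F) p k.1 k.2 * Num.max (- a k.1 k.2) 0 + e / 2)%:E)%E.
  apply: Hpos => [k|k km|k Dk km]; first by rewrite le_max lexx orbT.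
    by rewrite ge_max C0 andbT (le_trans (ler_norm _))// normrN absC.
  by rewrite abs0// oppr0 maxxx.
rewrite /pair_sum /rsum.
have -> : (\esum_(k in D) (p k.1 k.2 * Num.max (a k.1 k.2) 0)%:E =
  \esum_(k in D) (EFin \o (fun ij : S * S => (p ij.1 ij.2 * a ij.1 ij.2)%R))^\+ k)%E.
  apply: eq_esum => k _; rewrite funeposE /= -EFin_max; congr EFin.
  by rewrite maxr_pMr ?mulr0 ?(kernel_ge0 hp).
have -> : (\esum_(k in D) (p k.1 k.2 * Num.max (- a k.1 k.2) 0)%:E =
  \esum_(k in D) (EFin \o (fun ij : S * S => (p ij.1 ij.2 * a ij.1 ij.2)%R))^\- k)%E.
  apply: eq_esum => k _; rewrite funenegE /= -EFin_max; congr EFin.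
  by rewrite maxr_pMr ?mulr0 ?mulrN ?(kernel_ge0 hp).
rewrite -/D.
set x := (\esum_(_ in D) _)%E; set y := (\esum_(_ in D) _)%E.
have -> : \sum_(k <- F) p k.1 k.2 * a k.1 k.2 =
  \sum_(k <- F) p k.1 k.2 * Num.max (a k.1 k.2) 0 -
  \sum_(k <- F) p k.1 k.2 * Num.max (- a k.1 k.2) 0.
  rewrite -sumrB; apply: eq_bigr => k _; rewrite -mulrBr; congr (_ * _).
  by have [] := leP (a k.1 k.2) 0; have [] := leP (- a k.1 k.2) 0; lra.
set u := \sum_(_ <- F) _; set v := \sum_(_ <- F) _.
have : (u%:E <= x <= (u + e / 2)%:E)%E ->
  (v%:E <= y <= (v + e / 2)%:E)%E -> `|fine (y - x)%E - (v - u)| <= e.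
  (* The upper bounds exclude infinite sums, so [fine] returns the true difference and not a default
     value. *)
  case: x => [x||]; case: y => [y||]; rewrite ?leye_eq ?leeNy_eq ?andbF//=.
  rewrite ?lee_fin => /andP[x1 x2] /andP[y1 y2].
  by rewrite ler_norml; apply/andP; split; lra.
exact: id.
Qed.

End pair_sum_approximation.

Section pair_sum_theory.
Context {R : realType} {S : countType}.
Variable p : S -> S -> R.
Hypothesis hp : symmetric_irreducible p.
Implicit Types (A : {fset S}) (a b : S -> S -> R) (c C e : R).

Lemma pair_sum_lin A c C a b : bounded_on A C a -> bounded_on A C b ->
  adapted A a -> adapted A b ->
  pair_sum (fun i j => p i j * (a i j + c * b i j)) =
  pair_sum (fun i j => p i j * a i j) + c * pair_sum (fun i j => p i j * b i j).
Proof.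
move=> aC0 bC0 aA bA; set x := pair_sum _; set y := pair_sum _; set z := pair_sum _.
have h1 : `|C| <= `|C| + `|c| * `|C| by rewrite lerDl mulr_ge0.
have aC : bounded_on A (`|C| + `|c| * `|C|) a.
  by move=> i j ij; apply: le_trans h1; rewrite (le_trans (aC0 _ _ ij))// ler_norm.
have bC1 : bounded_on A `|C| b.
  by move=> i j ij; rewrite (le_trans (bC0 _ _ ij))// ler_norm.
have bC : bounded_on A (`|C| + `|c| * `|C|) b.
  by move=> i j ij; apply: le_trans h1; exact: bC1.
have abC : bounded_on A (`|C| + `|c| * `|C|) (fun i j => a i j + c * b i j).
  move=> i j ij; rewrite (le_trans (ler_normD _ _))// lerD//.
    by rewrite (le_trans (aC0 _ _ ij))// ler_norm.
  by rewrite normrM ler_wpM2l ?bC1.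
have abA : adapted A (fun i j => a i j + c * b i j).
  by move=> i j ij nm; rewrite aA// bA// mulr0 addr0.
apply/eqP; rewrite -subr_eq0 -normr_le0; apply/ler_addgt0Pr => e e0; rewrite add0r.
(* Three approximations enter, with weights 1, 1 and |c|. *)
have k0 : 0 < 2 + `|c| by rewrite ltr_pwDl.
have [F FA HF] := pair_sum_approx hp A (le_trans (normr_ge0 C) h1) (divr_gt0 e0 k0).
have := HF _ abC abA.
have -> : \sum_(k <- F) p k.1 k.2 * (a k.1 k.2 + c * b k.1 k.2) =
   \sum_(k <- F) p k.1 k.2 * a k.1 k.2 + c * \sum_(k <- F) p k.1 k.2 * b k.1 k.2.
  by rewrite mulr_sumr -big_split/=; apply: eq_bigr => k _; rewrite mulrDr mulrCA.
move: (HF _ aC aA) (HF _ bC bA); rewrite -/x -/y -/z.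
set u := \sum_(k <- F) _; set v := \sum_(k <- F) _; set d := e / _ => Ha Hb Hx.
have -> : x - (y + c * z) = (x - (u + c * v)) - (y - u) - c * (z - v) by ring.
have -> : e = d + d + `|c| * d by rewrite /d; field; rewrite gt_eqF.
rewrite (le_trans (ler_normB _ _))// lerD// ?(le_trans (ler_normB _ _)) ?lerD//.
by rewrite normrM ler_wpM2l.
Qed.

Lemma pair_sum_ge A c C a : 0 <= c -> bounded_on A C a -> adapted A a ->
  (forall i j, touches A (i, j) -> - c <= a i j) ->
  - (c * (2 * #|` A|%:R)) <= pair_sum (fun i j => p i j * a i j).
Proof.
move=> c0 aC0 aA ca; have C0 : 0 <= `|C| by [].
have aC : bounded_on A `|C| a.
  by move=> i j ij; rewrite (le_trans (aC0 _ _ ij))// ler_norm.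
apply/ler_addgt0Pr => e e0.
have [F FA HF] := pair_sum_approx hp A C0 e0.
have := HF _ aC aA; rewrite ler_norml => /andP[H _].
have FF : - (c * (2 * #|` A|%:R)) <= \sum_(k <- F) p k.1 k.2 * a k.1 k.2.
  apply: (@le_trans _ _ (- c * \sum_(k <- F) p k.1 k.2)).
    rewrite mulNr lerN2 ler_wpM2l//; exact: touches_sum_le.
  rewrite mulr_sumr !big_seq; apply: ler_sum => -[i j] /FA km /=.
  by rewrite mulrC ler_wpM2l ?(kernel_ge0 hp)// ca.
by lra.
Qed.

Lemma pair_sum_le A C a b : bounded_on A C a -> bounded_on A C b ->
  adapted A a -> adapted A b -> (forall i j, touches A (i, j) -> a i j <= b i j) ->
  pair_sum (fun i j => p i j * a i j) <= pair_sum (fun i j => p i j * b i j).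
Proof.
move=> aC bC aA bA ab; rewrite -subr_ge0 -mulN1r addrC addrC.
rewrite -(pair_sum_lin (-1) bC aC)//.
have := @pair_sum_ge A 0 (C + C) (fun i j => b i j + -1 * a i j) (lexx 0).
rewrite mul0r oppr0; apply.
- move=> i j ij; rewrite (le_trans (ler_normD _ _))// normrM normrN1 mul1r.
  by rewrite lerD ?aC ?bC.
- by move=> i j ij nm; rewrite aA// bA// mulr0 addr0.
- by move=> i j ij; rewrite mulN1r subr_ge0 ab.
Qed.

Lemma pair_sum_cst_le A c : 0 <= c ->
  pair_sum (fun i j => p i j * (c * (touches A (i, j))%:R)) <= c * (2 * #|` A|%:R).
Proof.
move=> c0; set a := fun i j => c * (touches A (i, j))%:R : R.
have aC : bounded_on A c a by move=> i j ij; rewrite /a ij mulr1 ger0_norm.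
have aA : adapted A a by move=> i j ij nm; rewrite /a (negbTE nm) mulr0.
have zC : bounded_on A c (fun _ _ => 0) by move=> i j ij; rewrite normr0.
have zA : @adapted R S A (fun _ _ => 0) by [].
have z0 : pair_sum (fun i j => p i j * 0) = 0.
  have := pair_sum_lin (-1) zC zC zA zA; rewrite (mulr0 (-1)) addr0 mulN1r.
  by rewrite subrr.
rewrite -[leLHS]opprK lerNl.
have := @pair_sum_ge A c c (fun i j => 0 + -1 * a i j) c0.
rewrite (pair_sum_lin (-1) zC aC)// z0 add0r mulN1r; apply.
- by move=> i j ij; rewrite add0r normrM normrN1 mul1r aC.
- by move=> i j ij nm; rewrite aA// mulr0 addr0.
- by move=> i j ij; rewrite /a ij mulr1; lra.
Qed.

End pair_sum_theory.

(** * The dual generator as a positive operator *)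

Section finite_configurations.
Context {S : countType}.
Implicit Types (xi : config S nat) (A : {fset S}) (i j : S).

Definition fin_conf N xi := exists2 A : {fset S},
  (forall i, i \notin A -> xi i = 0%N) & (\sum_(i <- A) xi i <= N)%N.

Lemma fin_conf_supp N xi : fin_conf N xi -> exists A : {fset S},
  [/\ forall i, i \notin A -> xi i = 0%N, (#|` A| <= N)%N,
      (\sum_(i <- A) xi i <= N)%N & forall i, i \in A -> (0 < xi i)%N].
Proof.
move=> [A A0 AN]; pose B := [fset i in A | (0 < xi i)%N]%fset.
have BN : (\sum_(i <- B) xi i <= N)%N.
  apply: leq_trans AN; rewrite big_fset/= big_mkcond/=.
  by apply: leq_sum => i _; case: ifP.
exists B; split => //.
- move=> i; rewrite !inE/= negb_and -leqNgt leqn0 => /orP[/A0//|/eqP//].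
- apply: leq_trans BN; rewrite -sum1_size big_seq [leqRHS]big_seq.
  by apply: leq_sum => i; rewrite !inE/= => /andP[].
- by move=> i; rewrite !inE/= => /andP[].
Qed.

Lemma dual_exchange_out xi i j K M k : k != i -> k != j ->
  dual_exchange xi i j K M k = xi k.
Proof. by rewrite /dual_exchange => /negbTE-> /negbTE->. Qed.

(** The bounds on [K] and [M] make the truncated subtractions exact, so an exchange conserves the
    number of particles. *)
Lemma fin_conf_exchange N xi i j K M : i != j -> (K <= xi i)%N ->
  (M <= xi j)%N -> fin_conf N xi -> fin_conf N (dual_exchange xi i j K M).
Proof.
move=> ij Ki Mj [A A0 AN]; exists (i |` (j |` A))%fset.
  move=> k; rewrite !inE !negb_or => /and3P[ki kj kA].
  by rewrite dual_exchange_out// A0.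
set B := (i |` (j |` A))%fset.
have iB : i \in B by rewrite !inE eqxx.
have jB : j \in (B `\ i)%fset by rewrite !inE eqxx eq_sym ij orbT.
have sumB (eta : S -> nat) : \sum_(k <- B) eta k =
    (eta i + (eta j + \sum_(k <- ((B `\ i) `\ j)%fset) eta k))%N.
  by rewrite (big_fsetD1 i)//= (big_fsetD1 j).
rewrite sumB.
have -> : (\sum_(k <- ((B `\ i) `\ j)%fset) dual_exchange xi i j K M k =
    \sum_(k <- ((B `\ i) `\ j)%fset) xi k)%N.
  rewrite !big_seq; apply: eq_bigr => k; rewrite !inE => /and3P[kj ki _].
  exact: dual_exchange_out.
rewrite {1 2}/dual_exchange eqxx eq_sym (negbTE ij) eqxx.
have : (\sum_(k <- B) xi k <= N)%N.
  apply: leq_trans AN; rewrite (big_fsetID _ (mem A))/= leq_eqVlt; apply/orP; left.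
  rewrite [X in (_ + X)%N]big1_seq ?addn0.
    by apply/eqP/eq_fbigl => k; rewrite !inE/=; case: (k \in A); rewrite ?orbT ?andbF.
  by move=> k; rewrite !inE/= => /andP[_ /A0].
rewrite sumB; apply: leq_trans.
by rewrite !addnA leq_add2r; lia.
Qed.

End finite_configurations.

Section dual_operator.
Context {R : realType} {S : countType}.
Variable p : S -> S -> R.
Hypothesis hp : symmetric_irreducible p.
Variable N : nat.
Implicit Types (xi : config S nat) (A : {fset S}) (f g : config S nat -> R).

Definition dual_avg f xi i j : R :=
  \sum_(K < (xi i).+1) \sum_(M < (xi j).+1)
    ((xi i).+1%:R * (xi j).+1%:R)^-1 * f (dual_exchange xi i j K M).

Lemma dual_avg_cst c xi i j : dual_avg (fun=> c) xi i j = c.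
Proof.
rewrite /dual_avg; under eq_bigr do rewrite sumr_const card_ord.
rewrite sumr_const card_ord -mulrnA -[LHS]mulr_natr natrM.
by field; rewrite !nat1r !pnatr_eq0.
Qed.

Lemma dual_avg_lin c f g xi i j :
  dual_avg (fun eta => f eta + c * g eta) xi i j =
  dual_avg f xi i j + c * dual_avg g xi i j.
Proof.
rewrite /dual_avg mulr_sumr -big_split/=; apply: eq_bigr => K _.
rewrite mulr_sumr -big_split/=; apply: eq_bigr => M _.
by rewrite mulrDr mulrCA.
Qed.

Lemma dual_avg_le f g xi i j : i != j -> fin_conf N xi ->
  (forall eta, fin_conf N eta -> f eta <= g eta) ->
  dual_avg f xi i j <= dual_avg g xi i j.
Proof.
move=> ij Nxi fg; apply: ler_sum => K _; apply: ler_sum => M _.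
rewrite ler_wpM2l ?invr_ge0 ?mulr_ge0//; apply: fg.
by apply: fin_conf_exchange => //; rewrite -ltnS.
Qed.

Lemma dual_avg_norm_le f xi i j C : i != j -> fin_conf N xi ->
  (forall eta, fin_conf N eta -> `|f eta| <= C) -> `|dual_avg f xi i j| <= C.
Proof.
move=> ij Nxi fC; rewrite ler_norml -{1}(dual_avg_cst (- C) xi i j).
rewrite -{2}(dual_avg_cst C xi i j).
by apply/andP; split; apply: dual_avg_le => // eta /fC; rewrite ler_norml => /andP[].
Qed.

Lemma dual_genE f xi :
  dual_gen p f xi = pair_sum (fun i j => p i j * (dual_avg f xi i j - f xi)).
Proof.
rewrite /dual_gen; congr pair_sum; apply/funext => i; apply/funext => j.
congr (_ * _).
transitivity (dual_avg f xi i j + -1 * dual_avg (fun=> f xi) xi i j); last first.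
  by rewrite dual_avg_cst mulN1r.
rewrite -dual_avg_lin; apply: eq_bigr => K _; apply: eq_bigr => M _.
by rewrite mulN1r.
Qed.

(** The locality is that of the configuration: between two empty sites only K = M = 0 occurs, and
    nothing moves. *)
Lemma dual_incr_adapted f xi A : (forall i, i \notin A -> xi i = 0%N) ->
  adapted A (fun i j => dual_avg f xi i j - f xi).
Proof.
move=> A0 i j ij; rewrite /touches ij/= negb_or => /andP[/A0 i0 /A0 j0].
rewrite /dual_avg i0 j0 !big_ord1/= mulr1 invr1 mul1r.
rewrite (_ : dual_exchange _ _ _ _ _ = xi) ?subrr//.
apply/funext => k; rewrite /dual_exchange.
by case: eqP => [->|_]; [rewrite i0|case: eqP => [->|//]; rewrite j0].
Qed.

Lemma dual_incr_bounded f xi A C : fin_conf N xi ->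
  (forall eta, fin_conf N eta -> `|f eta| <= C) ->
  bounded_on A (C + C) (fun i j => dual_avg f xi i j - f xi).
Proof.
move=> Nxi fC i j /andP[/= ij _]; rewrite (le_trans (ler_normB _ _))//.
by rewrite lerD ?fC//; exact: dual_avg_norm_le.
Qed.

Definition rate : R := (2 * N).+1%:R.

(* The dual generator shifted by a bound of the total jump rate: a positive
   operator on configurations with at most [N] particles. *)
Definition dual_op f xi := dual_gen p f xi + rate * f xi.

Definition bounded_fin f := exists C : R,
  forall xi, fin_conf N xi -> `|f xi| <= C.

Lemma bounded_fin_max f g : bounded_fin f -> bounded_fin g -> exists C : R,
  (forall xi, fin_conf N xi -> `|f xi| <= C) /\
  (forall xi, fin_conf N xi -> `|g xi| <= C).
Proof.
move=> [C fC] [D gD]; exists (Num.max C D); split => xi Nxi.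
  by rewrite le_max fC.
by rewrite le_max gD// orbT.
Qed.

Lemma bounded_fin_lin c f g : bounded_fin f -> bounded_fin g ->
  bounded_fin (fun xi => f xi + c * g xi).
Proof.
move=> [C fC] [D gD]; exists (C + `|c| * D) => xi Nxi.
by rewrite (le_trans (ler_normD _ _))// lerD ?fC// normrM ler_wpM2l ?gD.
Qed.

Lemma bounded_fin_cst c : bounded_fin (fun=> c).
Proof. by exists `|c|. Qed.

Lemma dual_op_lin c f g xi : fin_conf N xi -> bounded_fin f -> bounded_fin g ->
  dual_op (fun eta => f eta + c * g eta) xi = dual_op f xi + c * dual_op g xi.
Proof.
move=> Nxi bf bg; have [C [fC gC]] := bounded_fin_max bf bg.
have [A [A0 _ _ _]] := fin_conf_supp Nxi.
rewrite /dual_op !dual_genE.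
have -> : (fun i j => p i j * (dual_avg (fun eta => f eta + c * g eta) xi i j -
    (f xi + c * g xi))) = (fun i j => p i j *
    ((dual_avg f xi i j - f xi) + c * (dual_avg g xi i j - g xi))).
  by apply/funext => i; apply/funext => j; rewrite dual_avg_lin; ring.
rewrite (pair_sum_lin hp c (dual_incr_bounded (A := A) Nxi fC)
  (dual_incr_bounded Nxi gC) (dual_incr_adapted f A0) (dual_incr_adapted g A0)).
by ring.
Qed.

(** Each increment is at least [- f xi] and the total rate is at most 2 N, so the shift
    [rate * f xi] compensates the loss. *)
Lemma dual_op_ge0 f xi : fin_conf N xi -> bounded_fin f ->
  (forall eta, fin_conf N eta -> 0 <= f eta) -> 0 <= dual_op f xi.
Proof.
move=> Nxi [C fC] f0; have [A [A0 AN _ _]] := fin_conf_supp Nxi.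
rewrite /dual_op dual_genE.
have := @pair_sum_ge _ _ _ hp A (f xi) _ _ (f0 _ Nxi)
  (dual_incr_bounded Nxi fC) (dual_incr_adapted f A0).
move=> /(_ _)/wrap[].
  move=> i j /andP[/= ij _]; rewrite lerBrDr addNr.
  rewrite -[leLHS](dual_avg_cst 0 xi i j).
  exact: dual_avg_le.
move=> H; rewrite -lerBlDr sub0r; apply: le_trans H.
rewrite lerN2 mulrC ler_wpM2r ?f0// /rate -natrM ler_nat.
by rewrite ltnW// ltnS leq_mul2l AN orbT.
Qed.

Lemma dual_op_le f g xi : fin_conf N xi -> bounded_fin f -> bounded_fin g ->
  (forall eta, fin_conf N eta -> f eta <= g eta) -> dual_op f xi <= dual_op g xi.
Proof.
move=> Nxi bf bg fg; rewrite -subr_ge0 -mulN1r -dual_op_lin//.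
apply: dual_op_ge0 => //; first exact: bounded_fin_lin.
by move=> eta Neta; rewrite mulN1r subr_ge0 fg.
Qed.

Lemma dual_op_cst c xi : fin_conf N xi -> dual_op (fun=> c) xi = rate * c.
Proof.
move=> Nxi.
have E0 : dual_op (fun=> 0) xi = 0.
  have := dual_op_lin (-1) Nxi (bounded_fin_cst 0) (bounded_fin_cst 0).
  by rewrite (mulr0 (-1)) addr0 mulN1r subrr.
have E1 a : dual_gen p (fun=> a) xi = pair_sum (fun i j => p i j * 0).
  rewrite dual_genE; congr pair_sum; apply/funext => i; apply/funext => j.
  by rewrite dual_avg_cst subrr.
by move: E0; rewrite /dual_op !E1 mulr0 addr0 => ->; rewrite add0r.
Qed.

Lemma eq_dual_op f g xi : fin_conf N xi -> bounded_fin f -> bounded_fin g ->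
  (forall eta, fin_conf N eta -> f eta = g eta) -> dual_op f xi = dual_op g xi.
Proof.
move=> Nxi bf bg fg; apply/eqP; rewrite eq_le; apply/andP.
by split; apply: dual_op_le => // eta /fg ->.
Qed.

Lemma dual_op_norm_le f xi C : fin_conf N xi ->
  (forall eta, fin_conf N eta -> `|f eta| <= C) -> `|dual_op f xi| <= rate * C.
Proof.
move=> Nxi fC; have bf : bounded_fin f by exists C.
rewrite ler_norml -mulrN -!(dual_op_cst _ Nxi).
by apply/andP; split; apply: dual_op_le => //; try exact: bounded_fin_cst;
  move=> eta /fC; rewrite ler_norml => /andP[].
Qed.

Lemma rate_ge0 : 0 <= rate. Proof. by []. Qed.

Lemma iter_dual_op_norm_le n f C : (forall xi, fin_conf N xi -> `|f xi| <= C) ->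
  forall xi, fin_conf N xi -> `|iter n dual_op f xi| <= rate ^+ n * C.
Proof.
move=> fC; elim: n => [|n ih] xi Nxi; first by rewrite expr0 mul1r fC.
by rewrite iterS exprS -mulrA; apply: dual_op_norm_le.
Qed.

Lemma bounded_fin_iter n f : bounded_fin f -> bounded_fin (iter n dual_op f).
Proof. by move=> [C fC]; exists (rate ^+ n * C); exact: iter_dual_op_norm_le. Qed.

Lemma iter_dual_op_lin n c f g : bounded_fin f -> bounded_fin g ->
  forall xi, fin_conf N xi -> iter n dual_op (fun eta => f eta + c * g eta) xi =
  iter n dual_op f xi + c * iter n dual_op g xi.
Proof.
move=> bf bg; elim: n => [//|n ih] xi Nxi.
rewrite !iterS -dual_op_lin//; try exact: bounded_fin_iter.
apply: eq_dual_op => //; first by apply: bounded_fin_iter; exact: bounded_fin_lin.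
by apply: bounded_fin_lin; exact: bounded_fin_iter.
Qed.

Lemma iter_dual_op0 n xi : fin_conf N xi -> iter n dual_op (fun=> 0) xi = 0.
Proof.
move=> Nxi; have z0 (eta : config S nat) : fin_conf N eta -> `|0 : R| <= 0 by rewrite normr0.
by have := iter_dual_op_norm_le n z0 Nxi; rewrite mulr0 normr_le0 => /eqP.
Qed.

Lemma iter_dual_op_le n f g : bounded_fin f -> bounded_fin g ->
  (forall xi, fin_conf N xi -> f xi <= g xi) ->
  forall xi, fin_conf N xi -> iter n dual_op f xi <= iter n dual_op g xi.
Proof.
move=> bf bg fg; elim: n => [|n ih] xi Nxi; first exact: fg.
by rewrite !iterS; apply: dual_op_le => //; exact: bounded_fin_iter.
Qed.

Lemma dual_op_sum n (c : nat -> R) (f : nat -> config S nat -> R) xi :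
  fin_conf N xi -> (forall k, bounded_fin (f k)) ->
  bounded_fin (fun eta => \sum_(k < n) c k * f k eta) /\
  dual_op (fun eta => \sum_(k < n) c k * f k eta) xi =
  \sum_(k < n) c k * dual_op (f k) xi.
Proof.
move=> Nxi bf; elim: n => [|n [ih1 ih2]].
  under eq_fun do rewrite big_ord0; split; first exact: bounded_fin_cst.
  by rewrite dual_op_cst// big_ord0 mulr0.
under eq_fun do rewrite big_ord_recr/=; split; first exact: bounded_fin_lin.
by rewrite dual_op_lin// big_ord_recr/= ih2.
Qed.

End dual_operator.

(** * Interchange of an expectation with the dual generator *)

Section exchange_of_expectation.
Context {R : realType} {S : countType} {d : measure_display}
  {T : measurableType d}.
Variable p : S -> S -> R.
Hypothesis hp : symmetric_irreducible p.
Variables (N : nat) (D : set T).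
Hypothesis mD : measurable D.
Implicit Types (xi eta : config S nat) (m : giry T R).

Lemma Ex_dual_avg m (g : config S nat -> T -> R) xi i j :
  i != j -> fin_conf N xi -> (forall eta, fin_conf N eta -> bmeas D (g eta)) ->
  bmeas D (fun y => dual_avg (fun eta => g eta y) xi i j) /\
  Ex D m (fun y => dual_avg (fun eta => g eta y) xi i j) =
  dual_avg (fun eta => Ex D m (g eta)) xi i j.
Proof.
move=> ij Nxi bg.
have bgx (K : 'I_(xi i).+1) (M : 'I_(xi j).+1) :
    bmeas D (g (dual_exchange xi i j K M)).
  by apply/bg/fin_conf_exchange => //; rewrite -ltnS.
have bw (K : 'I_(xi i).+1) (M : 'I_(xi j).+1) : bmeas D (fun y =>
    ((xi i).+1%:R * (xi j).+1%:R)^-1 * g (dual_exchange xi i j K M) y).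
  exact: bmeasZ.
split.
  by apply: bmeas_sum => // K _; apply: bmeas_sum => // M _; exact: bw.
rewrite /dual_avg Ex_sum//; last first.
  by move=> K _; apply: bmeas_sum => // M _; exact: bw.
apply: eq_bigr => K _; rewrite Ex_sum//.
by apply: eq_bigr => M _; rewrite ExZ.
Qed.

Lemma dual_op_approx xi (C e : R) : fin_conf N xi -> 0 <= C -> 0 < e ->
  exists2 F : {fset S * S}, (forall k, k \in F -> k.1 != k.2) &
  forall f, (forall eta, fin_conf N eta -> `|f eta| <= C) ->
  `|dual_op p N f xi - (\sum_(k <- F) p k.1 k.2 *
     (dual_avg f xi k.1 k.2 - f xi) + rate N * f xi)| <= e.
Proof.
move=> Nxi C0 e0; have [A [A0 _ _ _]] := fin_conf_supp Nxi.
have CC0 : 0 <= C + C by rewrite addr_ge0.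
have [F FA HF] := pair_sum_approx hp A CC0 e0.
exists F; first by move=> k /FA /andP[].
move=> f fC.
have := HF _ (dual_incr_bounded (A := A) Nxi fC) (dual_incr_adapted f A0).
by rewrite /dual_op dual_genE opprD addrACA subrr addr0.
Qed.

(** The pair sum is cut to finitely many pairs, with an error e / 2 once under the expectation and
    once outside; the same [F] serves both because it depends only on [xi], [C] and e. *)
Lemma Ex_le_dual_op m (g : config S nat -> T -> R) (f : T -> R) (C : R) xi :
  fin_conf N xi ->
  (forall eta, fin_conf N eta -> bmeas D (g eta)) ->
  (forall eta y, fin_conf N eta -> D y -> `|g eta y| <= C) ->
  bmeas D f ->
  (forall y, D y -> f y <= dual_op p N (fun eta => g eta y) xi) ->
  Ex D m f <= dual_op p N (fun eta => Ex D m (g eta)) xi.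
Proof.
move=> Nxi bg gC0 bf fg; have C0 : 0 <= `|C| by [].
have gC eta y : fin_conf N eta -> D y -> `|g eta y| <= `|C|.
  by move=> Ne Dy; rewrite (le_trans (gC0 _ _ Ne Dy))// ler_norm.
apply/ler_addgt0Pr => e e0; have e20 : 0 < e / 2 by rewrite divr_gt0.
have [F Fne HF] := dual_op_approx Nxi C0 e20.
pose GF (h : config S nat -> R) := \sum_(k <- F) p k.1 k.2 *
     (dual_avg h xi k.1 k.2 - h xi) + rate N * h xi.
have bterm k : k \in F -> bmeas D (fun y => p k.1 k.2 *
    (dual_avg (fun eta => g eta y) xi k.1 k.2 - g xi y)).
  move=> kF; apply: bmeasZ => //; apply: bmeasB; last exact: bg.
  (* [giry_ret point] is a placeholder: only the [bmeas] part of the conclusion is used, which does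
     not depend on the law. *)
  exact: (Ex_dual_avg (giry_ret point) (Fne k kF) Nxi bg).1.
have bG : bmeas D (fun y => \sum_(k <- F) p k.1 k.2 *
    (dual_avg (fun eta => g eta y) xi k.1 k.2 - g xi y)).
  exact: bmeas_sum.
have bGF : bmeas D (fun y => GF (fun eta => g eta y)).
  by apply: bmeasD => //; apply: bmeasZ; exact: bg.
have EGF : Ex D m (fun y => GF (fun eta => g eta y)) =
    GF (fun eta => Ex D m (g eta)).
  rewrite ExD//; last by apply: bmeasZ; exact: bg.
  rewrite ExZ//; last exact: bg.
  congr (_ + _); rewrite Ex_sum//; rewrite !big_seq; apply: eq_bigr => k kF.
  have [b1 E1] := Ex_dual_avg m (Fne k kF) Nxi bg.
  rewrite ExZ//; last by apply: bmeasB => //; exact: bg.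
  by rewrite ExB ?E1//; exact: bg.
have H1 : Ex D m f <= GF (fun eta => Ex D m (g eta)) + e / 2.
  rewrite -EGF -lerBlDl -ExB//.
  apply: Ex_le_cst => //; first exact: ltW.
    exact: bmeasB.
  move=> y Dy; have := HF (fun eta => g eta y) (fun eta Ne => gC eta y Ne Dy).
  by rewrite ler_norml -/(GF _) => /andP[_]; have := fg y Dy; lra.
have := HF (fun eta => Ex D m (g eta)) (fun eta Ne => Ex_norm_le mD m C0
  (bg eta Ne) (fun y Dy => gC eta y Ne Dy)).
rewrite ler_norml -/(GF _) => /andP[]; lra.
Qed.

End exchange_of_expectation.

(** * Iteration of the forward equation *)

Section duality_comparison.
Context {R : realType} {S : countType} {dE dW : measure_display}
  {E : measurableType dE} {W : measurableType dW}.
Variables (Om : set (config S E)) (Pr : config S E -> probability W R)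
  (X : R -> W -> config S E).
Variable L : (config S E -> R) -> config S E -> R.
Hypothesis mOm : measurable Om.
Hypothesis hX : markov_process Om Pr X.
Hypothesis hL : has_generator Om Pr X L.
Variable p : S -> S -> R.
Hypothesis hp : symmetric_irreducible p.
Variable N : nat.

Let G := @dual_op R S p N.
Let lam : R := rate N.

(* Iterating the forward equation [n] times, with the error after [n] steps put
   in the coefficient of [t ^+ n]. *)
Lemma flow_le_dual_series (x : config S E) (n : nat) (T : R)
  (h : nat -> config S nat -> config S E -> R) (B : nat -> R) : Om x ->
  (forall k xi, fin_conf N xi -> test_fun (h k xi)) ->
  (forall k xi y, fin_conf N xi -> Om y -> `|h k xi y| <= B k) ->
  (forall k xi y, fin_conf N xi -> Om y ->
     L (h k xi) y + lam * h k xi y <= G (fun eta => h k.+1 eta y) xi) ->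
  forall t xi, 0 <= t -> t <= T -> fin_conf N xi ->
  expR (lam * t) * Ex Om (flow mOm hX (giry_ret x) t) (h 0%N xi) <=
  psum (fun k => if (k < n)%N then iter k G (fun eta => h k eta x) xi
                 else lam ^+ n * B n * expR (lam * T)) n.+1 t.
Proof.
move=> Ox; have m0 := @giry_ret_supp _ _ R _ _ Ox.
elim: n h B => [|n ih] h B th hB hL' t xi t0 tT Nxi.
  have bh := test_fun_bmeas Om (th 0%N xi Nxi).
  rewrite psumS psum0 add0r/= expr0 mul1r mulr1 divr1 mulrC.
  have B0 : 0 <= B 0%N by apply: le_trans (hB 0%N xi x Nxi Ox).
  apply: (@le_trans _ _ (B 0%N * expR (lam * t))).
    rewrite ler_wpM2r ?expR_ge0//; apply: Ex_le_cst => // y Oy.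
    by rewrite (le_trans (ler_norm _))// hB.
  by rewrite ler_wpM2l// ler_expR ler_wpM2l// /lam rate_ge0.
pose c k := if (k < n.+1)%N then iter k G (fun eta => h k eta x) xi
  else lam ^+ n.+1 * B n.+1 * expR (lam * T).
rewrite [leRHS](_ : _ = psum c n.+2 t)//.
pose h' k := h k.+1; pose B' k := B k.+1.
pose c' eta k := if (k < n)%N then iter k G (fun zeta => h' k zeta x) eta
  else lam ^+ n * B' n * expR (lam * T).
have th' k zeta : fin_conf N zeta -> test_fun (h' k zeta) by exact: th.
have IH := ih h' B' th' (fun k => hB k.+1) (fun k => hL' k.+1).
have bc' k : bounded_fin N (fun eta => c' eta k).
  rewrite /c'; case: (k < n)%N; last exact: bounded_fin_cst.
  apply: bounded_fin_iter => //; exists (B' k) => eta Neta.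
  exact: (hB k.+1 eta x Neta Ox).
(* [G] maps the series of the shifted families to the derivative of the series wanted: it adds one
   iteration to each coefficient and multiplies the constant error coefficient by lam. *)
have Gc' s : bounded_fin N (fun eta => psum (c' eta) n.+1 s) /\
    G (fun eta => psum (c' eta) n.+1 s) xi = psum (fun k => c k.+1) n.+1 s.
  have [b1 E1] := dual_op_sum hp n.+1 (fun k => s ^+ k / (k`!)%:R) Nxi bc'.
  have e1 : (fun eta => psum (c' eta) n.+1 s) =
      (fun eta => \sum_(k < n.+1) s ^+ k / (k`!)%:R * c' eta k).
    apply/funext => eta; rewrite /psum; apply: eq_bigr => k _.
    by rewrite -mulrA mulrC.
  rewrite e1; split => //; rewrite /G E1 /psum; apply: eq_bigr => k _.
  rewrite /c/= ltnS; case: ifPn => kn.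
    rewrite (_ : (fun eta => c' eta k) = iter k G (fun zeta => h' k zeta x)).
      by rewrite /h' -/G mulrC mulrA.
    by apply/funext => eta; rewrite /c' kn.
  rewrite (_ : (fun eta => c' eta k) = (fun=> lam ^+ n * B' n * expR (lam * T))).
    by rewrite dual_op_cst// /B' exprS -/lam; ring.
  by apply/funext => eta; rewrite /c' (negbTE kn).
apply: (@flow_comparison _ _ _ _ _ _ _ _ _ _ mOm hX hL (giry_ret x) (h 0%N xi)
  lam T (psum c n.+2) (psum (fun k => c k.+1) n.+1)) => //.
- exact: th.
- by move=> s; exact: is_derive_psum.
- move=> s s0 sT; rewrite -(Gc' s).2.
  have bL : bmeas Om (fun y => L (h 0%N xi) y + lam * h 0%N xi y).
    apply: bmeasD; first exact: (bmeas_generator mOm hX hL (th 0%N xi Nxi)).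
    by apply: bmeasZ; apply: test_fun_bmeas; exact: th.
  have bh1 eta : fin_conf N eta -> bmeas Om (h 1%N eta).
    by move=> Neta; apply: test_fun_bmeas; exact: th.
  have B1 : 0 <= B 1%N by apply: le_trans (hB 1%N xi x Nxi Ox).
  have := Ex_le_dual_op hp mOm (flow mOm hX (giry_ret x) s) Nxi bh1 (hB 1%N) bL
    (fun y Oy => hL' 0%N xi y Nxi Oy).
  move=> /(ler_wpM2l (expR_ge0 (lam * s))) /le_trans; apply.
  have bE : bounded_fin N (fun eta => Ex Om (flow mOm hX (giry_ret x) s) (h 1%N eta)).
    exists (B 1%N) => eta Neta; apply: Ex_norm_le => //; first exact: bh1.
    by move=> y Oy; exact: hB.
  (* The exponential factor is moved inside [G] by linearity, with the zero function as first
     summand. *)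
  rewrite -[leLHS]add0r -(mulr0 lam) -(dual_op_cst hp 0 Nxi) -dual_op_lin//.
    apply: dual_op_le => //.
    - by apply: bounded_fin_lin => //; exact: bounded_fin_cst.
    - exact: (Gc' s).1.
    - move=> eta Neta; rewrite add0r; apply: IH => //; exact: ltW.
  exact: bounded_fin_cst.
- rewrite psum_at0 /c/= Ex_ret//; apply: test_fun_bmeas; exact: th.
Qed.

End duality_comparison.

(** * Exchange averages and duality polynomials *)

Section configuration_measurability.
Context {S : countType} {dE : measure_display} {E : measurableType dE}.

Lemma measurable_coordinate (k : S) :
  measurable_fun setT (fun x : config S E => x k).
Proof.
move=> _ B mB; rewrite setTI; apply: sub_sigma_algebra.
by exists k, B.
Qed.

Lemma measurable_to_config {d} {T : measurableType d} (D : set T)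
    (g : T -> config S E) :
  (forall k, measurable_fun D (fun z => g z k)) -> measurable_fun D g.
Proof.
move=> mg mD.
suff : measurable_fun D g by exact.
apply: (@measurability _ _ _ (config S E) D g (@cylinders S _ E)) => //.
by move=> _ [_ [k [B [mB ->]]] <-]; exact: mg.
Qed.

End configuration_measurability.

Section unit_interval_integral.
Context {R : realType}.

Definition unit_itv : set R := `[0, 1].

Definition int01 (g : R -> R) : R := \int[lebesgue_measure]_(v in unit_itv) g v.

Lemma measurable_unit_itv : measurable unit_itv.
Proof. exact: measurable_itv. Qed.

Lemma lebesgue_unit_itv : (lebesgue_measure unit_itv = 1)%E.
Proof. by rewrite /unit_itv lebesgue_measure_itv/= lte01 oppr0 adde0. Qed.

Lemma int01_integrable g : bmeas unit_itv g ->
  lebesgue_measure.-integrable unit_itv (EFin \o g).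
Proof.
move=> [mg [M gM]]; apply: measurable_bounded_integrable => //.
- exact: measurable_unit_itv.
- by rewrite [ltLHS](_ : _ = 1%E) ?ltey//; exact: lebesgue_unit_itv.
- exists M; split; first exact: num_real.
  by move=> r Mr x Dx /=; apply: le_trans (gM x Dx) (ltW Mr).
Qed.

Lemma int01D g h : bmeas unit_itv g -> bmeas unit_itv h ->
  int01 (fun v => g v + h v) = int01 g + int01 h.
Proof.
move=> bg bh; apply: RintegralD; [exact: measurable_unit_itv| |].
apply (int01_integrable bg).
apply (int01_integrable bh).
Qed.

Lemma int01Z c g : bmeas unit_itv g -> int01 (fun v => c * g v) = c * int01 g.
Proof.
by move=> bg; apply: RintegralZl; first [exact: measurable_unit_itv|exact: int01_integrable].
Qed.

Lemma int01_cst c : int01 (fun=> c) = c.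
Proof.
rewrite /int01 Rintegral_cst; last exact: measurable_unit_itv.
by rewrite [X in fine X](_ : _ = 1%E) ?mulr1//; exact: lebesgue_unit_itv.
Qed.

Lemma eq_int01 g h : (forall v, unit_itv v -> g v = h v) -> int01 g = int01 h.
Proof. by move=> gh; apply: eq_Rintegral => v /set_mem; exact: gh. Qed.

Lemma int01_le g h : bmeas unit_itv g -> bmeas unit_itv h ->
  (forall v, unit_itv v -> g v <= h v) -> int01 g <= int01 h.
Proof.
move=> bg bh gh; apply: le_Rintegral => //; first exact: measurable_unit_itv.
exact (int01_integrable bg).
exact (int01_integrable bh).
Qed.

Lemma int01_norm_le g c : bmeas unit_itv g ->
  (forall v, unit_itv v -> `|g v| <= c) -> `|int01 g| <= c.
Proof.
move=> bg gc; rewrite ler_norml -[in X in X <= _ <= _](int01_cst (- c)).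
rewrite -[in X in _ <= _ <= X](int01_cst c).
by apply/andP; split; apply: int01_le => //; try exact: bmeas_cst;
  move=> v /gc; rewrite ler_norml => /andP[].
Qed.

Lemma int01_sum (I : eqType) (s : seq I) (F : I -> R -> R) :
  (forall i, i \in s -> bmeas unit_itv (F i)) ->
  int01 (fun v => \sum_(i <- s) F i v) = \sum_(i <- s) int01 (F i).
Proof.
elim: s => [|i s ih] bF.
  under [X in int01 X]eq_fun do rewrite big_nil.
  by rewrite big_nil int01_cst.
have bs : forall j, j \in s -> bmeas unit_itv (F j).
  by move=> j js; apply: bF; rewrite in_cons js orbT.
under [X in int01 X]eq_fun do rewrite big_cons.
rewrite big_cons int01D ?ih//; first by apply: bF; rewrite mem_head.
exact: bmeas_sum.
Qed.

Lemma bmeas_int01 {d} {T : measurableType d} (D : set T) (F : T -> R -> R) :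
  measurable D -> bmeas (D `*` unit_itv) (fun z => F z.1 z.2) ->
  bmeas D (fun z => int01 (F z)) /\ (forall z, D z -> bmeas unit_itv (F z)).
Proof.
move=> mD [mF [C FC]].
have mDI : measurable (D `*` unit_itv).
  by apply: measurableX => //; exact: measurable_unit_itv.
have bFz z : D z -> bmeas unit_itv (F z).
  move=> Dz; split; last by exists C => v Iv; exact: (FC (z, v)).
  apply: (measurable_comp mDI _ mF (measurable_funTS (measurable_pair1 z))).
  by move=> _ [v Iv <-].
split => //.
(* Shifted by its bound and extended by 0, the integrand is nonnegative on the whole product space,
   as Tonelli's theorem requires. *)
pose F2 z : \bar R := ((fun z : T * R => (F z.1 z.2 + C)%:E) \_ (D `*` unit_itv)) z.
have mF2 : measurable_fun setT F2.
  apply: (measurable_restrictT (fun z : T * R => (F z.1 z.2 + C)%:E) mDI).1.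
  by apply/measurable_EFinP; exact: measurable_funD.
have F20 z : (0 <= F2 z)%E.
  rewrite /F2 patchE; case: ifPn => //; rewrite inE => Dz; rewrite lee_fin.
  by have := FC z Dz; rewrite ler_norml => /andP[]; lra.
have mint : measurable_fun setT (fubini_F (@lebesgue_measure R) F2).
  exact: measurable_fun_fubini_tonelli_F.
split; last first.
  by exists C => z Dz; apply: int01_norm_le => [|v Iv]; [exact: bFz|exact: (FC (z, v))].
apply: (eq_measurable_fun (fun z => fine (fubini_F (@lebesgue_measure R) F2 z) - C)).
  move=> z; rewrite inE => Dz; rewrite /fubini_F.
  have -> : (\int[lebesgue_measure]_y F2 (z, y) =
      \int[lebesgue_measure]_(y in unit_itv) (F z y + C)%:E)%E.
    rewrite [RHS]integral_mkcond; apply: eq_integral => v _.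
    rewrite /F2 !patchE; congr (if _ then _ else _).
    by apply/idP/idP; rewrite !inE /= => -[].
  have := int01D (bFz z Dz) (bmeas_cst unit_itv C); rewrite int01_cst.
  by rewrite {1}/int01 /Rintegral => ->; rewrite addrK.
apply: measurable_funB => //; apply: measurableT_comp => //.
exact: measurable_funTS.
Qed.

Lemma int01_XMonemX a b :
  int01 (XMonemX a b) = (a`! * b`!)%:R / ((a + b).+1)`!%:R.
Proof.
have := @beta_fun_fact R a b; rewrite /beta_fun/= => <-.
by rewrite /int01 Rintegral_mkcond.
Qed.

Lemma bmeas_XMonemX a b : bmeas unit_itv (XMonemX a b : R -> R).
Proof.
split; first exact: measurable_XMonemX.
exists 1 => v; rewrite /unit_itv/= => v01.
by rewrite ger0_norm ?XMonemX_ge0// XMonemX_le1.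
Qed.

End unit_interval_integral.

Definition supported {R : realType} {S : countType} {d : measure_display}
    {E : measurableType d} (A : {fset S}) (f : config S E -> R) :=
  forall x y : config S E, (forall i, i \in A -> x i = y i) -> f x = f y.

Section exchange_average.
Context {R : realType} {S : countType}.
Implicit Types (x y : config S R) (A : {fset S}) (f g : config S R -> R).

Lemma measurable_exchange (i j : S) : measurable_fun setT
  (fun z : (config S R * R) * R => exchange z.1.1 i j z.1.2 z.2).
Proof.
apply: measurable_to_config => k; rewrite /exchange.
have mx (l : S) : measurable_fun setT (fun z : (config S R * R) * R => z.1.1 l).
  exact: (measurableT_comp (measurable_coordinate l)
    (measurableT_comp measurable_fst measurable_fst)).
have mu : measurable_fun setT (fun z : (config S R * R) * R => z.1.2).
  exact: (measurableT_comp measurable_snd measurable_fst).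
have mv : measurable_fun setT (fun z : (config S R * R) * R => z.2).
  exact: measurable_snd.
case: (k == i).
  by apply: measurable_funD; apply: measurable_funM => //; apply: measurable_funB.
case: (k == j) => //.
by apply: measurable_funD; apply: measurable_funM => //; apply: measurable_funB.
Qed.

Definition exch_avg f (i j : S) x : R :=
  int01 (fun u => int01 (fun v => f (exchange x i j u v))).

Lemma bmeas_exch f i j : test_fun f ->
  bmeas ((setT `*` unit_itv) `*` unit_itv)
    (fun z : (config S R * R) * R => f (exchange z.1.1 i j z.1.2 z.2)).
Proof.
move=> [mf _ [M fM]]; split; last by exists M.
apply: measurable_funTS.
exact: (measurableT_comp mf (measurable_exchange i j)).
Qed.

Lemma bmeas_exch_inner f i j x u : test_fun f -> unit_itv u ->
  bmeas unit_itv (fun v => f (exchange x i j u v)).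
Proof.
move=> tf Iu.
have mD : measurable ([set: config S R] `*` (unit_itv : set R)).
  by apply: measurableX => //; exact: measurable_unit_itv.
have [_ H] := bmeas_int01 (F := fun z v => f (exchange z.1 i j z.2 v)) mD
  (bmeas_exch i j tf).
by apply: (H (x, u)).
Qed.

Lemma bmeas_exch_mid f i j : test_fun f ->
  bmeas ([set: config S R] `*` unit_itv) (fun z =>
    int01 (fun v => f (exchange z.1 i j z.2 v))).
Proof.
move=> tf.
have mD : measurable ([set: config S R] `*` (unit_itv : set R)).
  by apply: measurableX => //; exact: measurable_unit_itv.
by have [H _] := bmeas_int01 (F := fun z v => f (exchange z.1 i j z.2 v)) mD
  (bmeas_exch i j tf).
Qed.

Lemma bmeas_exch_outer f i j x : test_fun f ->
  bmeas unit_itv (fun u => int01 (fun v => f (exchange x i j u v))).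
Proof.
move=> tf.
have [_ H] := bmeas_int01 (F := fun z u => int01 (fun v => f (exchange z i j u v)))
  measurableT (bmeas_exch_mid i j tf).
exact: H.
Qed.

Lemma exch_avg_norm_le f i j x M : test_fun f -> (forall y, `|f y| <= M) ->
  `|exch_avg f i j x| <= M.
Proof.
move=> tf fM; apply: int01_norm_le; first exact: bmeas_exch_outer.
by move=> u Iu; apply: int01_norm_le => //; exact: bmeas_exch_inner.
Qed.

Lemma exchange_eq A x y i j u v k : (forall l, l \in (i |` (j |` A))%fset -> x l = y l) ->
  k \in (i |` (j |` A))%fset -> exchange x i j u v k = exchange y i j u v k.
Proof.
move=> xy kA; rewrite /exchange !xy//; first by rewrite !inE eqxx orbT.
by rewrite !inE eqxx.
Qed.

Lemma exch_avg_supported f i j A : supported A f ->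
  supported (i |` (j |` A))%fset (exch_avg f i j).
Proof.
move=> fA x y xy; apply: eq_int01 => u _; apply: eq_int01 => v _.
by apply: fA => k kA; apply: exchange_eq xy _; rewrite !inE kA !orbT.
Qed.

Lemma test_fun_exch_avg f i j : test_fun f -> test_fun (exch_avg f i j).
Proof.
move=> tf; have [mf [A fA] [M fM]] := tf; split.
- have [[H _] _] := bmeas_int01
    (F := fun z u => int01 (fun v => f (exchange z i j u v)))
    measurableT (bmeas_exch_mid i j tf).
  exact: H.
- by exists (i |` (j |` A))%fset; exact: exch_avg_supported.
- by exists M => x; exact: exch_avg_norm_le.
Qed.

Lemma exch_genE (p : S -> S -> R) f x : test_fun f ->
  exch_gen p f x = pair_sum (fun i j => p i j * (exch_avg f i j x - f x)).
Proof.
move=> tf; rewrite /exch_gen; congr pair_sum; apply/funext => i; apply/funext => j.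
congr (_ * _); rewrite -/(int01 _).
rewrite (eq_int01 (h := fun u =>
    int01 (fun v => f (exchange x i j u v)) + - f x)); last first.
  move=> u Iu; rewrite -/(int01 _) int01D ?int01_cst//.
    exact: bmeas_exch_inner.
  exact: bmeas_cst.
rewrite int01D ?int01_cst//; first exact: bmeas_exch_outer.
exact: bmeas_cst.
Qed.

Lemma exch_incr_adapted f A x : supported A f ->
  adapted A (fun i j => exch_avg f i j x - f x).
Proof.
move=> fA i j ij; rewrite /touches ij/= negb_or => /andP[iA jA].
rewrite /exch_avg (eq_int01 (h := fun=> f x)) ?int01_cst ?subrr// => u _.
rewrite (eq_int01 (h := fun=> f x)) ?int01_cst// => v _.
apply: fA => k kA; rewrite /exchange; case: eqP => [ki|_].
  by rewrite -ki kA in iA.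
by case: eqP => [kj|//]; rewrite -kj kA in jA.
Qed.

Lemma exch_incr_bounded f A x M : test_fun f -> (forall y, `|f y| <= M) ->
  bounded_on A (M + M) (fun i j => exch_avg f i j x - f x).
Proof.
move=> tf fM i j _; rewrite (le_trans (ler_normB _ _))// lerD//.
exact: exch_avg_norm_le.
Qed.

End exchange_average.

Section duality_polynomials.
Context {R : realType} {S : countType}.
Implicit Types (x y : config S R) (A : {fset S}) (xi eta : config S nat).

Lemma dpol0 (z : R) : dpol 0 z = 1.
Proof. by rewrite /dpol expr0 divr1. Qed.

Lemma dpol_ge0 n (z : R) : 0 <= z -> 0 <= dpol n z.
Proof. by move=> z0; rewrite /dpol divr_ge0 ?exprn_ge0. Qed.

Lemma dpol_le n (z w : R) : 0 <= z -> z <= w -> dpol n z <= dpol n w.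
Proof.
by move=> z0 zw; rewrite /dpol ler_wpM2r ?invr_ge0// lerXn2r// nnegrE (le_trans z0).
Qed.

Lemma dual_polyE xi x A : (forall k, k \notin A -> xi k = 0%N) ->
  dual_poly xi x = \prod_(k <- A) dpol (xi k) (x k).
Proof.
move=> A0; rewrite /dual_poly [RHS]fsbig_seq ?fset_uniq//.
rewrite -(fsbig_widen [set` A] setT)//=.
by move=> k /= [_ /negP kA]; rewrite A0// dpol0.
Qed.

Lemma dual_poly_split xi x A i j : i != j -> (forall k, k \notin A -> xi k = 0%N) ->
  dual_poly xi x = dpol (xi i) (x i) * (dpol (xi j) (x j) *
    \prod_(k <- ((A `\ i) `\ j)%fset) dpol (xi k) (x k)).
Proof.
move=> ij A0; rewrite (@dual_polyE xi x (i |` (j |` A))%fset); last first.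
  by move=> k; rewrite !inE !negb_or => /and3P[_ _ /A0].
rewrite (big_fsetD1 i) ?inE ?eqxx//= (big_fsetD1 j) ?inE/= ?eqxx ?orbT ?andbT; last first.
  by rewrite eq_sym.
congr (_ * (_ * _)); apply: eq_fbigl => k; rewrite !inE.
by case: (k == i); case: (k == j).
Qed.

Lemma dual_poly_ge0 N xi x : fin_conf N xi -> (forall k, 0 <= x k) ->
  0 <= dual_poly xi x.
Proof.
move=> [A A0 _] x0; rewrite (dual_polyE _ A0).
by apply: prodr_ge0 => k _; exact: dpol_ge0.
Qed.

Lemma dual_poly_le N xi x y : fin_conf N xi -> (forall k, 0 <= x k) ->
  (forall k, x k <= y k) -> dual_poly xi x <= dual_poly xi y.
Proof.
move=> [A A0 _] x0 xy; rewrite !(dual_polyE _ A0).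
by apply: ler_prod => k _; rewrite dpol_ge0// dpol_le.
Qed.

Lemma dual_poly_supported xi A : (forall k, k \notin A -> xi k = 0%N) ->
  supported A (dual_poly xi : config S R -> R).
Proof.
move=> A0 x y xy; rewrite !(dual_polyE _ A0) !big_seq.
by apply: eq_bigr => k kA; rewrite xy.
Qed.

Lemma measurable_dual_poly N xi : fin_conf N xi ->
  measurable_fun setT (dual_poly xi : config S R -> R).
Proof.
move=> [A A0 _].
rewrite (_ : dual_poly xi = fun x => \prod_(k <- A) dpol (xi k) (x k)); last first.
  by apply/funext => x; exact: dual_polyE.
apply: measurable_prod => k _; apply: measurable_funM => //.
by apply: measurable_funX; exact: measurable_coordinate.
Qed.

(* Binomial expansion followed by the Beta integrals: the factorials of the
   Beta function cancel those of the binomial coefficients. *)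
Lemma int_exchange_dpol n m (a b : R) :
  int01 (fun u => int01 (fun v =>
    dpol n (a * (1 - u) + b * v) * dpol m (b * (1 - v) + a * u))) =
  \sum_(K < n.+1) \sum_(M < m.+1) (n.+1%:R * m.+1%:R)^-1 *
    (dpol (n - K + M) a * dpol (m - M + K) b).
Proof.
(* [K] counts the factors [b * v] in the first power and [M] the factors [a * u] in the second, so
   they act as the numbers of exchanged dual particles. *)
pose c (K : 'I_n.+1) (M : 'I_m.+1) : R := a ^+ (n - K + M) * b ^+ (m - M + K) *
  ('C(n, K)%:R * 'C(m, M)%:R) / ((n.+1)`!%:R * (m.+1)`!%:R).
have expand u v : dpol n (a * (1 - u) + b * v) * dpol m (b * (1 - v) + a * u) =
    \sum_(K < n.+1) \sum_(M < m.+1)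
      c K M * XMonemX M (n - K) u * XMonemX K (m - M) v.
  rewrite /dpol !exprDn mulrACA -invfM big_distrlr/= mulr_suml.
  apply: eq_bigr => K _; rewrite mulr_suml; apply: eq_bigr => M _.
  rewrite /c /XMonemX /unstable.onem -[in LHS](mulr_natr _ 'C(n, K))
    -[in LHS](mulr_natr _ 'C(m, M)) !exprMn !exprD invfM.
  move: (a ^+ (n - K)) (a ^+ M) (b ^+ (m - M)) (b ^+ K) ((1 - u) ^+ (n - K))
    (u ^+ M) ((1 - v) ^+ (m - M)) (v ^+ K) ('C(n, K)%:R : R) ('C(m, M)%:R : R)
    (n.+1`!%:R^-1 : R) (m.+1`!%:R^-1 : R).
  by move=> *; ring.
have bK K M : bmeas unit_itv (fun v : R => XMonemX K (m - M) v).
  exact: bmeas_XMonemX.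
have inner u : int01 (fun v => dpol n (a * (1 - u) + b * v) *
      dpol m (b * (1 - v) + a * u)) =
    \sum_(K < n.+1) \sum_(M < m.+1) (c K M * int01 (XMonemX K (m - M))) *
      XMonemX M (n - K) u.
  under eq_fun do rewrite expand.
  rewrite int01_sum; last first.
    by move=> K _; apply: bmeas_sum => // M _; exact: bmeasZ.
  apply: eq_bigr => K _; rewrite int01_sum; last by move=> M _; exact: bmeasZ.
  apply: eq_bigr => M _; rewrite int01Z; last exact: bK.
  by rewrite mulrAC.
under eq_fun do rewrite inner.
rewrite int01_sum; last first.
  move=> K _; apply: bmeas_sum => // M _; apply: bmeasZ; exact: bmeas_XMonemX.
apply: eq_bigr => K _; rewrite int01_sum; last first.
  by move=> M _; apply: bmeasZ; exact: bmeas_XMonemX.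
apply: eq_bigr => M _; rewrite int01Z; last exact: bmeas_XMonemX.
rewrite !int01_XMonemX /c /dpol.
have Kn : (K <= n)%N by rewrite -ltnS.
have Mm : (M <= m)%N by rewrite -ltnS.
have En : (n`!)%:R = 'C(n, K)%:R * (K`!%:R * (n - K)`!%:R) :> R.
  by rewrite -!natrM bin_fact.
have Em : (m`!)%:R = 'C(m, M)%:R * (M`!%:R * (m - M)`!%:R) :> R.
  by rewrite -!natrM bin_fact.
have fn (k : nat) : k`!%:R != 0 :> R by rewrite pnatr_eq0 -lt0n fact_gt0.
have nn (k : nat) : k.+1%:R != 0 :> R by rewrite pnatr_eq0.
rewrite (addnC K) (addnC M) (factS n) (factS m) (natrM _ n.+1) (natrM _ m.+1)
  (natrM _ K`!) (natrM _ M`!).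
have fN := fn (n - K + M).+1; have fM := fn (m - M + K).+1.
have fn1 := fn n; have fm1 := fn m; have n1 := nn n; have m1 := nn m.
move: fn1 fm1; rewrite En Em !mulf_eq0 !negb_or.
move=> /and3P[z1 z2 z3] /and3P[z4 z5 z6].
(* [X] and [Y] are the denominators of the Beta integrals, which are exactly the normalisations of
   [dpol] after the exchange; everything else reduces to the uniform weight. *)
have alg (x y c1 c2 k l f g N M' X Y : R) : c1 != 0 -> c2 != 0 -> k != 0 ->
    l != 0 -> f != 0 -> g != 0 -> N != 0 -> M' != 0 -> X != 0 -> Y != 0 ->
    x * y * (c1 * c2) / (N * (c1 * (k * f)) * (M' * (c2 * (l * g)))) *
    (k * g / Y) * (l * f / X) = (N * M')^-1 * (x / X * (y / Y)).
  move=> *; field; by do ?[apply/andP; split].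
exact: alg.
Qed.

End duality_polynomials.

Section generator_inequalities.
Context {R : realType} {S : countType}.
Implicit Types (x y : config S R) (A : {fset S}) (xi eta : config S nat).

Lemma exchange_ge0 y i j (u v : R) : Omega R S y -> unit_itv u -> unit_itv v ->
  Omega R S (exchange y i j u v).
Proof.
move=> Oy; rewrite /unit_itv/= !in_itv/= => /andP[u0 u1] /andP[v0 v1] k.
by rewrite /exchange; case: ifP => _; [|case: ifP => _ //];
  rewrite addr_ge0// mulr_ge0 ?subr_ge0//; exact: Oy.
Qed.

Lemma exchange_mono x y i j (u v : R) : unit_itv u -> unit_itv v ->
  (forall k, x k <= y k) -> forall k, exchange x i j u v k <= exchange y i j u v k.
Proof.
rewrite /unit_itv/= !in_itv/= => /andP[u0 u1] /andP[v0 v1] xy k.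
by rewrite /exchange; case: ifP => _; [|case: ifP => _ //];
  rewrite lerD// ler_wpM2r ?subr_ge0.
Qed.

Lemma exchange_le_sum y i j (u v : R) k : Omega R S y -> unit_itv u ->
  unit_itv v -> (k == i) || (k == j) -> exchange y i j u v k <= y i + y j.
Proof.
move=> Oy; rewrite /unit_itv/= !in_itv/= => /andP[u0 u1] /andP[v0 v1].
have yi := Oy i; have yj := Oy j.
rewrite /exchange; case: ifP => _; last case: ifP => // _; move=> _; nra.
Qed.

(** For fixed [y] the unbounded polynomial stays bounded along exchanges: [w] dominates every
    exchanged configuration. *)
Lemma bmeas_exch_dual_poly N xi y i j : fin_conf N xi -> i != j -> Omega R S y ->
  bmeas (unit_itv `*` unit_itv) (fun z => dual_poly xi (exchange y i j z.1 z.2)).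
Proof.
move=> Nxi ij Oy; split.
  apply: measurable_funTS.
  have mp : measurable_fun setT
      (fun z : R * R => ((y, z.1), z.2) : (config S R * R) * R).
    by apply: measurable_fun_pair => //; exact: measurable_fun_pair.
  exact: (measurableT_comp (measurable_dual_poly Nxi)
    (measurableT_comp (measurable_exchange i j) mp)).
pose w : config S R := fun k => if (k == i) || (k == j) then y i + y j else y k.
exists (dual_poly xi w) => -[u v] /= [Iu Iv].
have Oe := exchange_ge0 i j Oy Iu Iv.
rewrite ger0_norm; last exact: (dual_poly_ge0 Nxi).
apply: (dual_poly_le Nxi) => // k.
rewrite /w; case: ifPn => [|]; first exact: exchange_le_sum.
by rewrite negb_or /exchange => /andP[/negbTE-> /negbTE->].
Qed.

(** Duality for a single pair: the other sites factor out as [r], and the two remaining factors are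
    those of [int_exchange_dpol]. *)
Lemma exch_avg_dual_poly N xi y i j : fin_conf N xi -> i != j ->
  Omega R S y ->
  exch_avg (dual_poly xi) i j y = dual_avg (fun eta => dual_poly eta y) xi i j.
Proof.
move=> [A A0 _] ij Oy.
pose r := \prod_(k <- ((A `\ i) `\ j)%fset) dpol (xi k) (y k) : R.
have out (k : S) : k \in ((A `\ i) `\ j)%fset -> k != i /\ k != j.
  by rewrite !inE => /and3P[].
have -> : dual_avg (fun eta => dual_poly eta y) xi i j =
  r * \sum_(K < (xi i).+1) \sum_(M < (xi j).+1)
    ((xi i).+1%:R * (xi j).+1%:R)^-1 *
    (dpol (xi i - K + M) (y i) * dpol (xi j - M + K) (y j)).
  rewrite /dual_avg mulr_sumr; apply: eq_bigr => K _; rewrite mulr_sumr.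
  apply: eq_bigr => M _; rewrite mulrCA; congr (_ * _).
  rewrite (@dual_poly_split _ _ _ _ (i |` (j |` A))%fset _ _ ij); last first.
    move=> k; rewrite !inE !negb_or => /and3P[ki kj kA].
    by rewrite dual_exchange_out// A0.
  rewrite {1 2}/dual_exchange eqxx eq_sym (negbTE ij) eqxx mulrA mulrC; congr (_ * _).
  have -> : (((i |` (j |` A)) `\ i) `\ j)%fset = ((A `\ i) `\ j)%fset.
    by apply/fsetP => k; rewrite !inE; case: (k == i); case: (k == j).
  rewrite /r !big_seq; apply: eq_bigr => k /out[ki kj].
  by rewrite dual_exchange_out.
rewrite -int_exchange_dpol.
have Iin (u v : R) : dual_poly xi (exchange y i j u v) =
   r * (dpol (xi i) (y i * (1 - u) + y j * v) *
        dpol (xi j) (y j * (1 - v) + y i * u)).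
  rewrite (dual_poly_split _ ij A0) {1 2}/exchange eqxx eq_sym (negbTE ij) eqxx.
  rewrite mulrA mulrC; congr (_ * _).
  rewrite /r !big_seq; apply: eq_bigr => k /out[/negbTE ki /negbTE kj].
  by rewrite /exchange ki kj.
have bpoly : bmeas (unit_itv `*` unit_itv) (fun z : R * R =>
    dpol (xi i) (y i * (1 - z.1) + y j * z.2) *
    dpol (xi j) (y j * (1 - z.2) + y i * z.1)).
  split.
    apply: measurable_funTS; have m1 := @measurable_fst _ _ R R.
    have m2 := @measurable_snd _ _ R R.
    by apply: measurable_funM; apply: measurable_funM => //;
      apply: measurable_funX; apply: measurable_funD; apply: measurable_funM => //;
      exact: measurable_funB.
  exists (dpol (xi i) (y i + y j) * dpol (xi j) (y i + y j)) => -[u v] /= [Iu Iv].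
  have := exchange_ge0 i j Oy Iu Iv.
  have := fun k => @exchange_le_sum y i j u v k Oy Iu Iv.
  rewrite /exchange => le ge.
  have := le i; have := le j; have := ge i; have := ge j.
  rewrite !eqxx [j == i]eq_sym (negbTE ij)/= => ge1 ge2 /(_ isT) le1 /(_ isT) le2.
  have di := dpol_ge0 (xi i) ge2; have dj := dpol_ge0 (xi j) ge1.
  rewrite ger0_norm; last exact: mulr_ge0.
  by apply: ler_pM => //; exact: dpol_le.
have [bout bin] := bmeas_int01 (F := fun u v : R =>
    dpol (xi i) (y i * (1 - u) + y j * v) *
    dpol (xi j) (y j * (1 - v) + y i * u)) measurable_unit_itv bpoly.
rewrite -int01Z//; apply: eq_int01 => u Iu.
rewrite -int01Z; last exact: bin.
by apply: eq_int01 => v Iv; exact: Iin.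
Qed.

(* If some dual polynomial exceeds [C * kap] then its weight, at least
   [1 / kap], makes the average exceed [C]. *)
Lemma exch_avg_min_le N xi y i j (C : R) : fin_conf N xi -> i != j ->
  Omega R S y -> 0 <= C ->
  exch_avg (fun x => Num.min (dual_poly xi (fun k => Num.max (x k) 0)) C) i j y <=
  dual_avg (fun eta => Num.min (dual_poly eta (fun k => Num.max (y k) 0))
     (C * (N.+1 ^ 2)%:R)) xi i j.
Proof.
move=> Nxi ij Oy C0.
have posO x : Omega R S x -> (fun k => Num.max (x k) 0) = x.
  by move=> Ox; apply/funext => k; apply/max_idPl; exact: Ox.
rewrite (posO y Oy).
have bD := bmeas_exch_dual_poly Nxi ij Oy.
have [bout bin] := bmeas_int01 (F := fun u v : R => dual_poly xi (exchange y i j u v))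
  measurable_unit_itv bD.
pose g u v : R := Num.min (dual_poly xi (exchange y i j u v)) C.
have bg : bmeas (unit_itv `*` unit_itv) (fun z => g z.1 z.2).
  split; first by apply: measurable_minr => //; exact: bD.1.
  exists C => -[u v] /= [Iu Iv].
  have Oe := exchange_ge0 i j Oy Iu Iv.
  have D0 := dual_poly_ge0 Nxi Oe.
  by rewrite ger0_norm ?le_min ?D0// ge_min lexx orbT.
have [bgout bgin] := bmeas_int01 measurable_unit_itv bg.
have -> : exch_avg (fun x => Num.min (dual_poly xi (fun k => Num.max (x k) 0)) C) i j y
   = int01 (fun u => int01 (g u)).
  apply: eq_int01 => u Iu; apply: eq_int01 => v Iv.
  by rewrite posO//; exact: exchange_ge0.
have le1 : int01 (fun u => int01 (g u)) <=
    dual_avg (fun eta => dual_poly eta y) xi i j.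
  rewrite -(exch_avg_dual_poly Nxi ij Oy); apply: int01_le => // u Iu.
  apply: int01_le; [exact: bgin|exact: bin|move=> v Iv].
  by rewrite /g ge_min lexx.
have le2 : int01 (fun u => int01 (g u)) <= C.
  rewrite -[leRHS](int01_cst C); apply: int01_le => //; first exact: bmeas_cst.
  move=> u Iu; rewrite -[leRHS](int01_cst C).
  apply: int01_le; [exact: bgin|exact: bmeas_cst|move=> v Iv].
  by rewrite /g ge_min lexx orbT.
have Nle (k : S) : (xi k <= N)%N.
  have [A [A0 _ AN _]] := fin_conf_supp Nxi.
  have [kA|/A0->//] := boolP (k \in A).
  by apply: leq_trans AN; rewrite (big_fsetD1 k)//= leq_addr.
have fe (K : 'I_(xi i).+1) (M : 'I_(xi j).+1) : fin_conf N (dual_exchange xi i j K M).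
  by apply: fin_conf_exchange => //; rewrite -ltnS.
have [[K [M big]]|small] := pselect (exists (K : 'I_(xi i).+1) (M : 'I_(xi j).+1),
    C * (N.+1 ^ 2)%:R < dual_poly (dual_exchange xi i j K M) y).
  apply: (le_trans le2).
  rewrite /dual_avg (bigD1 K)//= (bigD1 M)//=.
  rewrite min_r; last exact: ltW.
  (* Both sites carry at most N particles, which bounds the weight of the large term from below. *)
  have w1 : 1 <= ((xi i).+1%:R * (xi j).+1%:R)^-1 * (N.+1 ^ 2)%:R :> R.
    rewrite mulrC ler_pdivlMr ?mulr_gt0// mul1r -natrM ler_nat expnS expn1.
    by apply: leq_mul; rewrite ltnS.
  have P0 eta : fin_conf N eta -> 0 <= Num.min (dual_poly eta y) (C * (N.+1 ^ 2)%:R).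
    by move=> Neta; rewrite le_min (dual_poly_ge0 Neta)// mulr_ge0.
  have w0 : 0 <= ((xi i).+1%:R * (xi j).+1%:R)^-1 :> R by rewrite invr_ge0 mulr_ge0.
  rewrite -[leLHS]addr0; apply: lerD; last first.
    by apply: sumr_ge0 => K' _; apply: sumr_ge0 => M' _; rewrite mulr_ge0// P0.
  rewrite -[leLHS]addr0; apply: lerD; last first.
    by apply: sumr_ge0 => M' _; rewrite mulr_ge0// P0.
  by rewrite mulrCA -[leLHS]mulr1 ler_wpM2l.
(* In this case no term of the average is truncated. *)
rewrite (le_trans le1)// le_eqVlt; apply/orP; left; apply/eqP.
apply: eq_bigr => K _; apply: eq_bigr => M _; congr (_ * _).
apply/esym/min_idPl; rewrite leNgt; apply/negP => lt; apply: small.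
by exists K, M.
Qed.

(** The maximum with 0 sends every real configuration into [Omega], since a [test_fun] must be
    bounded also where coordinates are negative. *)
Definition cap (m : R) x : config S R := fun k => Num.max (Num.min (x k) m) 0.

Lemma cap_ge0 m x : Omega R S (cap m x).
Proof. by move=> k; rewrite /cap le_max lexx orbT. Qed.

Lemma test_fun_cap N m xi : fin_conf N xi -> 0 <= m ->
  test_fun (fun x : config S R => dual_poly xi (cap m x)).
Proof.
move=> Nxi m0; have [A [A0 _ _ _]] := fin_conf_supp Nxi; split.
- have mc : measurable_fun setT (cap m : config S R -> config S R).
    apply: measurable_to_config => k; apply: measurable_maxr => //.
    by apply: measurable_minr => //; exact: measurable_coordinate.
  exact: (measurableT_comp (measurable_dual_poly Nxi) mc).
- exists A => x y xy; apply: (dual_poly_supported A0) => k kA.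
  by rewrite /cap xy.
- exists (dual_poly xi (fun=> m)) => x; have Oc := cap_ge0 m x.
  rewrite ger0_norm ?(dual_poly_ge0 Nxi)//; apply: (dual_poly_le Nxi) => // k.
  by rewrite /cap ge_max m0 ge_min lexx orbT.
Qed.

Lemma test_fun_min N (C : R) xi : fin_conf N xi -> 0 <= C ->
  test_fun (fun x : config S R =>
    Num.min (dual_poly xi (fun k => Num.max (x k) 0)) C).
Proof.
move=> Nxi C0; have [A [A0 _ _ _]] := fin_conf_supp Nxi; split.
- have mc : measurable_fun setT
      ((fun x k => Num.max (x k) 0) : config S R -> config S R).
    apply: measurable_to_config => k; apply: measurable_maxr => //.
    exact: measurable_coordinate.
  apply: measurable_minr => //.
  exact: (measurableT_comp (measurable_dual_poly Nxi) mc).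
- exists A => x y xy; congr Num.min; apply: (dual_poly_supported A0) => k kA.
  by rewrite xy.
- exists C => x; have D0 : 0 <= dual_poly xi (fun k => Num.max (x k) 0).
    by apply: (dual_poly_ge0 Nxi) => k; rewrite le_max lexx orbT.
  by rewrite ger0_norm ?le_min ?D0// ge_min lexx orbT.
Qed.

(* A coordinate after an exchange is at most the sum of two coordinates, so
   capping at [m / 2] before the exchange caps at [m] after it. *)
Lemma exch_avg_cap_ge N xi y i j (m : R) : fin_conf N xi -> i != j ->
  Omega R S y -> 0 <= m ->
  dual_avg (fun eta => dual_poly eta (cap (m / 2) y)) xi i j <=
  exch_avg (fun x => dual_poly xi (cap m x)) i j y.
Proof.
move=> Nxi ij Oy m0; have Oc := cap_ge0 (m / 2) y.
rewrite -(exch_avg_dual_poly Nxi ij Oc).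
have [bout bin] := bmeas_int01
  (F := fun u v : R => dual_poly xi (exchange (cap (m / 2) y) i j u v))
  measurable_unit_itv (bmeas_exch_dual_poly Nxi ij Oc).
have tf := test_fun_cap Nxi m0.
apply: int01_le => [//||u Iu]; first exact: (bmeas_exch_outer i j y tf).
apply: int01_le; [exact: bin|exact: (bmeas_exch_inner i j y tf Iu)|move=> v Iv].
apply: (dual_poly_le Nxi); first exact: exchange_ge0.
move=> k; have Oe := exchange_ge0 i j Oy Iu Iv.
have lecap l : cap (m / 2) y l <= y l by rewrite /cap ge_max Oy andbT ge_min lexx.
have h1 := exchange_mono i j Iu Iv lecap k.
rewrite {2}/cap le_max le_min h1/=; apply/orP; left.
have capm l : cap (m / 2) y l <= m / 2.
  by rewrite /cap ge_max ge_min lexx orbT/= divr_ge0.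
have [kij|] := boolP ((k == i) || (k == j)).
  apply: le_trans (exchange_le_sum Oc Iu Iv kij) _.
  have := capm i; have := capm j; lra.
rewrite negb_or /exchange => /andP[/negbTE-> /negbTE->].
by apply: le_trans (capm k) _; rewrite ler_pdivrMr//; lra.
Qed.

End generator_inequalities.

(** * Series bounds for the truncated moments of the exchange process *)

Section moment_series.
Context {R : realType} {S : countType}.
Variable p : S -> S -> R.
Hypothesis hp : symmetric_irreducible p.
Implicit Types (x y : config S R) (A : {fset S}) (xi eta : config S nat).

(** For each pair the increment of [f] exceeds that of [g] by at most c = g xi - f y. Over all pairs
    this costs at most 2 N c, and the shift gains [rate N * c]. *)
Lemma exch_gen_le_dual_op N xi A (f : config S R -> R) (g : config S nat -> R) y :
  fin_conf N xi -> (forall k, k \notin A -> xi k = 0%N) -> (#|` A| <= N)%N ->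
  test_fun f -> supported A f -> bounded_fin N g -> f y <= g xi ->
  (forall i j, i != j -> exch_avg f i j y <= dual_avg g xi i j) ->
  exch_gen p f y + rate N * f y <= dual_op p N g xi.
Proof.
move=> Nxi A0 AN tf fA [C gC] fg fgij.
have [_ _ [M fM]] := tf.
rewrite exch_genE// /dual_op dual_genE; set c := g xi - f y.
have c0 : 0 <= c by rewrite subr_ge0.
pose D := Num.max (M + M) (C + C + c).
have bf : bounded_on A D (fun i j => exch_avg f i j y - f y).
  move=> i j ij; apply: (le_trans (exch_incr_bounded (A := A) y tf fM ij)).
  by rewrite le_max lexx.
have C0 : 0 <= C by apply: le_trans (gC xi Nxi).
have bg : bounded_on A D (fun i j => dual_avg g xi i j - g xi).
  move=> i j ij; apply: (le_trans (dual_incr_bounded (A := A) Nxi gC ij)).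
  by rewrite le_max lerDl c0 orbT.
have bc : bounded_on A D (fun i j => c * (touches A (i, j))%:R).
  move=> i j ->; rewrite mulr1 ger0_norm// le_max.
  by rewrite lerDr (addr_ge0 C0 C0) orbT.
have af := exch_incr_adapted y fA; have ag := dual_incr_adapted g A0.
have ac : adapted A (fun i j => c * (touches A (i, j))%:R).
  by move=> i j ij nm; rewrite (negbTE nm) mulr0.
have bs : bounded_on A (D + D) (fun i j =>
    (dual_avg g xi i j - g xi) + 1 * (c * (touches A (i, j))%:R)).
  move=> i j ij; rewrite mul1r (le_trans (ler_normD _ _))// lerD//.
    exact: bg.
  exact: bc.
have as' : adapted A (fun i j =>
    (dual_avg g xi i j - g xi) + 1 * (c * (touches A (i, j))%:R)).
  by move=> i j ij nm; rewrite ag// ac// mulr0 addr0.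
have D0 : 0 <= D by rewrite le_max (addr_ge0 (addr_ge0 C0 C0) c0) orbT.
have bf2 : bounded_on A (D + D) (fun i j => exch_avg f i j y - f y).
  by move=> i j ij; rewrite (le_trans (bf i j ij))// lerDl.
have H1 := pair_sum_le hp bf2 bs af as'.
have {}H1 := H1 (fun i j ij => ltac:(move: (ij) => /andP[/= ine _];
  rewrite ij mulr1 mul1r /c; have := fgij i j ine; lra)).
have H2 := pair_sum_cst_le hp A c0.
rewrite (pair_sum_lin hp 1 bg bc ag ac) mul1r in H1.
have H3 : c * (2 * #|` A|%:R) <= rate N * c.
  rewrite mulrC ler_wpM2r// /rate -natrM ler_nat.
  by rewrite ltnW// ltnS leq_mul2l AN orbT.
have E : rate N * g xi = rate N * f y + rate N * c by rewrite /c; ring.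
rewrite E; lra.
Qed.

(** The base is 1 + m, not m, because a total exponent of at most N may be raised to N only for a
    base at least 1. *)
Lemma dual_poly_cap_le N xi (m : R) x : fin_conf N xi -> 0 <= m ->
  dual_poly xi (cap m x) <= (1 + m) ^+ N.
Proof.
move=> [A A0 AN] m0; rewrite (dual_polyE _ A0).
have m1 : 1 <= 1 + m by rewrite lerDl.
apply: (@le_trans _ _ (\prod_(k <- A) (1 + m) ^+ xi k)).
  apply: ler_prod => k _; have Oc := cap_ge0 m x k; rewrite dpol_ge0//=.
  have cm : cap m x k <= m by rewrite /cap ge_max m0 ge_min lexx orbT.
  rewrite /dpol ler_pdivrMr ?ltr0n ?fact_gt0//.
  rewrite -[leLHS]mulr1; apply: ler_pM => //.
  - exact: exprn_ge0.
  - apply: lerXn2r; rewrite ?nnegrE ?addr_ge0//; lra.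
  - by rewrite ler1n fact_gt0.
by rewrite prodrXr; apply: ler_weXn2l.
Qed.

End moment_series.

Lemma countType_bigcup_measurable {d} {T : measurableType d} {I : countType}
    (F : I -> set T) : (forall i, measurable (F i)) -> measurable (\bigcup_i F i).
Proof. by move=> mF; apply: countable_bigcupT_measurable. Qed.

Lemma countType_bigcap_measurable {d} {T : measurableType d} {I : countType}
    (F : I -> set T) : (forall i, measurable (F i)) -> measurable (\bigcap_i F i).
Proof.
move=> mF; rewrite -[X in measurable X]setCK setC_bigcap; apply: measurableC.
by apply: countType_bigcup_measurable => i; exact: measurableC.
Qed.

Section exchange_process_moments.
Context {R : realType} {S : countType} {dW : measure_display}
  {W : measurableType dW}.
Variables (p : S -> S -> R) (P : config S R -> probability W R)
  (X : R -> W -> config S R).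
Hypothesis hp : symmetric_irreducible p.
Hypothesis hX : markov_process (Omega R S) P X.
Hypothesis hL : has_generator (Omega R S) P X (exch_gen p).
Implicit Types (x y : config S R) (A : {fset S}) (xi eta : config S nat).

Lemma measurable_Omega : measurable (Omega R S).
Proof.
rewrite (_ : Omega R S = \bigcap_(k in [set: S]) [set x : config S R | 0 <= x k]).
  apply: countType_bigcap_measurable => k.
  rewrite (_ : [set x : config S R | 0 <= x k] =
    [set: config S R] `&` (fun x : config S R => x k) @^-1` `[0, +oo[%classic).
    exact: measurable_coordinate.
  by apply/seteqP; split=> [x xk|x [_]]; rewrite /= ?in_itv/= ?andbT.
by apply/seteqP; split=> x Ox k *; exact: Ox.
Qed.

(** Each use of the generator inequality multiplies the truncation level by (N + 1)^2; the level
    reached after n uses bounds the error coefficient. *)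
Lemma min_moment_le_series N (n : nat) xi x (C t : R) : fin_conf N xi ->
  Omega R S x -> 0 <= C -> 0 <= t ->
  expR (rate N * t) * Ex (Omega R S) (flow measurable_Omega hX (giry_ret x) t)
    (fun y => Num.min (dual_poly xi (fun k => Num.max (y k) 0)) C) <=
  psum (fun k => if (k < n)%N then
      iter k (dual_op p N) (fun eta =>
        Num.min (dual_poly eta (fun l => Num.max (x l) 0)) (C * (N.+1 ^ 2)%:R ^+ k)) xi
    else rate N ^+ n * (C * (N.+1 ^ 2)%:R ^+ n) * expR (rate N * t)) n.+1 t.
Proof.
move=> Nxi Ox C0 t0.
pose h (k : nat) eta y := Num.min (dual_poly eta (fun l => Num.max (y l) 0))
  (C * (N.+1 ^ 2)%:R ^+ k) : R.
have Ck k : 0 <= C * (N.+1 ^ 2)%:R ^+ k by rewrite mulr_ge0 ?exprn_ge0.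
have hb k eta y : fin_conf N eta -> `|h k eta y| <= C * (N.+1 ^ 2)%:R ^+ k.
  move=> Neta; rewrite ger0_norm /h; first by rewrite ge_min lexx orbT.
  rewrite le_min Ck andbT; apply: (dual_poly_ge0 Neta) => l.
  by rewrite le_max lexx orbT.
have := @flow_le_dual_series _ _ _ _ _ _ _ _ _ _ measurable_Omega hX hL p hp N
  x n t h (fun k => C * (N.+1 ^ 2)%:R ^+ k) Ox.
rewrite [h 0%N]/h expr0 mulr1; apply => //.
- by move=> k eta Neta; exact: (test_fun_min Neta).
- by move=> k eta y Neta _; exact: hb.
- move=> k eta y Neta Oy; have [A [A0 AN _ _]] := fin_conf_supp Neta.
  apply: (exch_gen_le_dual_op hp Neta A0 AN).
  + exact: (test_fun_min Neta).
  + move=> u v uv; congr Num.min; apply: (dual_poly_supported A0) => l lA.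
    by rewrite uv.
  + by exists (C * (N.+1 ^ 2)%:R ^+ k.+1) => zeta Nzeta; exact: hb.
  + rewrite /h le_min ge_min lexx/= ge_min; apply/orP; right.
    rewrite exprS mulrCA ler_peMl//.
    by rewrite ler1n expn_gt0.
  + move=> i j ij; have := exch_avg_min_le Neta ij Oy (Ck k).
    by rewrite -mulrA -exprSr.
Qed.

(** The upper comparison is applied to the negated polynomials, with the cap halved at each
    iteration; hence the minus sign on the last coefficient. *)
Lemma cap_moment_ge_series N (n : nat) xi x (m t : R) : fin_conf N xi ->
  Omega R S x -> 0 <= m -> 0 <= t ->
  psum (fun k => if (k < n)%N then
      iter k (dual_op p N) (fun eta => dual_poly eta (cap (m / 2 ^+ k) x)) xi
    else - (rate N ^+ n * (1 + m / 2 ^+ n) ^+ N * expR (rate N * t))) n.+1 t <=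
  expR (rate N * t) * Ex (Omega R S) (flow measurable_Omega hX (giry_ret x) t)
    (fun y => dual_poly xi (cap m y)).
Proof.
move=> Nxi Ox m0 t0.
pose h (k : nat) eta y := -1 * dual_poly eta (cap (m / 2 ^+ k) y) : R.
have mk k : 0 <= m / 2 ^+ k by rewrite divr_ge0 ?exprn_ge0.
have hb0 k eta y : fin_conf N eta ->
    `|dual_poly eta (cap (m / 2 ^+ k) y)| <= (1 + m / 2 ^+ k) ^+ N.
  move=> Neta; rewrite ger0_norm; first exact: dual_poly_cap_le.
  apply: (dual_poly_ge0 Neta); exact: cap_ge0.
have hb k eta y : fin_conf N eta -> `|h k eta y| <= (1 + m / 2 ^+ k) ^+ N.
  by move=> Neta; rewrite /h mulN1r normrN hb0.
have bh k y : bounded_fin N (fun eta => dual_poly eta (cap (m / 2 ^+ k) y)).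
  by exists ((1 + m / 2 ^+ k) ^+ N) => eta; exact: hb0.
have := @flow_le_dual_series _ _ _ _ _ _ _ _ _ _ measurable_Omega hX hL p hp N
  x n t h (fun k => (1 + m / 2 ^+ k) ^+ N) Ox.
move=> /(_ _ _ _)/wrap[].
- move=> k eta Neta.
  have [mf [A fA] [M fM]] := test_fun_cap Neta (mk k); split.
  + exact: measurable_funM.
  + by exists A => u v uv; rewrite /h (fA u v uv).
  + by exists M => u; rewrite /h mulN1r normrN.
- by move=> k eta y Neta _; exact: hb.
- move=> k eta y Neta Oy; have [A [A0 AN _ _]] := fin_conf_supp Neta.
  have tf := test_fun_cap Neta (mk k).
  have tN : test_fun (h k eta).
    have [mf [A' fA] [M fM]] := tf; split.
    + exact: measurable_funM.
    + by exists A' => u v uv; rewrite /h (fA u v uv).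
    + by exists M => u; rewrite /h mulN1r normrN.
  have mE : m / 2 ^+ k.+1 = m / 2 ^+ k / 2.
    by rewrite exprSr; field; rewrite expf_neq0.
  apply: (exch_gen_le_dual_op hp Neta A0 AN) => //.
  + move=> u v uv; congr (_ * _); apply: (dual_poly_supported A0) => l lA.
    by rewrite /cap uv.
  + by exists ((1 + m / 2 ^+ k.+1) ^+ N) => zeta; exact: hb.
  + rewrite /h !mulN1r lerN2; apply: (dual_poly_le Neta).
      exact: cap_ge0.
    move=> l; rewrite /cap ge_max le_max le_min ge_min lexx/=.
    rewrite le_max lexx orbT andbT ge_min; apply/orP; left.
    apply/orP; right; rewrite mE ler_pdivrMr//.
    by have := mk k; lra.
  + move=> i j ij.
    have -> : exch_avg (h k eta) i j y =
        - exch_avg (fun y => dual_poly eta (cap (m / 2 ^+ k) y)) i j y.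
      rewrite /exch_avg -mulN1r -int01Z; last exact: (bmeas_exch_outer i j y tf).
      apply: eq_int01 => u Iu; rewrite -int01Z//.
      exact: (bmeas_exch_inner i j y tf Iu).
    rewrite /h.
    have := dual_avg_lin (-1) (fun=> 0 : R)
      (fun eta => dual_poly eta (cap (m / 2 ^+ k.+1) y)) eta i j.
    under [X in dual_avg X]eq_fun do rewrite add0r.
    rewrite dual_avg_cst add0r mulN1r => ->.
    rewrite lerN2 mE; exact (exch_avg_cap_ge Neta ij Oy (mk k)).
move=> H; rewrite -lerN2.
have := H t xi t0 (lexx t) Nxi; rewrite ExZ; last first.
- apply: test_fun_bmeas; rewrite /h expr0 divr1; exact: (test_fun_cap Nxi m0).
- exact: measurable_Omega.
rewrite mulrCA mulN1r expr0 divr1 => /le_trans; apply.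
rewrite -[leRHS]mulN1r /psum mulr_sumr; apply: ler_sum => k _.
rewrite !mulrA; rewrite le_eqVlt; apply/orP; left; apply/eqP.
congr (_ * _ / _); case: ifP => _; last by rewrite mulrN mulN1r opprK.
have := iter_dual_op_lin hp k (-1) (bounded_fin_cst N (0 : R)) (bh k x) Nxi.
rewrite iter_dual_op0// add0r => <-; congr (iter _ _ _ _); apply/funext => eta.
by rewrite add0r.
Qed.

End exchange_process_moments.

(** * Uniqueness for the forward equation *)

(* [delta] stands for the difference of the expectations under two solutions of
   the forward equation with generator [L], the observables being restricted to
   a class [Z] on which the two agree at time 0. *)
Section forward_uniqueness.
Context {R : realType} {S : countType} {dE : measure_display}
  {E : measurableType dE}.
Variable p : S -> S -> R.
Hypothesis hp : symmetric_irreducible p.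
Variable Om : set (config S E).
Implicit Types (A : {fset S}) (f g : config S E -> R) (t : R).

Variable avg : (config S E -> R) -> S -> S -> config S E -> R.
Variable L : (config S E -> R) -> config S E -> R.
Hypothesis LE : forall f x, test_fun f -> Om x ->
  L f x = pair_sum (fun i j => p i j * (avg f i j x - f x)).
Hypothesis test_avg : forall f i j, test_fun f -> test_fun (avg f i j).
Hypothesis supported_avg : forall f i j A, supported A f ->
  supported (i |` (j |` A))%fset (avg f i j).
Hypothesis avg_bound : forall f i j x M, test_fun f ->
  (forall y, `|f y| <= M) -> `|avg f i j x| <= M.
Hypothesis avg_adapted : forall f A x, supported A f ->
  adapted A (fun i j => avg f i j x - f x).

Variable Z : (config S E -> R) -> Prop.
Hypothesis Z_avg : forall f i j, i != j -> Z f -> Z (avg f i j).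

Variable delta : R -> (config S E -> R) -> R.
Variable K : R.
Hypothesis K0 : 0 <= K.
Hypothesis delta_lin : forall t c f g, 0 <= t -> bmeas Om f -> bmeas Om g ->
  delta t (fun x => f x + c * g x) = delta t f + c * delta t g.
Hypothesis delta_bound : forall t f M, 0 <= t -> 0 <= M -> bmeas Om f ->
  (forall x, Om x -> `|f x| <= M) -> `|delta t f| <= K * M.
Hypothesis bmeas_L : forall f, test_fun f -> bmeas Om (L f).
Hypothesis delta_deriv : forall f t, test_fun f -> 0 < t ->
  is_derive t 1 (fun s => delta s f) (delta t (L f)).
Hypothesis delta_cvg0 : forall f, test_fun f ->
  delta s f @[s --> 0^'+] --> delta 0 f.
Hypothesis delta_0 : forall f, test_fun f -> Z f -> delta 0 f = 0.

Lemma delta_sum t (s : seq (S * S)) (c : S * S -> R) (F : S * S -> config S E -> R)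
    g : 0 <= t -> bmeas Om g -> (forall k, bmeas Om (F k)) ->
  delta t (fun x => g x + \sum_(k <- s) c k * F k x) =
  delta t g + \sum_(k <- s) c k * delta t (F k).
Proof.
move=> t0 + bF; elim: s g => [|k s ih] g bg.
  by under [X in delta t X]eq_fun do rewrite big_nil addr0; rewrite big_nil addr0.
under [X in delta t X]eq_fun do rewrite big_cons addrA.
rewrite ih; first by rewrite delta_lin// big_cons addrA.
by apply: bmeasD => //; exact: bmeasZ.
Qed.

Let beta M (a n : nat) t := K * M * a.+1%:R * expR (2 * t) / (a.+1 + n)%:R.

(** One of the two sites is already in [A], so a jump creates at most one new site, like a
    splitting. *)
Let card_touch A k : touches A k -> (#|` (k.1 |` (k.2 |` A))%fset| <= #|` A|.+1)%N.
Proof.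
move=> /andP[_]; rewrite !cardfsU1 !inE.
by case: (k.1 \in A); case: (k.2 \in A); case: (k.1 == k.2) => //= _; lia.
Qed.

(* The factors [2 * a.+1] and [expR (2 * t) / (a.+1 + n)] are those of a
   branching process in which each of the sites of the support splits at rate 2:
   [n] splittings by time [t] have probability at most [beta 1 a n t]. *)
Lemma delta_le_beta n a f A M t : supported A f -> (#|` A| <= a.+1)%N -> Z f ->
  test_fun f -> (forall x, `|f x| <= M) -> 0 <= t ->
  `|delta t f| <= beta M a n t.
Proof.
elim: n a f A t => [|n ih] a f A t fA Aa Zf tf fM t0;
    have M0 : 0 <= M by apply: le_trans (fM point).
  rewrite /beta addn0 mulrAC mulfK ?pnatr_eq0//.
  apply: (@le_trans _ _ (K * M)).
    by apply: delta_bound => //; exact: test_fun_bmeas.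
  by rewrite ler_peMr ?mulr_ge0// -expR0 ler_expR mulr_ge0.
have bf := test_fun_bmeas Om tf; have bL := bmeas_L tf.
pose lam : R := 2 * a.+1%:R.
(* The averages [avg f] carry total weight q, and what remains of the shift is (lam - q) [f]. Both
   fall under the induction hypothesis for supports of at most a + 2 sites, and the weights add up
   to lam. *)
have key (s : R) : 0 < s -> `|delta s (L f) + lam * delta s f| <= lam * beta M a.+1 n s.
  move=> s0; apply/ler_addgt0Pr => e e0.
  have d0 : 0 < e / (K + 1) by rewrite divr_gt0// ltr_wpDl.
  have [F FA HF] := pair_sum_approx hp A (addr_ge0 M0 M0) d0.
  set q := \sum_(k <- F) p k.1 k.2.
  have q0 : 0 <= q by apply: sumr_ge0 => k _; exact: (kernel_ge0 hp).
  have qlam : q <= lam.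
    apply: le_trans (touches_sum_le hp FA) _.
    by rewrite ler_wpM2l// ler_nat.
  pose g x := 0 + \sum_(k <- F) p k.1 k.2 * (avg f k.1 k.2 x - f x).
  have bavg k : bmeas Om (avg f k.1 k.2).
    by apply: test_fun_bmeas; exact: test_avg.
  have bavgf (k : S * S) : bmeas Om (fun x => avg f k.1 k.2 x - f x).
    exact: bmeasB.
  have bg : bmeas Om g.
    apply: bmeasD; first exact: bmeas_cst.
    by apply: bmeas_sum => k _; exact: bmeasZ.
  have close : `|delta s (L f) - delta s g| <= e.
    have -> : delta s (L f) - delta s g = delta s (fun x => L f x + -1 * g x).
      by rewrite delta_lin ?mulN1r ?ltW.
    apply: (@le_trans _ _ (K * (e / (K + 1)))).
      apply: delta_bound => //; [exact: ltW|exact: ltW| |].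
        by apply: bmeasD => //; exact: bmeasZ.
      move=> x Ox; rewrite mulN1r LE// /g add0r; apply: HF.
      - move=> i j ij; rewrite (le_trans (ler_normB _ _))// lerD//.
        exact: avg_bound.
      - exact: avg_adapted.
    by rewrite mulrCA ger_pMr// ler_pdivrMr ?mul1r ?lerDl ?ltr_wpDl.
  have Eg : delta s g = \sum_(k <- F) p k.1 k.2 * (delta s (avg f k.1 k.2)) - q * delta s f.
    rewrite delta_sum ?(ltW s0)//; last exact: bmeas_cst.
    have -> : delta s (fun=> 0) = 0.
      have := delta_lin (-1) (ltW s0) (bmeas_cst Om 0) (bmeas_cst Om 0).
      by rewrite (mulr0 (-1)) addr0 mulN1r subrr.
    rewrite add0r mulr_suml -sumrB; apply: eq_bigr => k _; rewrite -mulrBr.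
    by rewrite -mulN1r -delta_lin ?(ltW s0)//; under [in RHS]eq_fun do rewrite mulN1r.
  have b1 : `|delta s f| <= beta M a.+1 n s.
    by apply: ih fA _ Zf tf fM (ltW s0); exact: leqW.
  have b2 : `|\sum_(k <- F) p k.1 k.2 * delta s (avg f k.1 k.2)| <= q * beta M a.+1 n s.
    rewrite (le_trans (ler_norm_sum _ _ _))// mulr_suml !big_seq.
    apply: ler_sum => k kF; rewrite normrM (ger0_norm (kernel_ge0 hp _ _)).
    rewrite ler_wpM2l ?(kernel_ge0 hp)//.
    have /andP[kne _] := FA k kF.
    apply: (ih _ _ _ _ (supported_avg (i := k.1) (j := k.2) fA)) => //.
    - by apply: leq_trans (card_touch (FA k kF)) _.
    - exact: Z_avg.
    - exact: test_avg.
    - by move=> x; exact: avg_bound.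
    - exact: ltW.
  have -> : delta s (L f) + lam * delta s f = (delta s (L f) - delta s g) +
      (\sum_(k <- F) p k.1 k.2 * delta s (avg f k.1 k.2)) + (lam - q) * delta s f.
    by rewrite Eg; ring.
  have b3 : `|(lam - q) * delta s f| <= (lam - q) * beta M a.+1 n s.
    by rewrite normrM ger0_norm ?subr_ge0// ler_wpM2l// subr_ge0.
  have := ler_normD (delta s (L f) - delta s g + \sum_(k <- F) p k.1 k.2 *
    delta s (avg f k.1 k.2)) ((lam - q) * delta s f).
  have := ler_normD (delta s (L f) - delta s g) (\sum_(k <- F) p k.1 k.2 *
    delta s (avg f k.1 k.2)).
  have : q * beta M a.+1 n s + (lam - q) * beta M a.+1 n s = lam * beta M a.+1 n s.
    by ring.
  by lra.
pose c := K * M * a.+1%:R / (a.+1 + n.+1)%:R.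
have c0 : 0 <= c by rewrite divr_ge0 ?mulr_ge0.
pose G (s : R) : R := c * expR ((lam + 2) * s).
pose G' (s : R) : R := c * (lam + 2) * expR ((lam + 2) * s).
have dG (s : R) : is_derive s 1 G (G' s).
  rewrite /G /G'; apply: is_derive_eq.
  by rewrite /GRing.scale/= mulr1; ring.
(* The bound integrates exactly: lam + 2 = 2 (a + 2) cancels the numerator of [beta M a.+1 n], and
   its denominator is already that of [beta M a n.+1]. *)
have GG (s : R) : expR (lam * s) * (lam * beta M a.+1 n s) = G' s.
  rewrite /G' /beta (mulrDl lam) expRD /c.
  have -> : (a.+2 + n = a.+1 + n.+1)%N by rewrite addSnnS.
  have -> : lam + 2 = 2 * a.+2%:R by rewrite /lam -[in RHS]natr1; ring.
  by move: (expR (lam * s)) (expR (2 * s)) => u v; rewrite /lam; ring.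
have bt : expR (lam * t) * beta M a n.+1 t = G t.
  by rewrite /G /beta (mulrDl lam) expRD /c; ring.
have e1 : 0 < expR (lam * t) by exact: expR_gt0.
have up : expR (lam * t) * delta t f <= G t.
  apply: (@exp_comparison _ lam t (fun s => delta s f) (fun s => delta s (L f)) G G') => //.
  - by move=> s s0; exact: delta_deriv.
  - exact: delta_cvg0.
  - move=> s s0 _; rewrite -GG ler_wpM2l ?expR_ge0//.
    by apply: le_trans (key s s0); exact: ler_norm.
  - by rewrite delta_0// /G mulr_ge0 ?expR_ge0.
have dn : expR (lam * t) * - delta t f <= G t.
  apply: (@exp_comparison _ lam t (fun s => - delta s f) (fun s => - delta s (L f)) G G') => //.
  - by move=> s s0; have := delta_deriv tf s0 => ?; exact: is_deriveN.
  - by apply: cvgN; exact: delta_cvg0.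
  - move=> s s0 _; rewrite -GG ler_wpM2l ?expR_ge0//.
    rewrite mulrN -opprD; apply: le_trans (key s s0).
    by rewrite -normrN; exact: ler_norm.
  - by rewrite delta_0// oppr0 /G mulr_ge0 ?expR_ge0.
rewrite -bt mulrN lerNl -mulrN ler_pM2l// in dn.
rewrite -bt ler_pM2l// in up.
by rewrite ler_norml dn up.
Qed.

(** For fixed t the bound [beta] decreases like 1 / n, and n is arbitrary. *)
Lemma delta_eq0 f t : test_fun f -> Z f -> 0 <= t -> delta t f = 0.
Proof.
move=> tf Zf t0; have [_ [A fA] [M fM]] := tf.
apply/eqP; rewrite -normr_le0; apply/ler_addgt0Pr => e e0; rewrite add0r.
pose a := #|` A|.
pose c := K * M * a.+1%:R * expR (2 * t).
have [n nc] : exists n : nat, c / e < n%:R.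
  exists (Num.bound (c / e)); apply: archi_boundP.
  have M0 : 0 <= M by apply: le_trans (fM point).
  by rewrite divr_ge0 ?(ltW e0)// /c !mulr_ge0 ?expR_ge0.
apply: le_trans (delta_le_beta n fA (leqnSn _) Zf tf fM t0) _.
rewrite /beta -/a -/c ler_pdivrMr ?ltr0n ?addSn//.
move: nc; rewrite ltr_pdivrMr// => /ltW/le_trans; apply.
by rewrite mulrC ler_wpM2l ?(ltW e0)// ler_nat -addSn leq_addl.
Qed.

End forward_uniqueness.

(** * The dual process *)

Section countable_local_functions.
Context {R : realType} {S : countType}.
Implicit Types (xi eta : config S nat) (A : {fset S}).

Lemma measurable_map_eq (s : seq S) (v : seq nat) :
  measurable [set eta : config S nat | [seq eta i | i <- s] = v].
Proof.
elim: s v => [|i s ih] [|a v].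
- by rewrite (_ : [set _ | _] = setT)//; apply/seteqP; split.
- by rewrite (_ : [set _ | _] = set0)//; apply/seteqP; split.
- by rewrite (_ : [set _ | _] = set0)//; apply/seteqP; split.
rewrite (_ : [set _ | _] =
  ([set: config S nat] `&` (fun eta : config S nat => eta i) @^-1` [set a]) `&`
  [set eta : config S nat | [seq eta i | i <- s] = v]).
  by apply: measurableI => //; exact: measurable_coordinate.
by apply/seteqP; split=> [eta /= [<- <-]//|eta /= [[_ <-] <-]].
Qed.

(** The restriction of a configuration to [A] takes countably many values, so a preimage under [f]
    is a countable union of cylinders. *)
Lemma measurable_supported A (f : config S nat -> R) : supported A f ->
  measurable_fun setT f.
Proof.
move=> fA _ B _; rewrite setTI.
rewrite (_ : f @^-1` B = \bigcup_(v : seq nat)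
    ([set eta | [seq eta i | i <- enum_fset A] = v] `&` f @^-1` B)).
  apply: countType_bigcup_measurable => v.
  have [[eta0 [<- Beta]]|nex] := pselect (exists eta0 : config S nat,
      [seq eta0 i | i <- enum_fset A] = v /\ B (f eta0)).
    rewrite (_ : _ `&` _ = [set eta : config S nat |
      [seq eta i | i <- enum_fset A] = [seq eta0 i | i <- enum_fset A]]).
      exact: measurable_map_eq.
    apply/seteqP; split=> [eta []//|eta /= E]; split => //=.
    rewrite (fA eta eta0)// => i iA.
    by move/eq_in_map : E; exact.
  rewrite (_ : _ `&` _ = set0)// -subset0 => eta /= [E Beta].
  by apply: nex; exists eta.
apply/seteqP; split=> [eta Beta|eta [v _ [_]]//].
by exists [seq eta i | i <- enum_fset A].
Qed.

Lemma test_fun_supported A (f : config S nat -> R) M : supported A f ->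
  (forall xi, `|f xi| <= M) -> test_fun f.
Proof.
by move=> fA fM; split; [exact: measurable_supported fA|exists A|exists M].
Qed.

Lemma fin_conf_sum_le N xi A : fin_conf N xi -> (\sum_(i <- A) xi i <= N)%N.
Proof.
move=> [B B0 BN]; apply: leq_trans BN.
apply: (@leq_trans (\sum_(i <- (A `&` B)%fset) xi i)).
  rewrite (big_fsetID _ (mem B))/= [X in (_ + X)%N]big1_seq ?addn0; last first.
    by move=> i; rewrite !inE/= => /andP[_ /B0].
  rewrite leq_eqVlt; apply/orP; left; apply/eqP/eq_fbigl => i.
  by rewrite !inE.
rewrite [leqRHS](big_fsetID _ (mem A))/= [X in (_ <= X + _)%N](_ : _ =
  \sum_(i <- (A `&` B)%fset) xi i)%N ?leq_addr//.
by apply: eq_fbigl => i; rewrite !inE andbC.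
Qed.

(** Replaces the existential support by countably many conditions on finitely many sites each, which
    gives measurability. Conversely, a finite set with the largest particle number contains every
    occupied site. *)
Lemma fin_confP N xi :
  fin_conf N xi <-> forall A, (\sum_(i <- A) xi i <= N)%N.
Proof.
split=> [Nxi A|H]; first exact: fin_conf_sum_le.
pose P n := `[< exists A, (\sum_(i <- A) xi i = n)%N >].
have exP : exists n, P n by exists 0%N; apply/asboolP; exists fset0; rewrite big_seq_fset0.
have ubP n : P n -> (n <= N)%N by move=> /asboolP[A <-].
have [n /asboolP[A An] maxn] := ex_maxnP exP ubP.
exists A; last by rewrite An; apply/ubP/asboolP; exists A.
move=> i iA; have : (\sum_(j <- (i |` A)%fset) xi j <= n)%N.
  by apply/maxn/asboolP; exists (i |` A)%fset.
by rewrite big_fsetU1//= An -[leqRHS]add0n leq_add2r leqn0 => /eqP.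
Qed.

Definition exceeds N A xi : R := (N < \sum_(i <- A) xi i)%N%:R.

Lemma supported_exceeds N A : supported A (exceeds N A).
Proof.
move=> x y xy; rewrite /exceeds (_ : \sum_(i <- A) x i = \sum_(i <- A) y i)%N//.
by rewrite !big_seq; apply: eq_bigr => i iA; rewrite xy.
Qed.

Lemma test_fun_exceeds N A : test_fun (exceeds N A).
Proof.
apply: (test_fun_supported (M := 1) (@supported_exceeds N A)) => xi.
by rewrite /exceeds; case: ltnP; rewrite ?normr1 ?normr0.
Qed.

Lemma exceeds_fin_conf N A xi : fin_conf N xi -> exceeds N A xi = 0.
Proof. by move=> Nxi; rewrite /exceeds ltnNge fin_conf_sum_le. Qed.

Lemma measurable_exceeds N A :
  measurable [set xi : config S nat | N < \sum_(i <- A) xi i]%N.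
Proof.
rewrite (_ : [set _ | _] = [set: config S nat] `&` exceeds N A @^-1` [set 1]).
  have [m _ _] := test_fun_exceeds N A; exact: m.
apply/seteqP; split=> [xi /= h|xi /= [_]]; first by rewrite /exceeds h.
by rewrite /exceeds; case: ltnP => // _ /eqP; rewrite eq_sym oner_eq0.
Qed.

Lemma not_fin_conf N : ~` [set xi : config S nat | fin_conf N xi] =
  \bigcup_(A : {fset S}) [set xi : config S nat | N < \sum_(i <- A) xi i]%N.
Proof.
apply/seteqP; split=> [xi /= /fin_confP/existsNP[A /negP]|xi [A _ /= h] /fin_confP].
  by rewrite -ltnNge; exists A.
by move=> /(_ A); rewrite leqNgt h.
Qed.

Lemma measurable_fin_conf N : measurable [set xi : config S nat | fin_conf N xi].
Proof.
rewrite -[X in measurable X]setCK; apply: measurableC; rewrite not_fin_conf.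
by apply: countType_bigcup_measurable => A; exact: measurable_exceeds.
Qed.

End countable_local_functions.

Section test_function_closure.
Context {R : realType} {S : countType} {dE : measure_display}
  {E : measurableType dE}.
Implicit Types (f g : config S E -> R).

Lemma test_fun_lin c f g : test_fun f -> test_fun g ->
  test_fun (fun x => f x + c * g x).
Proof.
move=> [mf [A fA] [M fM]] [mg [B gB] [K gK]]; split.
- by apply: measurable_funD => //; exact: measurable_funM.
- exists (A `|` B)%fset => x y xy; congr (_ + _ * _).
    by apply: fA => i iA; apply: xy; rewrite inE iA.
  by apply: gB => i iB; apply: xy; rewrite inE iB orbT.
- exists (M + `|c| * K) => x.
  by rewrite (le_trans (ler_normD _ _))// lerD// normrM ler_wpM2l.
Qed.

Lemma test_fun_cst (c : R) : test_fun (fun _ : config S E => c).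
Proof. by split=> //; [exists fset0|exists `|c|]. Qed.

Lemma test_fun_sum (I : Type) (s : seq I) (c : I -> R) (F : I -> config S E -> R) :
  (forall i, test_fun (F i)) -> test_fun (fun x => \sum_(i <- s) c i * F i x).
Proof.
move=> tF; elim: s => [|i s ih].
  by under eq_fun do rewrite big_nil; exact: test_fun_cst.
under eq_fun do rewrite big_cons addrC.
exact: test_fun_lin.
Qed.

End test_function_closure.

Lemma countType_bigcup_null {d} {T : measurableType d} {R : realType}
    {I : countType} (m : {measure set T -> \bar R}) (F : I -> set T) :
  (forall i, measurable (F i)) -> (forall i, m (F i) = 0%E) ->
  m (\bigcup_i F i) = 0%E.
Proof.
move=> mF F0.
pose G (n : nat) := if (choice.unpickle n : option I) is Some i then F i else set0.
have -> : \bigcup_i F i = \bigcup_n G n.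
  apply/seteqP; split=> [x [i _ Fx]|x [n _]].
    by exists (choice.pickle i) => //; rewrite /G choice.pickleK.
  by rewrite /G; case: (choice.unpickle n) => // i Fx; exists i.
have mG n : measurable (G n) by rewrite /G; case: (choice.unpickle n).
apply/measure_negligible; first exact: bigcupT_measurable.
apply: negligible_bigcup => n; apply/negligibleP; first exact: mG.
rewrite /G; case: (choice.unpickle n) => [i|]; [exact: F0|exact: measure0].
Qed.

Section dual_process.
Context {R : realType} {S : countType} {dW : measure_display}
  {W : measurableType dW}.
Variables (p : S -> S -> R) (Q : config S nat -> probability W R)
  (Y : R -> W -> config S nat).
Hypothesis hp : symmetric_irreducible p.
Hypothesis hY : markov_process [set: config S nat] Q Y.
Hypothesis hL : has_generator [set: config S nat] Q Y (dual_gen p).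
Variable N : nat.
Implicit Types (xi eta : config S nat) (A : {fset S}) (f : config S nat -> R).

Lemma dual_avg_norm_le_all f xi i j C :
  (forall eta, `|f eta| <= C) -> `|dual_avg f xi i j| <= C.
Proof.
move=> fC; rewrite -[leRHS](dual_avg_cst C xi i j) /dual_avg.
apply: (le_trans (ler_norm_sum _ _ _)); apply: ler_sum => K _.
apply: (le_trans (ler_norm_sum _ _ _)); apply: ler_sum => M _.
by rewrite normrM ger0_norm ?ler_wpM2l// invr_ge0 mulr_ge0.
Qed.

Lemma dual_avg_supported f i j A : supported A f ->
  supported (i |` (j |` A))%fset (fun xi => dual_avg f xi i j).
Proof.
move=> fA x y xy; rewrite /dual_avg.
have xi : x i = y i by apply: xy; rewrite !inE eqxx.
have xj : x j = y j by apply: xy; rewrite !inE eqxx orbT.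
(* The ordinal types depend on [x i] and [x j]; as sums over ranges of natural numbers, the bounds
   can be rewritten. *)
rewrite -(big_mkord xpredT (fun K => \sum_(M < (x j).+1)
  ((x i).+1%:R * (x j).+1%:R)^-1 * f (dual_exchange x i j K M))).
rewrite -(big_mkord xpredT (fun K => \sum_(M < (y j).+1)
  ((y i).+1%:R * (y j).+1%:R)^-1 * f (dual_exchange y i j K M))).
rewrite xi; apply: eq_bigr => K _.
rewrite -(big_mkord xpredT (fun M =>
  ((y i).+1%:R * (x j).+1%:R)^-1 * f (dual_exchange x i j K M))).
rewrite -(big_mkord xpredT (fun M =>
  ((y i).+1%:R * (y j).+1%:R)^-1 * f (dual_exchange y i j K M))).
rewrite xj; apply: eq_bigr => M _; congr (_ * _).
apply: fA => k kA; rewrite /dual_exchange xi xj xy//.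
by rewrite !inE kA !orbT.
Qed.

Lemma test_fun_dual_avg f i j : test_fun f ->
  test_fun (fun xi => dual_avg f xi i j).
Proof.
move=> [_ [A fA] [M fM]].
apply: (test_fun_supported (M := M) (dual_avg_supported (i := i) (j := j) fA)).
by move=> xi; exact: dual_avg_norm_le_all.
Qed.

Lemma dual_incr_adapted_supported f A xi : supported A f ->
  adapted A (fun i j => dual_avg f xi i j - f xi).
Proof.
move=> fA i j ij; rewrite /touches ij/= negb_or => /andP[iA jA].
rewrite -[X in _ - X](dual_avg_cst (f xi) xi i j) /dual_avg.
apply/eqP; rewrite subr_eq0; apply/eqP.
apply: eq_bigr => K _; apply: eq_bigr => M _; congr (_ * _).
apply: fA => k kA; rewrite dual_exchange_out//.
  by apply: contraNneq iA => <-.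
by apply: contraNneq jA => <-.
Qed.

Let mT : measurable [set: config S nat] := measurableT.
Let law xi t : giry (config S nat) R := flow mT hY (giry_ret xi) t.
Let Fin : set (config S nat) := [set xi | fin_conf N xi].

Let ret_supp xi : (giry_ret xi : giry (config S nat) R) (~` setT) = 0%E.
Proof. by rewrite setCT measure0. Qed.

(** Uniqueness against the zero solution, with [Z] the functions vanishing on [fin_conf N]:
    conservation of particles keeps this class stable under [dual_avg]. *)
Lemma dual_law_vanish f xi t : fin_conf N xi -> test_fun f ->
  (forall eta, fin_conf N eta -> f eta = 0) -> 0 <= t ->
  Ex setT (law xi t) f = 0.
Proof.
move=> Nxi tf f0 t0.
apply: (@delta_eq0 _ _ _ _ p hp setT (fun f i j xi => dual_avg f xi i j)
  (dual_gen p) _ _ _ _ _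
  (fun f => forall eta, fin_conf N eta -> f eta = 0) _
  (fun t f => Ex setT (law xi t) f) 1) => //.
- by move=> g eta _ _; exact: dual_genE.
- by move=> g i j; exact: test_fun_dual_avg.
- by move=> g i j A; exact: dual_avg_supported.
- by move=> g i j eta M _; exact: dual_avg_norm_le_all.
- by move=> g A eta; exact: dual_incr_adapted_supported.
- move=> g i j ij g0 eta Neta; rewrite /dual_avg big1// => K _; rewrite big1// => M _.
  by rewrite g0 ?mulr0//; apply: fin_conf_exchange => //; rewrite -ltnS.
- move=> s c g h s0 bg bh; rewrite ExD ?ExZ//; exact: bmeasZ.
- by move=> s g M s0 M0 bg gM; rewrite mul1r; exact: Ex_norm_le.
- by move=> g; exact: (bmeas_generator mT hY hL).
- by move=> g s tg s0; exact: flow_is_derive.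
- move=> g tg; rewrite (_ : Ex _ _ _ = Ex setT (giry_ret xi) g).
    exact: (flow_cvg0 mT hY hL (ret_supp xi) tg).
  by rewrite Ex_flow0//; exact: test_fun_bmeas.
- move=> g tg g0; rewrite Ex_flow0//; last exact: test_fun_bmeas.
  by rewrite Ex_ret ?g0//; exact: test_fun_bmeas.
Qed.

(** The complement is a countable union, over finite sets of sites, of events whose indicators
    [exceeds] are local and vanish on [Fin]. *)
Lemma dual_law_fin xi t : fin_conf N xi -> 0 <= t -> law xi t (~` Fin) = 0%E.
Proof.
move=> Nxi t0; rewrite /Fin not_fin_conf.
have m0 A : law xi t [set eta : config S nat | N < \sum_(i <- A) eta i]%N = 0%E.
  have mA := @measurable_exceeds R S N A.
  have := dual_law_vanish Nxi (test_fun_exceeds N A)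
    (fun eta Neta => exceeds_fin_conf A Neta) t0.
  rewrite /Ex /Rintegral.
  rewrite (eq_integral (fun eta =>
    (\1_[set eta : config S nat | N < \sum_(i <- A) eta i]%N eta)%:E)).
    rewrite integral_indic// setIT => h.
    by rewrite -[LHS]fineK ?h// fin_num_measure.
  move=> eta _; rewrite indicE /exceeds; congr (_%:R)%:E.
  by congr nat_of_bool; apply/idP/idP; rewrite inE.
apply: countType_bigcup_null => A; last exact: m0.
exact: (@measurable_exceeds R S N A).
Qed.


End dual_process.

Section exponential_polynomials.
Context {R : realType}.

Lemma psum_le (c c' : nat -> R) n t : 0 <= t ->
  (forall k, (k < n)%N -> c k <= c' k) -> psum c n t <= psum c' n t.
Proof.
move=> t0 cc'; apply: ler_sum => k _.
by rewrite ler_wpM2r ?invr_ge0// ler_wpM2r ?exprn_ge0// cc'.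
Qed.

Lemma psum_lin (c c' : nat -> R) e n t :
  psum (fun k => c k + e * c' k) n t = psum c n t + e * psum c' n t.
Proof.
by rewrite /psum mulr_sumr -big_split/=; apply: eq_bigr => k _; ring.
Qed.

Lemma eq_psum (c c' : nat -> R) n t : (forall k, (k < n)%N -> c k = c' k) ->
  psum c n t = psum c' n t.
Proof. by move=> cc'; apply: eq_bigr => k _; rewrite cc'. Qed.

End exponential_polynomials.

(** * Exponential series for the dual expectations *)

Section dual_process_series.
Context {R : realType} {S : countType} {dW : measure_display}
  {W : measurableType dW}.
Variables (p : S -> S -> R) (Q : config S nat -> probability W R)
  (Y : R -> W -> config S nat).
Hypothesis hp : symmetric_irreducible p.
Hypothesis hY : markov_process [set: config S nat] Q Y.
Hypothesis hL : has_generator [set: config S nat] Q Y (dual_gen p).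
Variable N : nat.
Implicit Types (xi eta : config S nat) (A : {fset S}) (f : config S nat -> R).

Let mT : measurable [set: config S nat] := measurableT.
Let law xi t : giry (config S nat) R := flow mT hY (giry_ret xi) t.
Let Fin : set (config S nat) := [set xi | fin_conf N xi].
Let G := @dual_op R S p N.
Let lam : R := rate N.

Let mFin : measurable Fin := @measurable_fin_conf R S N.

Lemma Ex_law_le_cst f xi (C t : R) : fin_conf N xi -> 0 <= t -> 0 <= C ->
  bmeas setT f -> (forall eta, fin_conf N eta -> f eta <= C) ->
  Ex setT (law xi t) f <= C.
Proof.
move=> Nxi t0 C0 bf fC.
rewrite (Ex_restrict mFin (dual_law_fin hp hY hL Nxi t0) bf).
apply: Ex_le_cst => //; have [mf [M fM]] := bf; split; last by exists M => eta _; exact: fM.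
exact: measurable_funTS.
Qed.

(** The pairs meeting the support of [f] may involve infinitely many sites, so [G f] need not be
    local. A finite set of pairs restores locality up to a uniform error. *)
Lemma dual_op_test_approx f (e : R) : test_fun f -> 0 < e -> exists2 g,
  test_fun g & forall eta, `|G f eta - g eta| <= e.
Proof.
move=> tf e0; have [_ [A fA] [M fM]] := tf.
have M0 : 0 <= M by apply: le_trans (fM point).
have MM : 0 <= M + M by rewrite addr_ge0.
have [F FA HF] := pair_sum_approx hp A MM e0.
exists (fun eta => \sum_(k <- F) p k.1 k.2 * (dual_avg f eta k.1 k.2 + -1 * f eta) +
  lam * f eta).
  apply: test_fun_lin => //; apply: test_fun_sum => k.
  by apply: test_fun_lin => //; exact: test_fun_dual_avg.
move=> eta; rewrite /G /dual_op dual_genE opprD addrACA subrr addr0.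
have := HF _ _ (dual_incr_adapted_supported eta fA) => /(_ _)/wrap[].
  move=> i j ij; rewrite (le_trans (ler_normB _ _))// lerD//.
  exact: dual_avg_norm_le_all.
by under [X in _ - X]eq_bigr do rewrite -mulN1r.
Qed.

Lemma dual_flow_le_series (n : nat) f (B T t : R) xi : fin_conf N xi ->
  test_fun f -> (forall eta, fin_conf N eta -> `|f eta| <= B) ->
  0 <= t -> t <= T ->
  expR (lam * t) * Ex setT (law xi t) f <=
  psum (fun k => if (k < n)%N then iter k G f xi
                 else lam ^+ n * B * expR (lam * T)) n.+1 t.
Proof.
move=> Nxi; have lam0 : 0 <= lam by exact: rate_ge0.
elim: n f B t => [|n ih] f B t tf fB t0 tT;
    have B0 : 0 <= B by apply: le_trans (fB xi Nxi).
  have bf := test_fun_bmeas setT tf.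
  rewrite psumS psum0 add0r/= expr0 mul1r mulr1 divr1 mulrC.
  apply: (@le_trans _ _ (B * expR (lam * t))).
    rewrite ler_wpM2r ?expR_ge0//; apply: Ex_law_le_cst => // eta Neta.
    by rewrite (le_trans (ler_norm _))// fB.
  by rewrite ler_wpM2l// ler_expR ler_wpM2l.
pose c k := if (k < n.+1)%N then iter k G f xi
  else lam ^+ n.+1 * B * expR (lam * T).
rewrite [leRHS](_ : _ = psum c n.+2 t)//.
have bf : bounded_fin N f by exists B.
have bGf : bounded_fin N (G f).
  by exists (lam * B) => eta Neta; exact: (dual_op_norm_le hp).
apply: (@flow_comparison _ _ _ _ _ _ _ _ _ _ mT hY hL (giry_ret xi) f
  lam T (psum c n.+2) (psum (fun k => c k.+1) n.+1)) => //.
- by rewrite setCT measure0.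
- by move=> s; exact: is_derive_psum.
- move=> s s0 sT; apply/ler_addgt0Pr => e e0.
  (* [c3] bounds the effect on each coefficient of adding the constant 1 to [G f]; the iterates of
     [G] on 1 are at most lam ^+ k. *)
  pose c3 k := if (k < n)%N then lam ^+ k else lam ^+ n * expR (lam * T).
  have c30 k : 0 <= c3 k by rewrite /c3; case: ifP => _; rewrite ?mulr_ge0 ?exprn_ge0 ?expR_ge0.
  (* Replacing [G f] with the local [g] costs e / D in the expectation and again in every
     coefficient; [D] is the total weight, so the cost is e. *)
  pose D := expR (lam * s) + psum c3 n.+1 s.
  have D0 : 0 < D.
    rewrite ltr_pwDl ?expR_gt0// /psum sumr_ge0// => k _.
    by rewrite divr_ge0// mulr_ge0// exprn_ge0// ltW.
  have d0 : 0 < e / D by rewrite divr_gt0.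
  have [g tg Gg] := dual_op_test_approx tf d0.
  have d0' := ltW d0.
  have s0' := ltW s0.
  have gB eta : fin_conf N eta -> `|g eta| <= lam * B + e / D.
    move=> Neta; have := dual_op_norm_le hp Neta fB; rewrite -/lam -/G => h.
    have -> : g eta = G f eta - (G f eta - g eta) by rewrite opprB addrC subrK.
    by rewrite (le_trans (ler_normB _ _))// lerD.
  have IH := ih g _ s tg gB s0' (ltW sT).
  have bg := test_fun_bmeas setT tg.
  have bL : bmeas setT (fun x => dual_gen p f x + lam * f x).
    apply: bmeasD; first exact: (bmeas_generator mT hY hL tf).
    by apply: bmeasZ; exact: test_fun_bmeas.
  have step : Ex setT (law xi s) (fun x => dual_gen p f x + lam * f x) <=
      Ex setT (law xi s) g + e / D.
    have := Ex_close mT (law xi s) d0' bL bg (fun x _ => Gg x).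
    by rewrite ler_norml => /andP[]; lra.
  have iterle k : iter k G g xi <= iter k.+1 G f xi + (e / D) * lam ^+ k.
    have b1 : bounded_fin N (fun eta => G f eta + (e / D) * 1).
      by apply: bounded_fin_lin => //; exact: bounded_fin_cst.
    have := @iter_dual_op_le _ _ _ hp N k g (fun eta => G f eta + (e / D) * 1) _ b1 _ _ Nxi.
    rewrite iter_dual_op_lin//; last exact: bounded_fin_cst.
    rewrite -iterSr => /(_ _ _)/wrap[|eta Neta|].
    + by exists (lam * B + e / D).
    + by have := Gg eta; rewrite ler_norml mulr1 => /andP[]; lra.
    move=> /le_trans; apply; rewrite lerD2l ler_wpM2l//.
    have := iter_dual_op_norm_le hp k (f := fun=> 1) (C := 1) _ Nxi.
    move=> /(_ _)/wrap[eta _|]; first by rewrite normr1.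
    by rewrite mulr1 => /(le_trans (ler_norm _)).
  have IH2 : expR (lam * s) * Ex setT (law xi s) g <=
      psum (fun k => c k.+1 + (e / D) * c3 k) n.+1 s.
    apply: (le_trans IH); apply: psum_le => // k; rewrite ltnS => kn.
    rewrite /c /c3 ltnS; case: ifPn => [k1|k1]; first exact: iterle.
    rewrite le_eqVlt; apply/orP; left; apply/eqP; rewrite exprS; ring.
  rewrite psum_lin in IH2.
  apply: (@le_trans _ _ (expR (lam * s) * (Ex setT (law xi s) g + e / D))).
    by rewrite ler_wpM2l ?expR_ge0.
  rewrite mulrDr.
  have Ee : (e / D) * psum c3 n.+1 s + expR (lam * s) * (e / D) = e.
    by rewrite -[RHS](divfK (lt0r_neq0 D0)) /D; ring.
  lra.
- rewrite psum_at0 /c/= Ex_ret//; exact: test_fun_bmeas.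
Qed.

End dual_process_series.

Lemma cvg_sum_seq {R : realType} (I : eqType) (s : seq I) (F : I -> nat -> R)
    (l : I -> R) : (forall i, i \in s -> F i n @[n --> \oo] --> l i) ->
  \sum_(i <- s) F i n @[n --> \oo] --> \sum_(i <- s) l i.
Proof.
elim: s => [|i s ih] Fl.
  by rewrite big_nil; under eq_fun do rewrite big_nil; exact: cvg_cst.
rewrite big_cons; under eq_fun do rewrite big_cons; apply: cvgD.
  by apply: Fl; rewrite mem_head.
by apply: ih => j js; apply: Fl; rewrite in_cons js orbT.
Qed.

Section dominated_iterates.
Context {R : realType} {S : countType}.
Variable p : S -> S -> R.
Hypothesis hp : symmetric_irreducible p.
Variable N : nat.
Variables (g : nat -> config S nat -> R) (f : config S nat -> R) (B : R).
Let G := @dual_op R S p N.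

(** Under a common bound one finite set of pairs approximates all the [g0 j] and [f0], and on it
    pointwise convergence suffices. *)
Lemma dual_op_cvg (g0 : nat -> config S nat -> R) (f0 : config S nat -> R) C xi :
  (forall j eta, fin_conf N eta -> `|g0 j eta| <= C) ->
  (forall eta, fin_conf N eta -> `|f0 eta| <= C) ->
  (forall eta, fin_conf N eta -> g0 j eta @[j --> \oo] --> f0 eta) ->
  fin_conf N xi -> G (g0 j) xi @[j --> \oo] --> G f0 xi.
Proof.
move=> gC fC gf Nxi; apply/cvgrPdist_le => e e0.
have C0 : 0 <= C by apply: le_trans (fC xi Nxi).
have e30 : 0 < e / 3 by rewrite divr_gt0.
have [F Fne HF] := dual_op_approx hp Nxi C0 e30.
have cv : \sum_(k <- F) p k.1 k.2 * (dual_avg (g0 j) xi k.1 k.2 - g0 j xi) +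
    rate N * g0 j xi @[j --> \oo] -->
    \sum_(k <- F) p k.1 k.2 * (dual_avg f0 xi k.1 k.2 - f0 xi) + rate N * f0 xi.
  apply: cvgD; last by apply: cvgMr; exact: gf.
  apply: cvg_sum_seq => k kF; apply: cvgMr; apply: cvgB; last exact: gf.
  apply: cvg_sum_seq => K _; apply: cvg_sum_seq => M _; apply: cvgMr; apply: gf.
  by apply: fin_conf_exchange => //; [exact: Fne|rewrite -ltnS|rewrite -ltnS].
move/cvgrPdist_le : cv => /(_ _ e30) cv; near=> j.
have h1 : `|\sum_(k <- F) p k.1 k.2 * (dual_avg f0 xi k.1 k.2 - f0 xi) + rate N * f0 xi -
  (\sum_(k <- F) p k.1 k.2 * (dual_avg (g0 j) xi k.1 k.2 - g0 j xi) +
    rate N * g0 j xi)| <= e / 3 by near: j.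
have h2 := HF f0 fC; have h3 := HF (g0 j) (gC j).
move: h1 h2 h3; rewrite -/G !ler_norml.
set a := \sum_(k <- F) _; set b := \sum_(k <- F) _ => /andP[? ?] /andP[? ?] /andP[? ?].
by apply/andP; split; lra.
Unshelve. all: by end_near. Qed.

Lemma iter_dual_op_cvg k :
  (forall j eta, fin_conf N eta -> `|g j eta| <= B) ->
  (forall eta, fin_conf N eta -> `|f eta| <= B) ->
  (forall eta, fin_conf N eta -> g j eta @[j --> \oo] --> f eta) ->
  forall xi, fin_conf N xi -> iter k G (g j) xi @[j --> \oo] --> iter k G f xi.
Proof.
move=> gB fB gf; elim: k => [//|k ih] xi Nxi /=.
apply: (@dual_op_cvg (fun j => iter k G (g j)) (iter k G f) (rate N ^+ k * B)) => //.
- move=> j eta Neta; exact: (iter_dual_op_norm_le hp k (gB j) Neta).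
- move=> eta Neta; exact: (iter_dual_op_norm_le hp k fB Neta).
Qed.

End dominated_iterates.

Section truncated_dual_polynomials.
Context {R : realType} {S : countType} {dW : measure_display}
  {W : measurableType dW}.
Variables (p : S -> S -> R) (Q : config S nat -> probability W R)
  (Y : R -> W -> config S nat).
Hypothesis hp : symmetric_irreducible p.
Hypothesis hY : markov_process [set: config S nat] Q Y.
Hypothesis hL : has_generator [set: config S nat] Q Y (dual_gen p).
Variable N : nat.
Implicit Types (xi eta : config S nat) (A : {fset S}) (z : config S R).

Let mT : measurable [set: config S nat] := measurableT.
Let law xi t : giry (config S nat) R := flow mT hY (giry_ret xi) t.
Let Fin : set (config S nat) := [set xi | fin_conf N xi].
Let G := @dual_op R S p N.
Let lam : R := rate N.
Let mFin : measurable Fin := @measurable_fin_conf R S N.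

Definition prefix (j : nat) : {fset S} :=
  [fset k in pmap choice.unpickle (iota 0 j)]%fset.

Lemma mem_prefix j (k : S) : (choice.pickle k < j)%N -> k \in prefix j.
Proof.
move=> kj; rewrite !inE mem_pmap; apply/mapP; exists (choice.pickle k).
  by rewrite mem_iota.
by rewrite choice.pickleK.
Qed.

Lemma prefix_exhausts A : \forall j \near \oo, forall k : S, k \in A -> k \in prefix j.
Proof.
near=> j => k kA; apply: mem_prefix.
have kb : (choice.pickle k <= \max_(l <- A) choice.pickle l)%N.
  by rewrite (big_fsetD1 k)//= leq_maxl.
apply: leq_ltn_trans kb _; near: j; exact: nbhs_infty_gt.
Unshelve. all: by end_near. Qed.

Definition truncated_poly z (C : R) eta : R := Num.min (dual_poly eta z) C.

(** The polynomial depends on all sites of [eta], so it is no test function. Restricting the product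
    to [prefix j] makes it local, and on a finite configuration nothing changes once j is large. *)
Definition local_poly z (C : R) j eta : R :=
  Num.min (\prod_(k <- prefix j) dpol (eta k) (z k)) C.

Lemma test_fun_local_poly z C j : Omega R S z -> 0 <= C ->
  test_fun (local_poly z C j) /\ forall eta, `|local_poly z C j eta| <= C.
Proof.
move=> Oz C0.
have b eta : `|local_poly z C j eta| <= C.
  rewrite ger0_norm /local_poly; first by rewrite ge_min lexx orbT.
  by rewrite le_min C0 andbT prodr_ge0// => k _; exact: dpol_ge0.
split => //; apply: (test_fun_supported (A := prefix j) _ b) => x y xy.
rewrite /local_poly !big_seq; congr Num.min; apply: eq_bigr => k kj.
by rewrite xy.
Qed.

Lemma local_poly_cvg z C eta : fin_conf N eta ->
  local_poly z C j eta @[j --> \oo] --> truncated_poly z C eta.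
Proof.
move=> [A A0 _]; apply: cvg_near_cst; near=> j.
rewrite /local_poly /truncated_poly (@dual_polyE _ _ _ _ (prefix j))//.
have h : forall k : S, k \in A -> k \in prefix j by near: j; exact: prefix_exhausts.
by move=> k kj; apply: A0; apply: contraNN kj => /h.
Unshelve. all: by end_near. Qed.

Lemma truncated_poly_bounds z C eta : Omega R S z -> 0 <= C ->
  fin_conf N eta -> 0 <= truncated_poly z C eta <= C.
Proof.
move=> Oz C0 Neta; rewrite /truncated_poly le_min C0 ge_min lexx orbT !andbT.
exact: (dual_poly_ge0 Neta).
Qed.

Lemma bmeas_truncated_poly z C : Omega R S z -> 0 <= C ->
  bmeas Fin (truncated_poly z C).
Proof.
move=> Oz C0; split; last first.
  exists C => eta Neta; have /andP[h0 h1] := truncated_poly_bounds Oz C0 Neta.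
  by rewrite ger0_norm.
apply: (@measurable_fun_cvg _ _ _ _ (local_poly z C)).
  move=> j; have [[m _ _] _] := test_fun_local_poly j Oz C0.
  exact: measurable_funTS.
by move=> eta Neta; exact: local_poly_cvg.
Qed.

Lemma Ex_local_poly_cvg z C xi t : Omega R S z -> 0 <= C -> fin_conf N xi ->
  0 <= t -> Ex setT (law xi t) (local_poly z C j) @[j --> \oo] -->
  Ex Fin (law xi t) (truncated_poly z C).
Proof.
move=> Oz C0 Nxi t0.
have bj j : bmeas setT (local_poly z C j).
  by apply: test_fun_bmeas; have [] := test_fun_local_poly j Oz C0.
have bjF j : bmeas Fin (local_poly z C j).
  have [m _] := bj j; split; first exact: measurable_funTS.
  by exists C => eta _; have [_] := test_fun_local_poly j Oz C0; exact.
under eq_fun do rewrite (Ex_restrict mFin (dual_law_fin hp hY hL Nxi t0) (bj _)).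
have bt := bmeas_truncated_poly Oz C0.
apply: fine_cvg.
rewrite fineK; last by apply: integrable_fin_num => //; exact: bmeas_integrable.
apply: (@dominated_cvg _ _ _ _ _ mFin (fun j eta => (local_poly z C j eta)%:E)
  (fun eta => (truncated_poly z C eta)%:E) (fun=> C%:E)).
- by move=> j; apply/measurable_EFinP; exact: (bjF j).1.
- by move=> eta Neta; apply: cvg_EFin; [exact: nearW|exact: local_poly_cvg].
- by [].
- exact: (bmeas_integrable mFin _ (bmeas_cst Fin C)).
- by move=> j eta Neta; rewrite /= lee_fin; have [_] := test_fun_local_poly j Oz C0.
Qed.

Definition series_error (B : R) t n : R := B * expR (lam * t) * exp_coeff (lam * t) n.

Lemma series_errorE B t n :
  series_error B t n = lam ^+ n * B * expR (lam * t) * t ^+ n / (n`!)%:R.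
Proof. by rewrite /series_error /exp_coeff/= exprMn; ring. Qed.

Lemma series_error_cvg0 B t : series_error B t n @[n --> \oo] --> 0.
Proof.
rewrite -[X in _ --> X](mulr0 (B * expR (lam * t))).
by apply: cvgMr; exact: cvg_exp_coeff.
Qed.

(** The lower bound is the upper bound for the opposite function. *)
Lemma dual_flow_series n f (B t : R) xi : fin_conf N xi ->
  test_fun f -> (forall eta, fin_conf N eta -> `|f eta| <= B) -> 0 <= t ->
  `|expR (lam * t) * Ex setT (law xi t) f - psum (fun k => iter k G f xi) n t|
    <= series_error B t n.
Proof.
move=> Nxi tf fB t0; have bf : bounded_fin N f by exists B.
have b0 : @bounded_fin R S N (fun=> 0 : R) by exists 0 => ? _; rewrite normr0.
have bsf := test_fun_bmeas setT tf.
rewrite series_errorE ler_norml; apply/andP; split; last first.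
  have := dual_flow_le_series hp hY hL n Nxi tf fB t0 (lexx t).
  rewrite psumS ltnn (eq_psum (c' := fun k => iter k G f xi)) => [|k ->//].
  by rewrite -/lam; set x := psum _ _ _; lra.
pose h eta := 0 + -1 * f eta : R.
have th : test_fun h by apply: test_fun_lin => //; exact: test_fun_cst.
have hB eta : fin_conf N eta -> `|h eta| <= B.
  by move=> Neta; rewrite /h add0r mulN1r normrN fB.
have := dual_flow_le_series hp hY hL n Nxi th hB t0 (lexx t).
rewrite psumS ltnn (eq_psum (c' := fun k => 0 + -1 * iter k G f xi)); last first.
  by move=> k ->; rewrite /h iter_dual_op_lin// iter_dual_op0.
rewrite psum_lin ExD//; last 2 first.
- exact: bmeas_cst.
- exact: bmeasZ.
rewrite ExZ// (_ : Ex setT _ (fun=> 0) = 0); last by rewrite /Ex Rintegral_cst// mul0r.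
rewrite (_ : psum (fun=> 0) n t = 0); last by rewrite /psum big1// => k _; rewrite !mul0r.
rewrite -/lam !add0r !mulN1r mulrN; set x := psum _ _ _; lra.
Qed.

Lemma truncated_flow_series n z C t xi : Omega R S z -> 0 <= C ->
  fin_conf N xi -> 0 <= t ->
  `|expR (lam * t) * Ex Fin (law xi t) (truncated_poly z C)
    - psum (fun k => iter k G (truncated_poly z C) xi) n t| <= series_error C t n.
Proof.
move=> Oz C0 Nxi t0.
have H j := dual_flow_series n Nxi (test_fun_local_poly j Oz C0).1
  (fun eta _ => (test_fun_local_poly j Oz C0).2 eta) t0.
have cv : `|expR (lam * t) * Ex setT (law xi t) (local_poly z C j)
    - psum (fun k => iter k G (local_poly z C j) xi) n t| @[j --> \oo] -->
  `|expR (lam * t) * Ex Fin (law xi t) (truncated_poly z C)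
    - psum (fun k => iter k G (truncated_poly z C) xi) n t|.
  apply: cvg_norm; apply: cvgB.
    by apply: cvgMr; exact: Ex_local_poly_cvg.
  apply: cvg_sum_seq => k _; apply: cvgMl; apply: cvgMl.
  apply: (iter_dual_op_cvg hp (B := C)) => //.
  - by move=> j eta _; have [_] := test_fun_local_poly j Oz C0.
  - move=> eta Neta; have /andP[h0 h1] := truncated_poly_bounds Oz C0 Neta.
    by rewrite ger0_norm.
  - by move=> eta Neta; exact: local_poly_cvg.
by apply: (cvgr_to_le cv); exact: nearW.
Qed.

(** The terms are nonnegative, so a partial sum is below every later one, and the error of the later
    ones tends to 0. *)
Lemma truncated_series_le n z C t xi : Omega R S z -> 0 <= C ->
  fin_conf N xi -> 0 <= t ->
  psum (fun k => iter k G (truncated_poly z C) xi) n t <=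
  expR (lam * t) * Ex Fin (law xi t) (truncated_poly z C).
Proof.
move=> Oz C0 Nxi t0.
have bt : bounded_fin N (truncated_poly z C).
  exists C => eta Neta; have /andP[h0 h1] := truncated_poly_bounds Oz C0 Neta.
  by rewrite ger0_norm.
have b0 : @bounded_fin R S N (fun=> 0 : R) by exists 0 => ? _; rewrite normr0.
have it0 k : 0 <= iter k G (truncated_poly z C) xi.
  have := iter_dual_op_le hp k b0 bt _ Nxi.
  by rewrite iter_dual_op0//; apply=> eta Neta; have /andP[] := truncated_poly_bounds Oz C0 Neta.
have mono m : (n <= m)%N -> psum (fun k => iter k G (truncated_poly z C) xi) n t <=
    psum (fun k => iter k G (truncated_poly z C) xi) m t.
  elim: m => [|m ih]; first by rewrite leqn0 => /eqP ->.
  rewrite leq_eqVlt => /predU1P[->//|]; rewrite ltnS => /ih /le_trans; apply.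
  by rewrite psumS lerDl mulr_ge0 ?invr_ge0// mulr_ge0 ?exprn_ge0.
rewrite -subr_le0.
apply: (cvgr_to_ge (series_error_cvg0 C t)).
near=> m.
have nm : (n <= m)%N by near: m; exact: nbhs_infty_ge.
have := truncated_flow_series m Oz C0 Nxi t0; have := mono m nm.
by rewrite ler_norml => ? /andP[]; lra.
Unshelve. all: by end_near. Qed.

End truncated_dual_polynomials.

(** * Duality *)

Section measurable_duality_polynomial.
Context {R : realType} {S : countType}.

Lemma finite_config_fin_conf (xi : config S nat) : finite_config R xi ->
  exists N, fin_conf N xi.
Proof.
rewrite /finite_config => xifin.
have xi0 : (0 <= \esum_(i in [set: S]) ((xi i)%:R : R)%:E)%E by exact: esum_ge0.
move: xifin xi0; case E : (\esum_(i in [set: S]) _)%E => [r| |]// _.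
rewrite lee_fin => r0; exists (Num.bound r); apply/fin_confP => A.
rewrite -(ler_nat R); apply: le_trans (ltW (archi_boundP r0)).
rewrite -lee_fin -E; apply: esum_ge; exists [set` A]; first by split.
by rewrite -fsbig_seq ?fset_uniq// sumEFin natr_sum.
Qed.

Lemma dual_poly_ge0_all (xi : config S nat) (x : config S R) : Omega R S x ->
  0 <= dual_poly xi x.
Proof.
(* With infinitely many nontrivial factors the product is empty and equals 1. *)
move=> Ox; rewrite /dual_poly; case: finite_supportP => [_|X _ _ _].
  by rewrite big_nil.
by apply: prodr_ge0 => k _; exact: (dpol_ge0 _ (Ox k)).
Qed.

(* When infinitely many factors differ from 1 the product takes the junk value
   1, so that measurability has to be checked on all configurations. *)
Lemma measurable_dual_poly_conf (x : config S R) :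
  measurable_fun setT (fun eta : config S nat => dual_poly eta x).
Proof.
pose M (A : {fset S}) : set (config S nat) :=
  [set eta | forall k, k \notin A -> dpol (eta k) (x k) = 1].
pose D (A : {fset S}) (eta : config S nat) := \prod_(k <- A) dpol (eta k) (x k).
have mM A : measurable (M A).
  rewrite (_ : M A = \bigcap_k
      [set eta : config S nat | k \notin A -> dpol (eta k) (x k) = 1]).
    apply: countType_bigcap_measurable => k.
    rewrite -[X in measurable X]setTI.
    by apply: (@measurable_coordinate _ _ nat k _
      [set n | k \notin A -> dpol n (x k) = 1]).
  by apply/seteqP; split => [eta h k _|eta h k]; apply: h.
have DE A eta : M A eta -> dual_poly eta x = D A eta.
  move=> Me; rewrite /dual_poly /D [RHS]fsbig_seq ?fset_uniq//.
  rewrite -(fsbig_widen [set` A] setT)//= => k /= [_ /negP kA]; exact: Me.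
have D1 eta : ~ (\bigcup_A M A) eta -> dual_poly eta x = 1.
  move=> nM; rewrite /dual_poly fsbig_dflt// setTI => fin.
  apply: nM; exists (fset_set ((fun k => dpol (eta k) (x k)) @^-1` [set~ 1])) => // k.
  by rewrite in_fset_set// => /negP; rewrite inE /= => /contrapT.
have mD A : measurable_fun setT (D A).
  by apply: (measurable_supported (A := A)) => y z yz; rewrite /D !big_seq;
    apply: eq_bigr => k kA; rewrite yz.
move=> _ B mB; rewrite setTI.
rewrite (_ : _ @^-1` B = (\bigcup_A (M A `&` D A @^-1` B)) `|`
  (~` (\bigcup_A M A) `&` [set _ | B 1])).
  apply: measurableU; last first.
    apply: measurableI.
      by apply: measurableC; exact: countType_bigcup_measurable.
    have [B1|nB1] := pselect (B 1).
      by rewrite (_ : [set _ | _] = setT)//; apply/seteqP; split.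
    by rewrite (_ : [set _ | _] = set0)//; apply/seteqP; split.
  apply: countType_bigcup_measurable => A; apply: measurableI => //.
  by rewrite -[X in measurable X]setTI; exact: mD.
apply/seteqP; split => [eta /= Be|eta [[A _ [MA]]|[nM]] /=].
- have [[A _ MA]|nM] := pselect ((\bigcup_A M A) eta).
    by left; exists A => //; split => //=; rewrite -DE.
  by right; split => //=; rewrite -(D1 _ nM).
- by rewrite (DE A).
- by rewrite D1.
Qed.

End measurable_duality_polynomial.

Lemma integral_le_of_approx {d} {T : measurableType d} {R : realType}
    (m : {measure set T -> \bar R}) (D : set T) (h : T -> R)
    (h_ : nat -> T -> R) (a : \bar R) : measurable D ->
  (forall n, measurable_fun D (h_ n)) -> (forall n y, D y -> 0 <= h_ n y) ->
  (forall y n k, D y -> (n <= k)%N -> h_ n y <= h_ k y) ->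
  (forall y, D y -> h_ n y @[n --> \oo] --> h y) ->
  (forall n, \int[m]_(y in D) (h_ n y)%:E <= a)%E ->
  (\int[m]_(y in D) (h y)%:E <= a)%E.
Proof.
move=> mD mh h0 hle hcv ha.
have cv := @cvg_monotone_convergence _ _ _ m _ mD (fun n y => (h_ n y)%:E)
  (fun n => (@measurable_EFinP _ _ _ _ _).2 (mh n))
  (fun n y Dy => h0 n y Dy) (fun y Dy n k nk => hle y n k Dy nk).
rewrite (_ : (\int[m]_(y in D) (h y)%:E)%E =
    (\int[m]_(x in D) limn (fun n => (h_ n x)%:E))%E).
  by apply: (cvge_to_le cv); exact: nearW.
apply: eq_integral => y; rewrite inE => Dy; apply/esym.
by apply: cvg_lim => //; apply: cvg_EFin; [exact: nearW|exact: hcv].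
Qed.

Section expectation_as_integral.
Context {R : realType} {dT dW : measure_display}
  {T : measurableType dT} {W : measurableType dW}.
Variables (Om : set T) (Pr : T -> probability W R) (X : R -> W -> T).
Hypothesis mOm : measurable Om.
Hypothesis hX : markov_process Om Pr X.

Lemma expectation_flow (h : T -> R) x t : Om x -> 0 <= t ->
  measurable_fun setT h -> (forall y, Om y -> 0 <= h y) ->
  ('E_(Pr x)[fun w => h (X t w)] =
   \int[flow mOm hX (giry_ret x) t]_(y in Om) (h y)%:E)%E.
Proof.
move=> Ox t0 mh h0.
have mX := mp_measurable hX t0.
have XOm : X t @^-1` Om = setT.
  by rewrite -subTset => w _ /=; exact: (mp_state hX).
rewrite unlock -{1}XOm.
rewrite -[LHS](@ge0_integral_pushforward _ _ _ _ _ (X t) mX (Pr x) Om (EFin \o h))//.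
- apply: eq_measure_integral => A mA _.
  apply/esym; rewrite [LHS](flowE mOm hX (giry_ret x) t mA).
  rewrite -/(giry_int (giry_ret x) (fun y => transition hX t y A)).
  rewrite giry_int_ret ?transitionE ?ger0_norm//.
  exact: (measurableT_comp (measurable_giry_ev mA) (measurable_transition mOm hX t)).
- by apply/measurable_EFinP; exact: measurable_funTS.
- by move=> y; rewrite inE lee_fin; exact: h0.
Qed.
End expectation_as_integral.

Lemma Ex_EFin {d} {T : measurableType d} {R : realType} (D : set T)
    (mD : measurable D) (m : giry T R) f : bmeas D f ->
  (Ex D m f)%:E = (\int[m]_(x in D) (f x)%:E)%E.
Proof.
move=> bf; rewrite /Ex /Rintegral fineK//.
by apply: integrable_fin_num => //; exact: bmeas_integrable.
Qed.

Lemma ereal_le_of_fin {R : realType} (a : R) (v : \bar R) : (0 <= v)%E ->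
  (forall r : R, v = r%:E -> a <= r) -> (a%:E <= v)%E.
Proof.
case: v => [r _ h|_ _|//]; last by rewrite leey.
by rewrite lee_fin; exact: h.
Qed.

Section duality.
Context {R : realType} {S : countType} {dW dW' : measure_display}
  {W : measurableType dW} {W' : measurableType dW'}.
Variables (p : S -> S -> R) (P : config S R -> probability W R)
  (X : R -> W -> config S R) (Q : config S nat -> probability W' R)
  (Y : R -> W' -> config S nat).
Hypothesis hp : symmetric_irreducible p.
Hypothesis hX : markov_process (Omega R S) P X.
Hypothesis hL : has_generator (Omega R S) P X (exch_gen p).
Hypothesis hY : markov_process [set: config S nat] Q Y.
Hypothesis hL' : has_generator [set: config S nat] Q Y (dual_gen p).
Variables (N : nat) (xi : config S nat) (x : config S R) (t : R).
Hypotheses (Nxi : fin_conf N xi) (Ox : Omega R S x) (t0 : 0 <= t).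

Let Om := Omega R S.
Let mOm : measurable Om := measurable_Omega.
Let Fin : set (config S nat) := [set eta | fin_conf N eta].
Let mFin : measurable Fin := @measurable_fin_conf R S N.
Let lawX : giry (config S R) R := flow mOm hX (giry_ret x) t.
Let lawY : giry (config S nat) R := flow measurableT hY (giry_ret xi) t.
Let G := @dual_op R S p N.
Let lam : R := rate N.

Let u : \bar R := (\int[lawX]_(y in Om) (dual_poly xi y)%:E)%E.
Let v : \bar R := (\int[lawY]_(eta in Fin) (dual_poly eta x)%:E)%E.

Let Dge0 eta : 0 <= dual_poly eta x. Proof. exact: dual_poly_ge0_all. Qed.
Let v0 : (0 <= v)%E.
Proof. by apply: integral_ge0 => eta _; rewrite lee_fin. Qed.
Let u0 : (0 <= u)%E.
Proof. by apply: integral_ge0 => y Oy; rewrite lee_fin; exact: dual_poly_ge0_all. Qed.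

Let Omax y : Om y -> (fun k => Num.max (y k) 0) = y.
Proof. by move=> Oy; apply/funext => k; apply/max_idPl; exact: Oy. Qed.

Let truncX (C : R) y : R :=
  Num.min (dual_poly xi (fun k => Num.max (y k) 0)) C.

Let tf_truncX C : 0 <= C -> bmeas Om (truncX C).
Proof. by move=> C0; apply: test_fun_bmeas; exact: (test_fun_min Nxi). Qed.

Lemma duality_le_truncated (C : R) : 0 <= C -> ((Ex Om lawX (truncX C))%:E <= v)%E.
Proof.
move=> C0; apply: ereal_le_of_fin => // r vr.
pose kap : R := (N.+1 ^ 2)%:R.
have kap1 : 1 <= kap by rewrite ler1n expn_gt0.
(* The error coefficient contains the truncation level C kap^n; the power of kap joins lam and t in
   the general term of a convergent exponential series. *)
pose err n : R := C * exp_coeff (lam * kap * t) n.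
have err0 : err n @[n --> \oo] --> 0.
  by rewrite -[X in _ --> X](mulr0 C); apply: cvgMr; exact: cvg_exp_coeff.
have step n : Ex Om lawX (truncX C) <= r + err n.
  have Cn0 : 0 <= C * kap ^+ n by rewrite mulr_ge0// exprn_ge0// (le_trans _ kap1).
  have := min_moment_le_series hp hX hL n Nxi Ox C0 t0.
  rewrite -/lam -/G -/kap -/(truncX C) -/lawX psumS ltnn => h1.
  (* The level varies with k. Raising it everywhere to the last one leaves a single bounded
     function, as the dual series requires. *)
  have h2 : psum (fun k => if (k < n)%N then iter k G (fun eta =>
      Num.min (dual_poly eta (fun l => Num.max (x l) 0)) (C * kap ^+ k)) xi
      else lam ^+ n * (C * kap ^+ n) * expR (lam * t)) n t <=
      psum (fun k => iter k G (truncated_poly x (C * kap ^+ n)) xi) n t.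
    apply: psum_le => // k kn; rewrite kn.
    have Ck0 : 0 <= C * kap ^+ k by rewrite mulr_ge0// exprn_ge0// (le_trans _ kap1).
    rewrite (Omax Ox); apply: (iter_dual_op_le hp) => //.
    - exists (C * kap ^+ k) => eta Neta.
      by have /andP[? ?] := truncated_poly_bounds Ox Ck0 Neta; rewrite ger0_norm.
    - exists (C * kap ^+ n) => eta Neta.
      by have /andP[? ?] := truncated_poly_bounds Ox Cn0 Neta; rewrite ger0_norm.
    - move=> eta Neta; rewrite /truncated_poly le_min ge_min lexx/= ge_min.
      apply/orP; right; apply: ler_wpM2l => //; apply: ler_weXn2l => //; exact: ltnW.
  have h3 := truncated_series_le hp hY hL' n Ox Cn0 Nxi t0.
  have h4 : Ex Fin lawY (truncated_poly x (C * kap ^+ n)) <= r.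
    rewrite -lee_fin -vr Ex_EFin//; last exact: (bmeas_truncated_poly N Ox Cn0).
    apply: ge0_le_integral => //.
    - by move=> eta Neta; rewrite lee_fin; have /andP[] := truncated_poly_bounds Ox Cn0 Neta.
    - by apply/measurable_EFinP; have [] := bmeas_truncated_poly N Ox Cn0.
    - by apply/measurable_EFinP; apply: measurable_funTS; exact: measurable_dual_poly_conf.
    - by move=> eta _; rewrite lee_fin /truncated_poly ge_min lexx.
  have e0 : 0 < expR (lam * t) := expR_gt0 _.
  rewrite -(ler_pM2l e0); apply: le_trans h1 _.
  rewrite mulrDr; apply: lerD.
    apply: le_trans h2 _; apply: le_trans h3 _; rewrite ler_pM2l//.
  rewrite /err /exp_coeff/= !exprMn; rewrite le_eqVlt; apply/orP; left; apply/eqP; ring.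
rewrite -[r]addr0; apply: (cvgr_to_ge (cvgD (cvg_cst r) err0)); exact: nearW.
Qed.

Lemma duality_le : (u <= v)%E.
Proof.
apply: (integral_le_of_approx (h := dual_poly xi) (h_ := fun n => truncX n%:R) mOm).
- by move=> n; have [] := @tf_truncX n%:R (ler0n _ _).
- move=> n y Oy; rewrite /truncX le_min ler0n andbT; apply: dual_poly_ge0_all => k.
  by rewrite le_max lexx orbT.
- move=> y n k _ nk; rewrite /truncX le_min ge_min lexx/= ge_min ler_nat nk.
  by rewrite orbT.
- move=> y Oy; apply: cvg_near_cst; near=> n; rewrite /truncX (Omax Oy).
  apply/min_idPl; apply: le_trans (ltW (archi_boundP (dual_poly_ge0_all xi Oy))) _.
  by rewrite ler_nat; near: n; exact: nbhs_infty_ge.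
- move=> n; rewrite -Ex_EFin//; last exact: tf_truncX.
  exact: duality_le_truncated.
Unshelve. all: by end_near. Qed.

Lemma cap_le_of (m : R) y k : Om y -> 0 <= m -> cap m y k <= y k.
Proof.
by move=> Oy m0; rewrite /cap ge_max Oy andbT ge_min lexx.
Qed.

Lemma cap_mono (m m' : R) (y : config S R) (k : S) : m <= m' -> cap m y k <= cap m' y k.
Proof.
move=> mm; rewrite /cap ge_max !le_max lexx orbT andbT; apply/orP; left.
by rewrite le_min !ge_min lexx mm orbT.
Qed.

Lemma duality_ge_capped (m : R) : 0 <= m ->
  ((Ex Fin lawY (fun eta => dual_poly eta (cap m x)))%:E <= u)%E.
Proof.
move=> m0; apply: ereal_le_of_fin => // r ur.
(* At this level the truncation is inactive on capped configurations, so the results on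
   [truncated_poly] apply to the polynomial itself. *)
pose C := (1 + m) ^+ N; have C0 : 0 <= C by rewrite exprn_ge0// addr_ge0.
have Oc := cap_ge0 m x.
have trE eta : fin_conf N eta -> truncated_poly (cap m x) C eta = dual_poly eta (cap m x).
  by move=> Neta; apply/min_idPl; exact: dual_poly_cap_le.
(* One error comes from the dual series and an equal one from the moment series, hence the factor
   2. *)
have step n : Ex Fin lawY (fun eta => dual_poly eta (cap m x)) <=
    r + 2 * (C * exp_coeff (lam * t) n).
  have e0 : 0 < expR (lam * t) := expR_gt0 _.
  have := truncated_flow_series hp hY hL' n Oc C0 Nxi t0.
  rewrite -/lam -/G -/lawY (@eq_Ex _ _ _ _ _ (truncated_poly (cap m x) C)
    (fun eta => dual_poly eta (cap m x)))//.
  rewrite ler_norml => /andP[_]; rewrite lerBlDl => h1.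
  (* Chosen so that after n halvings the cap is still m: the error coefficient then does not grow
     with n beyond lam ^+ n. *)
  pose M := m * 2 ^+ n; have M0 : 0 <= M by rewrite mulr_ge0 ?exprn_ge0.
  have := cap_moment_ge_series hp hX hL n Nxi Ox M0 t0.
  rewrite -/lam -/G -/lawX psumS ltnn => h2.
  have MnE : M / 2 ^+ n = m by rewrite /M mulfK// expf_neq0.
  have h3 : psum (fun k => iter k G (truncated_poly (cap m x) C) xi) n t <=
      psum (fun k => if (k < n)%N then
      iter k G (fun eta => dual_poly eta (cap (M / 2 ^+ k) x)) xi
      else - (lam ^+ n * (1 + M / 2 ^+ n) ^+ N * expR (lam * t))) n t.
    apply: psum_le => // k kn; rewrite kn.
    have Mk0 : 0 <= M / 2 ^+ k by rewrite divr_ge0 ?exprn_ge0.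
    apply: (iter_dual_op_le hp) => //.
    - exists C => eta Neta.
      by have /andP[? ?] := truncated_poly_bounds Oc C0 Neta; rewrite ger0_norm.
    - exists ((1 + M / 2 ^+ k) ^+ N) => eta Neta; rewrite ger0_norm.
        exact: dual_poly_cap_le.
      by apply: dual_poly_ge0_all; exact: cap_ge0.
    - move=> eta Neta; rewrite trE//; apply: (dual_poly_le Neta) => // l.
      apply: cap_mono; rewrite /M ler_pdivlMr ?exprn_gt0// ler_wpM2l// ler_weXn2l ?ler1n//.
      exact: ltnW.
  have h4 : Ex Om lawX (fun y => dual_poly xi (cap M y)) <= r.
    have tc := test_fun_cap Nxi M0.
    rewrite -lee_fin -ur Ex_EFin//; last exact: test_fun_bmeas.
    apply: ge0_le_integral => //.
    - by move=> y _; rewrite lee_fin; apply: dual_poly_ge0_all; exact: cap_ge0.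
    - by apply/measurable_EFinP; apply: measurable_funTS; have [] := tc.
    - by apply/measurable_EFinP; apply: measurable_funTS; exact: (measurable_dual_poly Nxi).
    - move=> y Oy; rewrite lee_fin; apply: (dual_poly_le Nxi); first exact: cap_ge0.
      by move=> k; exact: cap_le_of.
  rewrite -(ler_pM2l e0); apply: le_trans h1 _.
  have h5 : lam ^+ n * (1 + M / 2 ^+ n) ^+ N * expR (lam * t) * t ^+ n / n`!%:R =
      series_error N C t n.
    by rewrite MnE series_errorE -/lam.
  have h6 : expR (lam * t) * (r + 2 * (C * exp_coeff (lam * t) n)) =
     expR (lam * t) * r + 2 * series_error N C t n.
    by rewrite /series_error -/lam; ring.
  rewrite h6; move: h2; rewrite !mulNr h5.
  have : expR (lam * t) * Ex Om lawX (fun y => dual_poly xi (cap M y)) <= expR (lam * t) * r.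
    by rewrite ler_pM2l.
  by move: h3; lra.
have err0 : 2 * (C * exp_coeff (lam * t) n) @[n --> \oo] --> 0.
  rewrite -[X in _ --> X](mulr0 2); apply: cvgMr.
  by rewrite -[X in _ --> X](mulr0 C); apply: cvgMr; exact: cvg_exp_coeff.
rewrite -[r]addr0; apply: (cvgr_to_ge (cvgD (cvg_cst r) err0)); exact: nearW.
Qed.

Lemma duality_ge : (v <= u)%E.
Proof.
apply: (integral_le_of_approx (h := fun eta => dual_poly eta x)
  (h_ := fun n eta => dual_poly eta (cap n%:R x)) mFin).
- by move=> n; apply: measurable_funTS; exact: measurable_dual_poly_conf.
- by move=> n eta _; apply: dual_poly_ge0_all; exact: cap_ge0.
- move=> eta n k Neta nk; apply: (dual_poly_le Neta); first exact: cap_ge0.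
  by move=> l; apply: cap_mono; rewrite ler_nat.
- move=> eta [A A0 _]; rewrite !(dual_polyE _ A0); under eq_fun do rewrite (dual_polyE _ A0).
  apply: cvg_near_cst; near=> n; rewrite big_seq [RHS]big_seq; apply: eq_bigr => k kA.
  congr dpol; suff xn : x k <= n%:R by rewrite /cap (min_idPl xn) (max_idPl (Ox k)).
  have h : x k <= \sum_(l <- A) x l.
    by rewrite (big_fsetD1 k)//= lerDl sumr_ge0// => l _; exact: Ox.
  apply: le_trans h _; apply: le_trans (ltW (archi_boundP _)) _.
    by apply: sumr_ge0 => l _; exact: Ox.
  by rewrite ler_nat; near: n; exact: nbhs_infty_ge.
- move=> n; rewrite -Ex_EFin//; first exact: duality_ge_capped.
  split; first by apply: measurable_funTS; exact: measurable_dual_poly_conf.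
  exists ((1 + n%:R) ^+ N) => eta Neta; rewrite ger0_norm.
    exact: dual_poly_cap_le.
  by apply: dual_poly_ge0_all; exact: cap_ge0.
Unshelve. all: by end_near. Qed.

Lemma expectation_dual_poly :
  ('E_(P x)[fun w => dual_poly xi (X t w)] =
   'E_(Q xi)[fun w => dual_poly (Y t w) x])%E.
Proof.
rewrite (expectation_flow mOm hX Ox t0 (measurable_dual_poly Nxi)); last first.
  by move=> y; exact: dual_poly_ge0_all.
rewrite (expectation_flow measurableT hY I t0 (measurable_dual_poly_conf x)); last first.
  by move=> y _; exact: Dge0.
transitivity v; first by apply/eqP; rewrite eq_le duality_le duality_ge.
rewrite /v -giry_int_supp//.
- exact: (dual_law_fin hp hY hL' Nxi t0).
- by apply/measurable_EFinP; exact: measurable_dual_poly_conf.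
Qed.

End duality.

(** * Exchanges preserve the product of Gamma measures *)

Section image_measure.
Context {R : realType} {d d' : measure_display} {T : measurableType d}
  {U : measurableType d'}.
Variables (m : {measure set T -> \bar R}) (phi : T -> U).
Hypothesis mphi : measurable_fun setT phi.

Definition image_measure : {measure set U -> \bar R} :=
  @measure_function_pushforward__canonical__measure_function_Measure
    _ _ _ _ _ m _ mphi.

Lemma image_measureE B : image_measure B = m (phi @^-1` B).
Proof. by []. Qed.

Lemma ge0_integral_image (f : U -> \bar R) : measurable_fun setT f ->
  (forall y, 0 <= f y)%E -> (\int[image_measure]_y f y = \int[m]_x f (phi x))%E.
Proof. by move=> mf f0; rewrite /image_measure ge0_integral_pushforward. Qed.

End image_measure.

Section lebesgue_integrals.
Context {R : realType}.
Local Notation leb := (@lebesgue_measure R).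

(** The rescaled image of Lebesgue measure gives half-open intervals their length, and uniqueness
    concludes. *)
Lemma lebesgue_measure_affine (a b : R) (A : set (measurableTypeR R)) : 0 < a ->
  measurable A ->
  leb A = (a%:E * leb ((fun x : R => a * x + b)%R @^-1` A))%E.
Proof.
move=> a0 mA; pose phi (x : measurableTypeR R) : measurableTypeR R := a * x + b.
have mphi : measurable_fun setT phi by apply: measurable_funD => //; exact: measurable_funM.
pose m := mscale (NngNum (ltW a0)) (image_measure leb mphi).
transitivity (m A); last by [].
apply: lebesgue_measure_unique => // _ [[c d] /= _ <-].
rewrite /m /mscale/= (image_measureE leb mphi).
rewrite (_ : phi @^-1` _ = `](c - b) / a, (d - b) / a]%classic); last first.
  apply/seteqP; split => x; rewrite /phi /= !in_itv/= ltr_pdivrMr// ler_pdivlMr//;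
   by rewrite ltrBlDr lerBrDr (mulrC x).
rewrite lebesgue_measure_itv [X in (_ = _ * X)%E]lebesgue_measure_itv/=.
rewrite !lte_fin ltr_pM2r ?invr_gt0// ltrD2r.
case: ifPn => _; last by rewrite mule0.
by rewrite -!EFinB -EFinM; congr _%:E; field; rewrite gt_eqF.
Qed.

Lemma ge0_integral_affine (a b : R) (f : R -> \bar R) : 0 < a ->
  measurable_fun setT f -> (forall x, 0 <= f x)%E ->
  (\int[leb]_x f x = a%:E * \int[leb]_x f (a * x + b)%R)%E.
Proof.
move=> a0 mf f0; pose phi (x : measurableTypeR R) : measurableTypeR R := a * x + b.
have mphi : measurable_fun setT phi by apply: measurable_funD => //; exact: measurable_funM.
rewrite (_ : (\int[leb]_x f (a * x + b)%R)%E =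
   (\int[image_measure leb mphi]_x f x)%E); last first.
  by rewrite ge0_integral_image.
rewrite -(ge0_integral_mscale _ measurableT (NngNum (ltW a0)))//.
by apply: eq_measure_integral => A mA _; exact: lebesgue_measure_affine.
Qed.

Import HBNNSimple.

Lemma ge0_integral_density {d} {T : measurableType d} (m l : {measure set T -> \bar R})
    (k : T -> R) (f : T -> \bar R) : measurable_fun setT k -> (forall x, 0 <= k x) ->
  (forall B, measurable B -> m B = \int[l]_(x in B) (k x)%:E)%E ->
  measurable_fun setT f -> (forall x, 0 <= f x)%E ->
  (\int[m]_x f x = \int[l]_x ((k x)%:E * f x))%E.
Proof.
move=> mk k0 mE mf f0.
have mkE : measurable_fun setT (EFin \o k) by apply/measurable_EFinP.
have ind B : measurable B ->
    (\int[m]_x (\1_B x)%:E = \int[l]_x ((k x)%:E * (\1_B x)%:E))%E.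
  move=> mB; rewrite integral_indic// setIT mE// integral_mkcond.
  apply: eq_integral => x _; rewrite patchE indicE; case: ifP; by rewrite ?mule1 ?mule0.
pose g := nnsfun_approx measurableT mf.
have sf n : (\int[m]_x (g n x)%:E = \int[l]_x ((k x)%:E * (g n x)%:E))%E.
  under eq_integral do rewrite fimfunE -fsumEFin//.
  rewrite ge0_integral_fsum//; last 2 first.
  - by move=> r; exact/measurable_EFinP/measurableT_comp.
  - by move=> r x _; rewrite EFinM nnfun_muleindic_ge0.
  under [RHS]eq_integral.
    move=> x _; rewrite fimfunE -fsumEFin// ge0_mule_fsumr; last first.
      by move=> r; rewrite EFinM nnfun_muleindic_ge0.
    over.
  rewrite ge0_integral_fsum//; last 2 first.
  - move=> r; apply: emeasurable_funM => //; exact/measurable_EFinP/measurableT_comp.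
  - move=> r x _; apply: mule_ge0; first by rewrite lee_fin.
    by rewrite EFinM nnfun_muleindic_ge0.
  apply: eq_fsbigr => r _.
  (* Negative values are not attained, so their level sets are empty; the others can be taken out of
     a nonnegative integral. *)
  have [r0|r0] := ltP r 0.
    have E0 : g n @^-1` [set r] = set0.
      by rewrite -subset0 => x /= xr; move: r0; rewrite -xr ltNge fun_ge0.
    rewrite E0; rewrite !integral0_eq// => x _; by rewrite indicE in_set0 mulr0 ?mule0.
  under eq_integral do rewrite EFinM.
  under [RHS]eq_integral do rewrite EFinM muleCA.
  rewrite !ge0_integralZl//.
  - by rewrite ind.
  - by apply: emeasurable_funM => //; exact/measurable_EFinP.
  - by move=> x _; rewrite mule_ge0// lee_fin.
  - exact/measurable_EFinP.
have cv x : (g n x)%:E @[n --> \oo] --> f x by exact: cvg_nnsfun_approx.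
transitivity (limn (fun n => \int[m]_x (g n x)%:E)%E).
  rewrite -monotone_convergence//=.
  - by apply: eq_integral => x _; apply/esym/cvg_lim.
  - by move=> n; exact/measurable_EFinP/measurable_funTS.
  - by move=> n x _; rewrite lee_fin.
  - by move=> x _ ? ? mn; rewrite lee_fin; exact/lefP/nd_nnsfun_approx.
under eq_fun do rewrite sf.
rewrite -monotone_convergence//=.
- apply: eq_integral => x _; apply/cvg_lim => //.
  by apply: cvgeZl => //; exact: cv.
- by move=> n; apply: emeasurable_funM => //; exact/measurable_EFinP/measurable_funTS.
- by move=> n x _; rewrite mule_ge0// lee_fin.
- move=> x _ ? ? mn; apply: lee_wpmul2l; rewrite lee_fin//.
  exact/lefP/nd_nnsfun_approx.
Qed.

End lebesgue_integrals.

Section gamma_as_sum_of_exponentials.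
Context {R : realType}.
Local Notation leb := (@lebesgue_measure R).
Variable theta : R.
Hypothesis theta0 : 0 < theta.

Definition gamma_pdf (a : R) : R :=
  if 0 <= a then theta ^- 2 * a * expR (- a / theta) else 0.

Definition expo_pdf (y : R) : R :=
  if 0 <= y then theta^-1 * expR (- y / theta) else 0.

Let joint (z : R * R) : R :=
  if (0 <= z.2) && (z.2 <= z.1) then theta ^- 2 * expR (- z.1 / theta) else 0.

Lemma gamma_pdf_ge0 a : 0 <= gamma_pdf a.
Proof.
rewrite /gamma_pdf; case: ifP => // a0; rewrite mulr_ge0 ?expR_ge0// mulr_ge0//.
by rewrite invr_ge0 exprn_ge0// ltW.
Qed.

Lemma expo_pdf_ge0 y : 0 <= expo_pdf y.
Proof.
by rewrite /expo_pdf; case: ifP => // y0; rewrite mulr_ge0 ?expR_ge0// invr_ge0 ltW.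
Qed.

Let joint_ge0 z : 0 <= joint z.
Proof.
by rewrite /joint; case: ifP => // _; rewrite mulr_ge0 ?expR_ge0// invr_ge0 exprn_ge0// ltW.
Qed.

Lemma measurable_gamma_pdf : measurable_fun setT gamma_pdf.
Proof.
apply: measurable_fun_ifT => //; first exact: measurable_fun_ler.
apply: measurable_funM; first exact: measurable_funM.
by apply: measurableT_comp => //; apply: measurable_funM.
Qed.

Lemma measurable_expo_pdf : measurable_fun setT expo_pdf.
Proof.
apply: measurable_fun_ifT => //; first exact: measurable_fun_ler.
apply: measurable_funM => //.
by apply: measurableT_comp => //; apply: measurable_funM.
Qed.

Let measurable_joint : measurable_fun setT joint.
Proof.
apply: measurable_fun_ifT => //.
  by apply: measurable_and; exact: measurable_fun_ler.
apply: measurable_funM => //.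
by apply: measurableT_comp => //; apply: measurable_funM => //; exact: measurableT_comp.
Qed.

(* With a = y + w and w = a u, the density of (y, w) becomes
   theta^-2 exp(- a / theta) on 0 <= w <= a. *)
Lemma integral_gamma_split (h : R -> R -> \bar R) :
  measurable_fun setT (fun z : R * R => h z.1 z.2) -> (forall y w, 0 <= h y w)%E ->
  (\int[leb]_a ((gamma_pdf a)%:E * \int[leb]_(u in unit_itv) h (a * (1 - u))%R (a * u)%R) =
   \int[leb]_w ((expo_pdf w)%:E * \int[leb]_y ((expo_pdf y)%:E * h y w)))%E.
Proof.
move=> mh h0.
pose F (z : R * R) := ((joint z)%:E * h (z.1 - z.2)%R z.2)%E.
have mF : measurable_fun setT F.
  apply: emeasurable_funM; first exact/measurable_EFinP.
  apply: (measurableT_comp mh (g := fun z : R * R => (z.1 - z.2, z.2))).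
  by apply: measurable_fun_pair => //; apply: measurable_funB.
have F0 z : (0 <= F z)%E by rewrite /F mule_ge0// lee_fin.
have mhr (w : R) : measurable_fun setT (fun y => h y w).
  exact: (measurableT_comp mh (g := fun y => (y, w))).
transitivity (\int[leb]_a \int[leb]_w F (a, w))%E.
  apply: eq_integral => a _; rewrite /F /=.
  have [a0|a0] := ltP 0 a; last first.
    have -> : gamma_pdf a = 0.
      rewrite /gamma_pdf; case: ifP => // a00.
      by rewrite (_ : a = 0) ?mulr0 ?mul0r//; apply/eqP; rewrite eq_le a0.
    rewrite mul0e; apply/esym.
    (* For a at most 0 the constraint 0 <= w <= a leaves at most the null set where w = 0. *)
    transitivity (\int[leb]_(w in [set 0%R]) ((joint (a, w))%:E * h (a - w)%R w))%E.
      rewrite [RHS]integral_mkcond; apply: eq_integral => w _; rewrite patchE.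
      case: ifPn => //; rewrite notin_setE /= => w0; rewrite /joint /=.
      case: ifP => [/andP[? wa]|_]; last by rewrite mul0e.
      exfalso; apply: w0; apply/eqP; rewrite eq_le; apply/andP; split => //.
      exact: le_trans wa a0.
    by rewrite integral_set1.
  pose G w := ((\1_(`[0, a]%classic) w)%:E * h (a - w)%R w)%E.
  have mG : measurable_fun setT G.
    apply: emeasurable_funM; first exact/measurable_EFinP.
    apply: (measurableT_comp mh (g := fun w : R => (a - w, w))).
    by apply: measurable_fun_pair => //; apply: measurable_funB.
  have G0 w : (0 <= G w)%E by rewrite /G mule_ge0// lee_fin.
  transitivity ((theta ^- 2 * expR (- a / theta))%:E * \int[leb]_w G w)%E; last first.
    rewrite -ge0_integralZl//; last first.
      by rewrite lee_fin mulr_ge0 ?expR_ge0// invr_ge0 exprn_ge0// ltW.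
    apply: eq_integral => w _; rewrite /G /joint muleA -EFinM indicE /=.
    by rewrite mem_setE in_itv/=; case: ifP; rewrite ?mulr1 ?mulr0.
  (* The substitution w = a u contributes the Jacobian a, the linear factor of the Gamma density. *)
  rewrite (ge0_integral_affine 0 a0 mG G0) muleA -EFinM.
  congr (_%:E * _)%E; first by rewrite /gamma_pdf (ltW a0) mulrAC.
  rewrite integral_mkcond; apply: eq_integral => u _; rewrite patchE /G addr0 indicE.
  rewrite !mem_setE /unit_itv !in_itv/= pmulr_rge0// ger_pMr//.
  by case: ifP => _; rewrite ?mul1e ?mul0e// mulrBr mulr1.
rewrite (@fubini_tonelli _ _ _ _ R leb leb F mF F0).
apply: eq_integral => w _; rewrite /F /=.
have mFw : measurable_fun setT (fun a => F (a, w)).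
  exact: (measurableT_comp mF (g := fun a => (a, w))).
(* For fixed w, the translation a = y + w separates the two exponential densities. *)
rewrite (ge0_integral_affine w (@ltr01 R) mFw (fun a => F0 (a, w))) mul1e.
rewrite -ge0_integralZl//; last 3 first.
- apply: emeasurable_funM; last exact: mhr.
  by apply/measurable_EFinP; exact: measurable_expo_pdf.
- by move=> y _; rewrite mule_ge0// lee_fin expo_pdf_ge0.
- by rewrite lee_fin expo_pdf_ge0.
apply: eq_integral => y _; rewrite /F /= mul1r addrK muleA -EFinM; congr (_%:E * _)%E.
rewrite /joint /expo_pdf /= lerDr.
case: (0 <= w); case: (0 <= y); rewrite /= ?mulr0 ?mul0r//.
rewrite mulrACA -expRD -invfM -expr2; congr (_ * expR _).
by rewrite -mulrDl opprD addrC.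
Qed.

End gamma_as_sum_of_exponentials.

Section two_site_invariance.
Context {R : realType}.
Local Notation leb := (@lebesgue_measure R).
Variable theta : R.
Hypothesis theta0 : 0 < theta.

Definition uniform01 : probability (measurableTypeR R) R := uniform_prob (@ltr01 R).

Lemma integral_uniform01 (f : R -> \bar R) : measurable_fun setT f ->
  (forall u, 0 <= f u)%E -> (\int[uniform01]_u f u = \int[leb]_(u in unit_itv) f u)%E.
Proof.
move=> mf f0; rewrite /uniform01 integral_uniform//.
by rewrite subr0 invr1 mul1e.
Qed.

Local Notation gpdf := (gamma_pdf theta).
Local Notation epdf := (expo_pdf theta).
Let chi (B : set R) (x : R) : \bar R := (\1_B x)%:E.
(** Probability that c plus an exponential variable lies in [B]. *)
Let phi B (c : R) : \bar R := (\int[leb]_y ((epdf y)%:E * chi B (y + c)%R))%E.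

Let chi0 B x : (0 <= chi B x)%E. Proof. by rewrite lee_fin. Qed.
Let mchi B : measurable B -> measurable_fun setT (chi B).
Proof. by move=> mB; exact/measurable_EFinP. Qed.
Let e0 y : (0 <= (epdf y)%:E)%E. Proof. by rewrite lee_fin expo_pdf_ge0. Qed.
Let g0 y : (0 <= (gpdf y)%:E)%E. Proof. by rewrite lee_fin gamma_pdf_ge0. Qed.
Let me : measurable_fun setT (fun y => (epdf y)%:E).
Proof. by apply/measurable_EFinP; exact: measurable_expo_pdf. Qed.
Let mg : measurable_fun setT (fun y => (gpdf y)%:E).
Proof. by apply/measurable_EFinP; exact: measurable_gamma_pdf. Qed.

Let phi0 B c : (0 <= phi B c)%E.
Proof. by apply: integral_ge0 => y _; rewrite mule_ge0. Qed.

Let mphi B : measurable B -> measurable_fun setT (phi B).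
Proof.
move=> mB.
apply: (@measurable_fun_fubini_tonelli_F _ _ _ _ R leb
  (fun z : R * R => (epdf z.2)%:E * chi B (z.2 + z.1)%R)%E).
  apply: emeasurable_funM.
    exact: (measurableT_comp me measurable_snd).
  apply: (measurableT_comp (mchi mB) (g := fun z : R * R => z.2 + z.1)).
  exact: measurable_funD.
by move=> z; rewrite mule_ge0.
Qed.

Let split_uniform (h : R -> R -> \bar R) :
  measurable_fun setT (fun z : R * R => h z.1 z.2) -> (forall y w, 0 <= h y w)%E ->
  (\int[leb]_a ((gpdf a)%:E * \int[uniform01]_u h (a * (1 - u))%R (a * u)%R) =
   \int[leb]_w ((epdf w)%:E * \int[leb]_y ((epdf y)%:E * h y w)))%E.
Proof.
move=> mh h0; rewrite -integral_gamma_split//; apply: eq_integral => a _.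
congr (_ * _)%E; rewrite integral_uniform01//.
apply: (measurableT_comp mh (g := fun u : R => (a * (1 - u), a * u))).
apply: measurable_fun_pair => //; apply: measurable_funM => //.
exact: measurable_funB.
Qed.

(** Independence of the two parts into which a uniform variable splits a Gamma variable. *)
Let split_product (h1 h2 : R -> \bar R) :
  measurable_fun setT h1 -> measurable_fun setT h2 ->
  (forall y, 0 <= h1 y)%E -> (forall w, 0 <= h2 w)%E ->
  (\int[leb]_a ((gpdf a)%:E *
     \int[uniform01]_u (h1 (a * (1 - u))%R * h2 (a * u)%R)) =
   (\int[leb]_y ((epdf y)%:E * h1 y)) * (\int[leb]_w ((epdf w)%:E * h2 w)))%E.
Proof.
move=> m1 m2 h10 h20.
rewrite (@split_uniform (fun y w => h1 y * h2 w)%E); last 2 first.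
- by apply: emeasurable_funM; exact: measurableT_comp.
- by move=> y w; rewrite mule_ge0.
set I1 := (X in (X * _)%E).
have I10 : (0 <= I1)%E by apply: integral_ge0 => y _; rewrite mule_ge0.
rewrite -ge0_integralZl//.
- apply: eq_integral => w _; rewrite [RHS]muleCA; congr (_ * _)%E.
  under eq_integral do rewrite muleA.
  rewrite ge0_integralZr//; first exact: emeasurable_funM.
  by move=> y _; rewrite mule_ge0.
- exact: emeasurable_funM.
- by move=> w _; rewrite mule_ge0.
Qed.

(** A function of the sum of the two parts does not see the uniform variable, so the splitting
    identity reads as a convolution. *)
Lemma gamma_convolution B : measurable B ->
  (\int[leb]_a ((gpdf a)%:E * chi B a) = \int[leb]_y ((epdf y)%:E * phi B y))%E.
Proof.
move=> mB; rewrite -(@split_uniform (fun y w => chi B (y + w)%R))//.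
- apply: eq_integral => a _; congr (_ * _)%E.
  rewrite (eq_integral (fun=> chi B a)).
    by rewrite integral_cst// [X in (_ * X)%E]probability_setT mule1.
  by move=> u _; congr chi; ring.
- apply: (measurableT_comp (mchi mB) (g := fun z : R * R => z.1 + z.2)).
  exact: measurable_funD.
Qed.

(* Each of the two Gamma variables a and b is split by its own uniform variable
   into two independent exponentials, which are then recombined crosswise. *)
Lemma exchange_gamma_pair B1 B2 : measurable B1 -> measurable B2 ->
  (\int[leb]_a ((gpdf a)%:E * \int[leb]_b ((gpdf b)%:E *
     \int[uniform01]_u \int[uniform01]_v
       (chi B1 (a * (1 - u) + b * v)%R * chi B2 (b * (1 - v) + a * u)%R))) =
   (\int[leb]_a ((gpdf a)%:E * chi B1 a)) * (\int[leb]_a ((gpdf a)%:E * chi B2 a)))%E.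
Proof.
move=> mB1 mB2; rewrite !gamma_convolution//.
rewrite -(split_product (mphi mB1) (mphi mB2) (phi0 B1) (phi0 B2)).
apply: eq_integral => a _; congr (_ * _)%E.
pose K (b u v : R) := (chi B1 (a * (1 - u) + b * v)%R * chi B2 (b * (1 - v) + a * u)%R)%E.
have mK : measurable_fun setT (fun z : (R * R) * R => K z.1.1 z.1.2 z.2).
  apply: emeasurable_funM.
    apply: (measurableT_comp (mchi mB1)
      (g := fun z : (R * R) * R => a * (1 - z.1.2) + z.1.1 * z.2)).
    have m11 : measurable_fun setT (fun z : (R * R) * R => z.1.1) by exact: measurableT_comp.
    have m12 : measurable_fun setT (fun z : (R * R) * R => z.1.2) by exact: measurableT_comp.
    apply: measurable_funD; last exact: measurable_funM.
    by apply: measurable_funM => //; exact: measurable_funB.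
  apply: (measurableT_comp (mchi mB2)
    (g := fun z : (R * R) * R => z.1.1 * (1 - z.2) + a * z.1.2)).
  have m11 : measurable_fun setT (fun z : (R * R) * R => z.1.1) by exact: measurableT_comp.
  have m12 : measurable_fun setT (fun z : (R * R) * R => z.1.2) by exact: measurableT_comp.
  apply: measurable_funD; last exact: measurable_funM.
  by apply: measurable_funM => //; exact: measurable_funB.
have K0 b u v : (0 <= K b u v)%E by rewrite mule_ge0.
pose J (z : R * R) := (\int[uniform01]_v K z.1 z.2 v)%E.
have J0 z : (0 <= J z)%E by exact: integral_ge0.
have mJ : measurable_fun setT J.
  exact: (@measurable_fun_fubini_tonelli_F _ _ _ _ R uniform01
    (fun z : (R * R) * R => K z.1.1 z.1.2 z.2) mK).
transitivity (\int[leb]_b \int[uniform01]_u ((gpdf b)%:E * J (b, u)))%E.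
  apply: eq_integral => b _; rewrite ge0_integralZl//.
  apply: (measurableT_comp mJ (g := fun u : R => (b, u))); exact: measurable_fun_pair.
(* With u outside, b is split by v while the two parts of a stay fixed. *)
rewrite (@fubini_tonelli _ _ _ _ R leb uniform01 (fun z : R * R => (gpdf z.1)%:E * J z)%E).
- apply: eq_integral => u _ /=.
  have mc (B : set R) (c : R) : measurable B ->
      measurable_fun setT (fun y : R => chi B (y + c)%R).
    move=> mB; apply: (measurableT_comp (mchi mB) (g := fun y : R => y + c)).
    exact: measurable_funD.
  rewrite muleC -(split_product (mc B2 (a * u) mB2) (mc B1 (a * (1 - u)) mB1))//.
  apply: eq_integral => b _; congr (_ * _)%E; apply: eq_integral => v _.
  by rewrite /K muleC [(a * (1 - u) + _)%R]addrC.
- apply: emeasurable_funM => //.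
  exact: (measurableT_comp mg measurable_fst).
- by move=> z; rewrite mule_ge0.
Qed.

End two_site_invariance.

Section boxes.
Context {S : countType} {d : measure_display} {E : measurableType d}.

(** A generating class stable under intersection, on which [is_product_measure] prescribes the
    values and whose indicators are test functions. *)
Definition boxes : set (set (config S E)) :=
  [set C | exists (A : {fset S}) (B : S -> set E),
    [/\ forall k, measurable (B k), forall k, k \notin A -> B k = setT
      & C = [set x | forall k, B k (x k)]]].

Lemma boxE (A : {fset S}) (B : S -> set E) : (forall k, k \notin A -> B k = setT) ->
  [set x : config S E | forall k, B k (x k)] =
  [set x : config S E | forall k, k \in A -> B k (x k)].
Proof.
move=> B1; apply/seteqP; split => x /= h k; first by move=> _; exact: h.
by have [/h//|/B1->] := boolP (k \in A).
Qed.

Lemma measurable_box (B : S -> set E) : (forall k, measurable (B k)) ->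
  measurable [set x : config S E | forall k, B k (x k)].
Proof.
move=> mB; rewrite (_ : [set x | _] = \bigcap_k ((fun x : config S E => x k) @^-1` B k)).
  apply: countType_bigcap_measurable => k; rewrite -[X in measurable X]setTI.
  exact: measurable_coordinate.
by apply/seteqP; split => x h k; [move=> _|]; exact: h.
Qed.

Lemma measurable_boxes : @measurable _ (config S E) = <<s boxes >>.
Proof.
apply/seteqP; split; last first.
  apply: smallest_sub; first exact: sigma_algebra_measurable.
  by move=> _ [A [B [mB _ ->]]]; exact: measurable_box.
apply: smallest_sub; first exact: smallest_sigma_algebra.
move=> _ [i [B [mB ->]]]; apply: sub_gen_smallest.
exists [fset i]%fset, (fun k => if k == i then B else setT); split.
- by move=> k; case: ifP.
- by move=> k; rewrite inE => /negbTE ->.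
- apply/seteqP; split => x /= h; last by have := h i; rewrite eqxx.
  by move=> k; case: ifP => // /eqP ->.
Qed.

Lemma setI_closed_boxes : setI_closed boxes.
Proof.
move=> _ _ [A [B [mB B1 ->]]] [A' [B' [mB' B'1 ->]]].
exists (A `|` A')%fset, (fun k => B k `&` B' k); split.
- by move=> k; exact: measurableI.
- by move=> k; rewrite inE negb_or => /andP[/B1-> /B'1->]; rewrite setTI.
- by apply/seteqP; split => x /=; [move=> [h h'] k; split|move=> h; split => k; have [] := h k].
Qed.

Lemma boxes_setT : boxes setT.
Proof. by exists fset0, (fun=> setT); split => //; apply/seteqP; split. Qed.

Lemma eq_measure_boxes {R : realType} (m1 m2 : {measure set (config S E) -> \bar R}) :
  (m1 setT < +oo)%E -> (forall C, boxes C -> m1 C = m2 C) ->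
  forall C, measurable C -> m1 C = m2 C.
Proof.
move=> m1oo m12 C mC.
apply: (measure_unique boxes (fun=> setT) measurable_boxes setI_closed_boxes) => //.
- by move=> _; exact: boxes_setT.
- by apply/seteqP; split => // x _; exists 0%N.
Qed.

End boxes.

Section product_gamma.
Context {R : realType} {S : countType}.
Local Notation leb := (@lebesgue_measure R).
Variables (theta : R) (mu : probability (config S R) R).
Hypothesis theta0 : 0 < theta.
Hypothesis hmu : is_product_measure (gamma2 theta) mu.
Local Notation gpdf := (gamma_pdf theta).

Lemma gamma2E (B : set R) : gamma2 theta B = (\int[leb]_(a in B) (gpdf a)%:E)%E.
Proof.
rewrite /gamma2 integral_mkcondr; apply: eq_integral => a _.
by rewrite patchE mem_setE in_itv/= andbT /gamma_pdf; case: ifP.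
Qed.

Lemma gamma2_indic (B : set R) :
  gamma2 theta B = (\int[leb]_a ((gpdf a)%:E * (\1_B a)%:E))%E.
Proof.
rewrite gamma2E integral_mkcond; apply: eq_integral => a _.
by rewrite patchE indicE; case: ifP => _; rewrite ?mule1 ?mule0.
Qed.

Definition marginal (i : S) : giry (measurableTypeR R) R :=
  @giry_map _ _ (config S R) (measurableTypeR R) R (fun x => x i)
    (measurable_coordinate i) (mu : subprobability (config S R) R).

Lemma marginalE i B : measurable B ->
  marginal i B = (\int[leb]_(a in B) (gpdf a)%:E)%E.
Proof.
move=> mB; rewrite -gamma2E.
have := hmu [fset i]%fset (fun=> mB); rewrite big_seq_fset1 => <-.
rewrite /marginal /=; congr (mu _); apply/seteqP; split => x /=.
  by move=> h k; rewrite inE => /eqP ->.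
by apply; rewrite inE.
Qed.

Lemma product_Omega_null : mu (~` Omega R S) = 0%E.
Proof.
rewrite (_ : ~` _ = \bigcup_i [set x : config S R | x i < 0]); last first.
  apply/seteqP; split => x /=; first by move=> /existsNP[i /negP]; rewrite -ltNge; exists i.
  by move=> [i _ /= xi] /(_ i); rewrite leNgt xi.
have itvE i : [set x : config S R | x i < 0] =
    [set x : config S R | forall k, k \in [fset i]%fset -> `]-oo, (0 : R)[%classic (x k)].
  apply/seteqP; split => x /=; first by move=> h k; rewrite inE in_itv/= => /eqP ->.
  by move=> /(_ i); rewrite inE in_itv/= => /(_ (eqxx _)).
apply: countType_bigcup_null => i.
  rewrite (_ : [set _ | _] = setT `&` (fun x : config S R => x i) @^-1` `]-oo, 0[%classic).
    exact: measurable_coordinate.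
  by rewrite setTI; apply/seteqP; split => x /=; rewrite in_itv.
rewrite itvE; have := hmu [fset i]%fset (fun=> measurable_itv `]-oo, (0 : R)[%R).
move=> /= ->; rewrite big_seq_fset1 gamma2E.
apply: integral0_eq => a /=; rewrite in_itv/= => a0.
by rewrite /gamma_pdf leNgt a0.
Qed.

Section pair_law.
Variables (i j : S) (E : set (config S R)).
Hypothesis mE : measurable E.
Hypothesis indepE : forall B1 B2, measurable B1 -> measurable B2 ->
  mu ([set x | B1 (x i) /\ B2 (x j)] `&` E) =
  (mu E * (gamma2 theta B1 * gamma2 theta B2))%E.

(** Conditionally on [E], the pair (x i, x j) has the product law of its marginals, and Tonelli's
    theorem applies. *)
Lemma pair_integral (H : R * R -> \bar R) : measurable_fun setT H ->
  (forall z, 0 <= H z)%E ->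
  (\int[mu]_x ((\1_E x)%:E * H (x i, x j)) =
   mu E * \int[leb]_a ((gpdf a)%:E * \int[leb]_b ((gpdf b)%:E * H (a, b))))%E.
Proof.
move=> mH' H0.
have mH : @measurable_fun _ _ (measurableTypeR R * measurableTypeR R)%type _ setT H
  by exact: mH'.
have mpair : @measurable_fun _ _ (config S R)
    (measurableTypeR R * measurableTypeR R)%type setT (fun x => (x i, x j)).
  by apply: measurable_fun_pair; exact: measurable_coordinate.
have mHp : measurable_fun setT (fun x : config S R => H (x i, x j)).
  exact: (measurableT_comp mH mpair).
(* Conditioning divides by [mu E], so a null [E] is treated apart; both sides then vanish. *)
have [E0|En0] := eqVneq (mu E) 0%E.
  rewrite E0 mul0e (eq_integral (fun x => ((fun x => H (x i, x j)) \_ E) x)).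
    rewrite -integral_mkcond; apply: null_set_integral => //.
    exact: measurable_funTS.
  by move=> x _; rewrite patchE indicE; case: ifP => _; rewrite ?mul1e ?mul0e.
have cfin : mu E \is a fin_num by exact: fin_num_measure.
pose c := fine (mu E); have cE : c%:E = mu E by rewrite fineK.
have c0 : 0 < c by rewrite -lte_fin cE lt0e En0 measure_ge0.
have ci0 : 0 <= c^-1 by rewrite invr_ge0 ltW.
pose m' := mscale (NngNum ci0) (image_measure (mrestr mu mE) mpair).
have m'E A B : measurable A -> measurable B ->
    m' (A `*` B) = (marginal i A * marginal j B)%E.
  move=> mA mB; rewrite !marginalE// -!gamma2E /m' /mscale/= /image_measure/=.
  rewrite /pushforward /mrestr.
  rewrite (_ : _ @^-1` _ = [set x : config S R | A (x i) /\ B (x j)])//.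
  by rewrite indepE// -cE muleA -EFinM mulVf ?mul1e// gt_eqF.
have HE : (\int[m']_z H z = c^-1%:E * \int[mu]_x ((\1_E x)%:E * H (x i, x j)))%E.
  rewrite /m' (ge0_integral_mscale _ measurableT (NngNum ci0) mH)//; congr (_ * _)%E.
  rewrite (ge0_integral_image _ mpair)//.
  rewrite (@ge0_integral_density _ _ _ (mrestr mu mE) mu (\1_E))//.
  move=> B mB; rewrite integral_indic//.
  by rewrite setIC.
have -> : (\int[mu]_x ((\1_E x)%:E * H (x i, x j)) = c%:E * \int[m']_z H z)%E.
  by rewrite HE muleA -EFinM mulfV ?mul1e// gt_eqF.
rewrite -cE; congr (_ * _)%E.
rewrite (eq_measure_integral (marginal i \x marginal j)%E); last first.
  by move=> A mA _; apply/esym; exact: product_measure_unique.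
rewrite fubini_tonelli1//.
have g0 a : 0 <= gpdf a by exact: gamma_pdf_ge0.
rewrite (@ge0_integral_density R _ _ (marginal i) leb _ _
  (measurable_gamma_pdf theta) g0 (marginalE i)); last 2 first.
- exact: measurable_fun_fubini_tonelli_F.
- by move=> a; exact: integral_ge0.
apply: eq_integral => a _; congr (_ * _)%E; rewrite /fubini_F.
rewrite (@ge0_integral_density R _ _ (marginal j) leb _ _
  (measurable_gamma_pdf theta) g0 (marginalE j))//.
by apply: (measurableT_comp mH (g := fun b : R => (a, b))); exact: measurable_fun_pair.
Qed.

End pair_law.

End product_gamma.

Section exchange_invariance.
Context {R : realType} {S : countType}.
Local Notation leb := (@lebesgue_measure R).
Variables (theta : R) (mu : probability (config S R) R).
Hypothesis theta0 : 0 < theta.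
Hypothesis hmu : is_product_measure (gamma2 theta) mu.
Variables (i j : S).
Hypothesis ij : i != j.
Local Notation U := (@uniform01 R).
Local Notation RR := (measurableTypeR R).

Lemma measurable_exchange_pair : @measurable_fun _ _
  (config S R * (RR * RR))%type (config S R) setT
  (fun z => exchange z.1 i j z.2.1 z.2.2).
Proof.
have m1 : @measurable_fun _ _ (config S R * (RR * RR))%type
    ((config S R * R) * R)%type setT (fun z => ((z.1, z.2.1), z.2.2)).
  apply: measurable_fun_pair; last exact: (measurableT_comp measurable_snd measurable_snd).
  apply: measurable_fun_pair; first exact: measurable_fst.
  exact: (measurableT_comp measurable_fst measurable_snd).
exact: (measurableT_comp (measurable_exchange i j) m1).
Qed.

Let UU : subprobability (RR * RR)%type R :=
  product_subprobability ((U : subprobability RR R), (U : subprobability RR R)).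

(** Law of the configuration after one exchange, with two independent uniform variables. *)
Let nu := image_measure (mu \x UU)%E measurable_exchange_pair.

Lemma integral_exchanged (h : config S R -> \bar R) : measurable_fun setT h ->
  (forall x, 0 <= h x)%E ->
  (\int[nu]_x h x =
   \int[mu]_x \int[U]_u \int[U]_v h (exchange x i j u v))%E.
Proof.
move=> mh h0; rewrite ge0_integral_image//.
have mhe := measurableT_comp mh measurable_exchange_pair.
rewrite fubini_tonelli1//.
apply: eq_integral => x _; rewrite /fubini_F.
rewrite /UU (@fubini_tonelli1 _ _ RR RR R U U (fun y => h (exchange x i j y.1 y.2)))//.
apply: (measurableT_comp mhe (g := fun y : RR * RR => (x, y))).
exact: measurable_fun_pair.
Qed.

Let split_prod (A : {fset S}) (F : S -> \bar R) : i \in A -> j \in A ->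
  (\prod_(k <- A) F k = F i * (F j * \prod_(k <- (A `\ i `\ j)%fset) F k))%E.
Proof.
move=> iA jA; rewrite (big_fsetD1 i)//= (big_fsetD1 j)// !inE jA andbT.
by rewrite eq_sym ij.
Qed.

(** Sites other than i and j are untouched and enter only through the event [E]; given [E], the
    claim is the invariance of two independent Gamma variables. *)
Lemma exchanged_box C : boxes C -> nu C = mu C.
Proof.
move=> [A0 [B [mB B1 ->]]]; pose A := (i |` (j |` A0))%fset.
have iA : i \in A by rewrite !inE eqxx.
have jA : j \in A by rewrite !inE eqxx orbT.
have BA k : k \notin A -> B k = setT.
  by rewrite !inE !negb_or => /and3P[_ _]; exact: B1.
pose A' := (A `\ i `\ j)%fset.
pose E : set (config S R) := [set x | forall k, k \in A' -> B k (x k)].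
have mE : measurable E.
  rewrite (_ : E = [set x | forall k, (if k \in A' then B k else setT) (x k)]).
    by apply: (measurable_box (B := fun k => if k \in A' then B k else setT)) => k; case: ifP.
  apply/seteqP; split => x /= h k; first by case: ifP => //; exact: h.
  by move=> kA; have := h k; rewrite kA.
pose c (D : set R) (z : R) : \bar R := (\1_D z)%:E.
have mc D : measurable D -> measurable_fun setT (c D).
  by move=> mD; exact/measurable_EFinP.
have split x : (forall k, B k (x k)) <-> [/\ B i (x i), B j (x j) & E x].
  split=> [h|[Bi Bj Ex] k]; first by split; [exact: h|exact: h|move=> k _; exact: h].
  have [->//|ki] := eqVneq k i; have [->//|kj] := eqVneq k j.
  have [kA|/BA ->//] := boolP (k \in A).
  by apply: Ex; rewrite !in_fsetD1 ki kj.
have muE : mu E = (\prod_(k <- A') gamma2 theta (B k))%E := hmu A' mB.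
have indepE B1' B2 : measurable B1' -> measurable B2 ->
    mu ([set x | B1' (x i) /\ B2 (x j)] `&` E) =
    (mu E * (gamma2 theta B1' * gamma2 theta B2))%E.
  move=> mB1 mB2.
  pose B' k := if k == i then B1' else if k == j then B2 else B k.
  have mB' k : measurable (B' k) by rewrite /B'; case: ifP => // _; case: ifP.
  have B'i : B' i = B1' by rewrite /B' eqxx.
  have B'j : B' j = B2 by rewrite /B' eq_sym (negbTE ij) eqxx.
  have B'k k : k \in A' -> B' k = B k.
    by rewrite !inE /B' => /and3P[/negbTE -> /negbTE ->].
  have := hmu A mB'; rewrite split_prod// B'i B'j.
  rewrite (eq_big_seq (fun k => gamma2 theta (B k))); last by move=> k /B'k ->.
  rewrite -muE muleA muleC => <-; congr (mu _).
  apply/seteqP; split => x /=.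
    move=> [[x1 x2] Ex] k kA; rewrite /B'; case: eqVneq => [->//|ki].
    by case: eqVneq => [->//|kj]; apply: Ex; rewrite !in_fsetD1 ki kj.
  move=> h; split; first by have := h i iA; have := h j jA; rewrite B'i B'j.
  by move=> k kA; rewrite -B'k//; apply: h; move: kA; rewrite !inE => /and3P[_ _].
have mC : measurable [set x : config S R | forall k, B k (x k)] by exact: measurable_box.
pose Bx : set (config S R) := [set x | forall k, B k (x k)].
transitivity (\int[nu]_x (\1_Bx x)%:E)%E.
  by apply/esym; rewrite (integral_indic nu measurableT mC) setIT.
rewrite (@integral_exchanged (fun x => (\1_Bx x)%:E)); last 2 first.
- by apply/measurable_EFinP; exact: measurable_indic.
- by move=> x; rewrite lee_fin.
pose K (z : ((RR * RR) * RR) * RR) : \bar R :=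
  (c (B i) (z.1.1.1 * (1 - z.1.2) + z.1.1.2 * z.2)%R *
   c (B j) (z.1.1.2 * (1 - z.2) + z.1.1.1 * z.1.2)%R)%E.
have K0 z : (0 <= K z)%E by rewrite mule_ge0// lee_fin.
have mK : @measurable_fun _ _ (((RR * RR) * RR) * RR)%type _ setT K.
  have q2 : @measurable_fun _ _ (((RR * RR) * RR) * RR)%type R setT (fun z => z.2).
    exact: measurable_snd.
  have q12 : @measurable_fun _ _ (((RR * RR) * RR) * RR)%type R setT (fun z => z.1.2).
    exact: (measurableT_comp measurable_snd measurable_fst).
  have q11 : @measurable_fun _ _ (((RR * RR) * RR) * RR)%type (RR * RR)%type setT (fun z => z.1.1).
    exact: (measurableT_comp measurable_fst measurable_fst).
  have q112 : @measurable_fun _ _ (((RR * RR) * RR) * RR)%type R setT (fun z => z.1.1.2).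
    exact: (measurableT_comp measurable_snd q11).
  have q111 : @measurable_fun _ _ (((RR * RR) * RR) * RR)%type R setT (fun z => z.1.1.1).
    exact: (measurableT_comp measurable_fst q11).
  apply: emeasurable_funM.
    apply: (measurableT_comp (mc (B i) (mB i))).
    apply: measurable_funD; apply: measurable_funM => //; exact: measurable_funB.
  apply: (measurableT_comp (mc (B j) (mB j))).
  apply: measurable_funD; apply: measurable_funM => //; exact: measurable_funB.
pose H (z : RR * RR) := (\int[U]_u \int[U]_v K ((z, u), v))%E.
have H0 z : (0 <= H z)%E by apply: integral_ge0 => u _; exact: integral_ge0.
have mH : @measurable_fun _ _ (RR * RR)%type _ setT H.
  apply: (@measurable_fun_fubini_tonelli_F _ _ _ _ R U
    (fun y : (RR * RR) * RR => \int[U]_v K (y, v)))%E.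
    exact: (@measurable_fun_fubini_tonelli_F _ _ _ _ R U K mK K0).
  by move=> y; exact: integral_ge0.
transitivity (\int[mu]_x ((\1_E x)%:E * H (x i, x j)))%E.
  apply: eq_integral => x _; rewrite /H -ge0_integralZl//; first last.
  - by move=> u _; exact: integral_ge0.
  - apply: (measurableT_comp (@measurable_fun_fubini_tonelli_F _ _ _ _ R U K mK K0)
      (g := fun u : RR => ((x i, x j), u))).
    exact: measurable_fun_pair.
  apply: eq_integral => u _; rewrite -ge0_integralZl//; first last.
  - apply: (measurableT_comp mK (g := fun v : RR => (((x i, x j), u), v))).
    exact: measurable_fun_pair.
  apply: eq_integral => v _; rewrite /K /c /= -!EFinM; congr _%:E.
  rewrite !indicE -!natrM !mulnb; congr _%:R; congr nat_of_bool.
  apply/idP/idP.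
    rewrite inE /= => /split[]; rewrite /exchange eqxx eq_sym (negbTE ij) eqxx => Bi Bj Ee.
    rewrite !mem_set// => k kA; move: (Ee k kA) (kA).
    by rewrite !inE => + /and3P[/negbTE kj /negbTE ki _]; rewrite ki kj.
  move=> /and3P[]; rewrite !inE /= => Ee Bi Bj; apply/split.
  rewrite /exchange eqxx eq_sym (negbTE ij) eqxx; split => // k kA; move: (Ee k kA) (kA).
  by rewrite !inE => + /and3P[/negbTE kj /negbTE ki _]; rewrite ki kj.
rewrite (pair_integral theta0 hmu mE indepE mH H0).
rewrite /H /K /c /= exchange_gamma_pair// -!gamma2_indic -indepE//.
by congr (mu _); apply/seteqP; split => x /=; rewrite split; [move=> [[]]|move=> []].
Qed.

Lemma exchanged_law C : measurable C -> nu C = mu C.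
Proof.
apply: eq_measure_boxes; last exact: exchanged_box.
by rewrite exchanged_box ?probability_setT ?ltry//; exact: boxes_setT.
Qed.

Lemma int01E (g : R -> R) : bmeas unit_itv g ->
  (int01 g)%:E = (\int[leb]_(v in unit_itv) (g v)%:E)%E.
Proof.
move=> bg; rewrite /int01 /Rintegral fineK//.
by apply: integrable_fin_num => //; [exact: measurable_unit_itv|exact: int01_integrable].
Qed.

Lemma Ex_exch_avg_ge0 (f : config S R -> R) : test_fun f -> (forall x, 0 <= f x) ->
  Ex setT (mu : subprobability (config S R) R) (exch_avg f i j) =
  Ex setT (mu : subprobability (config S R) R) f.
Proof.
move=> tf f0; rewrite /Ex /Rintegral; congr fine.
have [mf _ _] := tf; have mfE : measurable_fun setT (EFin \o f) by exact/measurable_EFinP.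
have nmu : (\int[nu]_x (f x)%:E = \int[mu]_x (f x)%:E)%E.
  by apply: eq_measure_integral => C mC _; exact: exchanged_law.
rewrite -[RHS]nmu integral_exchanged//.
have m3 : @measurable_fun _ _ ((config S R * RR) * RR)%type _ setT
    (fun z => (f (exchange z.1.1 i j z.1.2 z.2))%:E).
  exact: (measurableT_comp mfE (measurable_exchange i j)).
have m2 : @measurable_fun _ _ (config S R * RR)%type _ setT
    (fun z => \int[U]_v (f (exchange z.1 i j z.2 v))%:E)%E.
  by apply: (@measurable_fun_fubini_tonelli_F _ _ _ _ R U _ m3) => z; rewrite lee_fin.
apply: eq_integral => x _; rewrite /exch_avg int01E; last exact: bmeas_exch_outer.
rewrite integral_uniform01; first last.
- by move=> u; apply: integral_ge0 => v _; rewrite lee_fin.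
- apply: (measurableT_comp m2 (g := fun u : RR => (x, u))); exact: measurable_fun_pair.
apply: eq_integral => u; rewrite inE => Iu.
rewrite int01E; last exact: bmeas_exch_inner.
rewrite integral_uniform01//.
- apply: (measurableT_comp m3 (g := fun v : RR => ((x, u), v))); exact: measurable_fun_pair.
- by move=> v; rewrite lee_fin.
Qed.

Lemma Ex_exch_avg (f : config S R -> R) : test_fun f ->
  Ex setT (mu : subprobability (config S R) R) (exch_avg f i j) =
  Ex setT (mu : subprobability (config S R) R) f.
Proof.
move=> tf; have [mf [A fA] [M fM]] := tf.
pose g x := f x + M * 1.
have tg : test_fun g by apply: test_fun_lin => //; exact: test_fun_cst.
have g0 x : 0 <= g x by rewrite /g mulr1 -lerBlDr sub0r; have := fM x; rewrite ler_norml => /andP[].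
have := Ex_exch_avg_ge0 tg g0.
have bs (h : config S R -> R) : test_fun h -> bmeas setT h by exact: test_fun_bmeas.
have bc : bmeas [set: config S R] (fun=> M * 1) by exact: bmeas_cst.
have -> : exch_avg g i j = fun x => exch_avg f i j x + M * 1.
  apply/funext => x; rewrite /exch_avg.
  rewrite -[X in _ + X]int01_cst -int01D; last 2 first.
  - exact: bmeas_exch_outer.
  - exact: bmeas_cst.
  apply: eq_int01 => u Iu; rewrite -[X in _ + X]int01_cst -int01D//.
  - exact: bmeas_exch_inner.
  - exact: bmeas_cst.
rewrite !ExD//; try exact: bs; last by apply: bs; exact: test_fun_exch_avg.
by move/addIr.
Qed.

End exchange_invariance.

(** * From single exchanges to the process *)

Section invariance.
Context {R : realType} {S : countType} {dW : measure_display}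
  {W : measurableType dW}.
Variables (p : S -> S -> R) (P : config S R -> probability W R)
  (X : R -> W -> config S R).
Hypothesis hp : symmetric_irreducible p.
Hypothesis hX : markov_process (Omega R S) P X.
Hypothesis hL : has_generator (Omega R S) P X (exch_gen p).
Variables (theta : R) (mu : probability (config S R) R).
Hypothesis theta0 : 0 < theta.
Hypothesis hmu : is_product_measure (gamma2 theta) mu.

Let Om := Omega R S.
Let mOm : measurable Om := measurable_Omega.
Let m : giry (config S R) R := (mu : subprobability (config S R) R).
Let m0 : m (~` Om) = 0%E := product_Omega_null hmu.
Let law t : giry (config S R) R := flow mOm hX m t.

(** Every term of the finite approximating sum integrates to 0, since one exchange preserves [mu],
    and the approximation is uniform on [Om]. *)
Lemma Ex_exch_gen f : test_fun f -> Ex Om m (exch_gen p f) = 0.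
Proof.
move=> tf; have [_ [A fA] [M fM]] := tf.
have M0 : 0 <= M by apply: le_trans (fM point).
have bf := test_fun_bmeas Om tf.
have bL : bmeas Om (exch_gen p f) by exact: (bmeas_generator mOm hX hL).
have bavg k : bmeas Om (exch_avg f k.1 k.2).
  by apply: test_fun_bmeas; exact: test_fun_exch_avg.
apply/eqP; rewrite -normr_le0; apply/ler_addgt0Pr => e e0; rewrite add0r.
have [F FA HF] := pair_sum_approx hp A (addr_ge0 M0 M0) e0.
pose g x := \sum_(k <- F) p k.1 k.2 * (exch_avg f k.1 k.2 x - f x).
have bg : bmeas Om g by apply: bmeas_sum => k _; apply: bmeasZ; exact: bmeasB.
have g0 : Ex Om m g = 0.
  rewrite /g Ex_sum//; last by move=> k _; apply: bmeasZ; exact: bmeasB.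
  rewrite big1_seq// => k /= /FA.
  rewrite /touches => /andP[kk _]; rewrite ExZ//; last exact: bmeasB.
  rewrite ExB// -!(Ex_restrict mOm m0); last 2 first.
  - by apply: test_fun_bmeas.
  - by apply: test_fun_bmeas; exact: test_fun_exch_avg.
  by rewrite (Ex_exch_avg theta0 hmu kk tf) subrr mulr0.
rewrite -[X in `|X|]subr0 -g0; apply: Ex_close => //; first exact: ltW.
move=> x Ox; rewrite exch_genE//.
apply: (HF (fun i j => exch_avg f i j x - f x)).
- by move=> i j ijA; exact (@exch_incr_bounded _ _ f A x M tf fM i j ijA).
- by move=> i j ij ijA; exact: (exch_incr_adapted x fA).
Qed.

(** The constant family [m] also solves the forward equation. Uniqueness applies to the difference
    with [Z] trivial, and K = 2 because two expectations are bounded. *)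
Lemma Ex_law_invariant f t : test_fun f -> 0 <= t -> Ex Om (law t) f = Ex Om m f.
Proof.
move=> tf t0; apply/eqP; rewrite -subr_eq0; apply/eqP.
apply: (@delta_eq0 _ _ _ _ p hp Om (fun f i j => exch_avg f i j) (exch_gen p)
  _ _ _ _ _ (fun=> True) _ (fun t f => Ex Om (law t) f - Ex Om m f) 2) => //.
- by move=> g x tg _; exact: exch_genE.
- by move=> g i j; exact: test_fun_exch_avg.
- by move=> g i j A; exact: exch_avg_supported.
- by move=> g i j x M tg; exact: exch_avg_norm_le.
- by move=> g A x; exact: exch_incr_adapted.
- move=> s c g h s0 bg bh.
  by rewrite !ExD ?ExZ//; [ring|exact: bmeasZ|exact: bmeasZ].
- move=> s g M s0 M0 bg gM; rewrite mulr_natl mulr2n.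
  by apply: le_trans (ler_normB _ _) _; apply: lerD; exact: Ex_norm_le.
- by move=> g; exact: (bmeas_generator mOm hX hL).
- move=> g s tg s0; rewrite Ex_exch_gen//.
  by apply: is_deriveB; exact: (flow_is_derive mOm hX hL).
- move=> g tg; apply: cvgB; last exact: cvg_cst.
  rewrite (_ : Ex _ (law 0) _ = Ex Om m g).
    exact: (flow_cvg0 mOm hX hL m0 tg).
  by rewrite Ex_flow0//; exact: test_fun_bmeas.
- move=> g tg _; rewrite Ex_flow0 ?subrr//; exact: test_fun_bmeas.
Qed.

Lemma test_fun_box (C : set (config S R)) : boxes C -> test_fun (\1_C : config S R -> R).
Proof.
move=> [A [B [mB B1 ->]]]; split.
- by apply: measurable_indic; exact: measurable_box.
- exists A => x y xy; rewrite !indicE; congr (_%:R); congr nat_of_bool.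
  by apply/idP/idP; rewrite !inE (boxE B1) /= => h k kA; have := h k kA; rewrite xy.
- by exists 1 => x; rewrite indicE; case: (_ \in _); rewrite ?normr1 ?normr0.
Qed.

Lemma product_gamma_invariant : invariant_measure Om P X mu.
Proof.
move=> t A t0 mA.
have law0 : law t (~` Om) = 0%E by exact: flow_supp.
have Ex_ind (m' : giry (config S R) R) C : measurable C -> m' (~` Om) = 0%E ->
    (Ex Om m' (\1_C))%:E = m' C.
  move=> mC m'0; rewrite -(Ex_restrict mOm m'0); last first.
    split; first exact: measurable_indic.
    by exists 1 => x _; rewrite indicE; case: (_ \in _); rewrite ?normr1 ?normr0.
  rewrite /Ex /Rintegral integral_indic// setIT fineK//.
  exact: fin_num_measure.
transitivity (law t A).
  rewrite /law flowE// -/(giry_int m _) (giry_int_supp mOm m0)//.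
  - by apply: eq_integral => x; rewrite inE => Ox; rewrite transitionE// ger0_norm.
  - exact: (measurableT_comp (measurable_giry_ev mA) (measurable_transition mOm hX t)).
apply: (eq_measure_boxes (m1 := law t) (m2 := mu)) => //.
  by rewrite ltey_eq fin_num_measure.
move=> C bC.
have mC : measurable C by have [A' [B [mB _ ->]]] := bC; exact: measurable_box.
transitivity (Ex Om (law t) (\1_C))%:E; first exact: (esym (Ex_ind (law t) C mC law0)).
rewrite Ex_law_invariant//; last exact: test_fun_box.
exact: (Ex_ind m C mC m0).
Qed.

End invariance.

Theorem theorem3p1 (R : realType) (S : countType) (p : S -> S -> R)
    (hp : symmetric_irreducible p)
    (d : measure_display) (W : measurableType d)
    (P : config S R -> probability W R) (X : R -> W -> config S R)
    (hX : markov_process (Omega R S) P X)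
    (hL : has_generator (Omega R S) P X (exch_gen p))
    (d' : measure_display) (W' : measurableType d')
    (Q : config S nat -> probability W' R) (Y : R -> W' -> config S nat)
    (hY : markov_process [set: config S nat] Q Y)
    (hL' : has_generator [set: config S nat] Q Y (dual_gen p)) :
  (forall (xi : config S nat) (x : config S R) (t : R),
     finite_config R xi -> Omega R S x -> 0 < t ->
     ('E_(P x)[fun w => dual_poly xi (X t w)] =
      'E_(Q xi)[fun w => dual_poly (Y t w) x])%E) /\
  (forall (theta : R) (mu : probability (config S R) R),
     0 < theta -> is_product_measure (gamma2 theta) mu ->
     invariant_measure (Omega R S) P X mu).
Proof.
split=> [xi x t xifin Ox t0|theta mu theta0 hmu].
  have [N Nxi] := finite_config_fin_conf xifin.
  exact: (expectation_dual_poly hp hX hL hY hL' Nxi Ox (ltW t0)).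
exact: (product_gamma_invariant hp hX hL theta0 hmu).
Qed.
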